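(* Let $1<p<\infty$ and let $\Omega\subseteq\mathbb{R}^N$ be a non-empty open set. Then \[ \lambda_p(\Omega)=\min\mathfrak{S}_p(\Omega), \] where $\mathfrak{S}_p(\Omega)=\mathfrak{S}_{\mathrm{ess},p}(\Omega)\cup\mathfrak{S}_{\mathrm{eigen},p}(\Omega)$ is the variational spectrum of the Dirichlet $p$-Laplacian on $\Omega$.
   Context: $B_R=\{x\in\mathbb{R}^N: |x|<R\}$. For an open set $A\subseteq\mathbb{R}^N$, $\lambda_p(A)=\inf\{\int_A|\nabla\varphi|^p\,dx : \varphi\in C^\infty_0(A),\ \int_A|\varphi|^p\,dx=1\}$. $W^{1,p}_0(\Omega)$ is the closure of $C^\infty_0(\Omega)$ in $W^{1,p}(\Omega)$, endowed with the norm $\|\varphi\|_{W^{1,p}(\Omega)}=(\int_\Omega|\varphi|^p\,dx+\int_\Omega|\nabla\varphi|^p\,dx)^{1/p}$, and $W^{-1,p'}(\Omega)$ is its topological dual with the dual norm, $p'=p/(p-1)$. For $u\in W^{1,p}_0(\Omega)$, $-\Delta_p u\in W^{-1,p'}(\Omega)$ is defined by $\langle-\Delta_p u,\varphi\rangle=\int_\Omega\langle|\nabla u|^{p-2}\nabla u,\nabla\varphi\rangle\,dx$, and $|u|^{p-2}u$ is identified with the functional $\varphi\mapsto\int_\Omega|u|^{p-2}u\,\varphi\,dx$. Eigenvalues: $\lambda\in\mathfrak{S}_{\mathrm{eigen},p}(\Omega)$ if and only if $\lambda\in\mathbb{R}$ and there is $u\in W^{1,p}_0(\Omega)\setminus\{0\}$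 with $\int_\Omega\langle|\nabla u|^{p-2}\nabla u,\nabla\varphi\rangle\,dx=\lambda\int_\Omega|u|^{p-2}u\,\varphi\,dx$ for every $\varphi\in W^{1,p}_0(\Omega)$. A constrained Palais-Smale sequence at the level $\lambda\in\mathbb{R}$ is a sequence $\{u_n\}_{n\in\mathbb{N}}\subseteq W^{1,p}_0(\Omega)$ such that: (i) $\|u_n\|_{L^p(\Omega)}=1$ for every $n$; (ii) $\lim_{n\to\infty}\int_\Omega|\nabla u_n|^p\,dx=\lambda$; (iii) $\lim_{n\to\infty}\|-\Delta_p u_n-\lambda|u_n|^{p-2}u_n\|_{W^{-1,p'}(\Omega)}=0$. It is singular if $\lim_{n\to\infty}\|u_n\|_{L^p(\Omega\cap B_R)}=0$ for every $R>0$. Variational essential spectrum: $\mathfrak{S}_{\mathrm{ess},p}(\Omega)=\{\lambda : \text{there exists a singular constrained Palais-Smale sequence at the level }\lambda\}$. *)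

(* Defs.v *)
From HB Require Import structures.
From mathcomp Require Import all_boot all_order all_algebra.
From mathcomp Require Import all_classical all_reals all_analysis.

Set Implicit Arguments.
Unset Strict Implicit.
Unset Printing Implicit Defensive.

Import Order.TTheory GRing.Theory Num.Theory.
Import numFieldTopology.Exports numFieldNormedType.Exports.

Local Open Scope classical_set_scope.
Local Open Scope ring_scope.

Definition measure_rV_display : measure_display -> measure_display.
Proof. exact. Qed.

(* The product sigma-algebra on 'rV[T]_n, generated by the coordinates; for
   T := R these are the Borel sets. *)
Section measurable_rV.
Context {d} {T : sigmaRingType d}.
Variable n : nat.

Let coors : 'I_n -> 'rV[T]_n -> T := fun i x => x ord0 i.

Let rV_set0 : g_sigma_preimage coors set0.
Proof. exact: sigma_algebra0. Qed.

Let rV_setC A : g_sigma_preimage coors A -> g_sigma_preimage coors (~` A).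
Proof. exact: sigma_algebraC. Qed.

Let rV_bigcup (F : (set 'rV[T]_n)^nat) :
  (forall i, g_sigma_preimage coors (F i)) ->
  g_sigma_preimage coors (\bigcup_i (F i)).
Proof. exact: sigma_algebra_bigcup. Qed.

HB.instance Definition _ := @isMeasurable.Build (measure_rV_display d)
  'rV[T]_n (g_sigma_preimage coors) rV_set0 rV_setC rV_bigcup.

End measurable_rV.

Lemma measurable_coord d (T : sigmaRingType d) n (i : 'I_n) :
  measurable_fun [set: 'rV[T]_n] (fun x : 'rV[T]_n => x ord0 i).
Proof.
move=> _ Y mY; rewrite setTI; apply: sub_sigma_algebra => /=.
rewrite -bigcup_seq/=; exists i => /=; first by rewrite mem_index_enum.
by exists Y => //; rewrite setTI.
Qed.

Lemma measurable_fun_rVP d1 d2 (T1 : measurableType d1) (T2 : measurableType d2)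
    n (f : T1 -> 'rV[T2]_n) :
  measurable_fun [set: T1] f <->
  forall i, measurable_fun [set: T1] (fun x => f x ord0 i).
Proof.
split=> [mf i|mf].
  by apply: (measurableT_comp (@measurable_coord _ _ _ i)).
apply: (measurability (\big[setU/set0]_(i < n)
  preimage_set_system setT (fun x : 'rV[T2]_n => x ord0 i) measurable)) => //.
move=> _ [B + <-]; rewrite -bigcup_seq => -[i _ [C mC <-]].
by rewrite setTI; exact: mf.
Qed.

Section lebesgue_rV.
Context {R : realType}.

Definition consrV n (z : R * 'rV[R]_n) : 'rV[R]_n.+1 :=
  \row_i oapp (z.2 ord0) z.1 (unlift ord0 i).

Lemma measurable_consrV n : measurable_fun [set: R * 'rV[R]_n] (@consrV n).
Proof.
apply/measurable_fun_rVP => i; rewrite /consrV.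
under eq_fun do rewrite mxE.
case: unliftP => [j|] _ /=; last exact: measurable_fst.
exact: (measurableT_comp (@measurable_coord _ _ _ j) measurable_snd).
Qed.

Section step.
Variables (n : nat) (m : {sigma_finite_measure set 'rV[R]_n -> \bar R}).

Definition lebesgue_cons : set 'rV[R]_n.+1 -> \bar R :=
  pushforward (lebesgue_measure \x m)%E (@consrV n).

HB.instance Definition _ := Measure.copy lebesgue_cons
  (measure_function_pushforward__canonical__measure_function_Measure
    (lebesgue_measure \x m)%E (@measurable_consrV n)).

Let lebesgue_cons_sigma_finite : sigma_finite setT lebesgue_cons.
Proof.
have /sigma_finiteP[F [TF ndF Foo]] := sigma_finiteT
  [the {sigma_finite_measure set (measurableTypeR R) -> \bar R} of
   @lebesgue_measure R].
have /sigma_finiteP[G [TG ndG Goo]] := sigma_finiteT m.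
exists (fun k => [set x : 'rV[R]_n.+1 | F k (x ord0 ord0) /\
                   G k (\row_j x ord0 (lift ord0 j))]).
  apply/esym/seteqP; split=> // x _.
  have [k _ Fk] : (\bigcup_i F i) (x ord0 ord0) by rewrite -TF.
  have [l _ Gl] : (\bigcup_i G i) (\row_j x ord0 (lift ord0 j)) by rewrite -TG.
  exists (maxn k l) => //; split.
    by move: Fk; exact/subsetPset/ndF/leq_maxl.
  by move: Gl; exact/subsetPset/ndG/leq_maxr.
move=> k; have [mFk Fkoo] := Foo k; have [mGk Gkoo] := Goo k; split.
  apply: measurableI.
    by rewrite -[X in measurable X]setTI; exact: (measurable_coord ord0).
  rewrite -[X in measurable X]setTI.
  have mtail : measurable_fun [set: 'rV[R]_n.+1]
      (fun x : 'rV[R]_n.+1 => \row_j x ord0 (lift ord0 j)).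
    apply/measurable_fun_rVP => j; under eq_fun do rewrite mxE.
    exact: measurable_coord.
  exact: mtail.
rewrite /lebesgue_cons /pushforward.
rewrite [X in product_measure1 _ _ X](_ : _ = F k `*` G k).
  by rewrite product_measure1E// lte_mul_pinfty// ge0_fin_numE.
apply/seteqP; split=> [[x v]|[x v]] /=; rewrite mxE unlift_none /=;
  by rewrite (_ : \row_j _ = v)//; apply/rowP => j; rewrite !mxE liftK.
Qed.

HB.instance Definition _ := Measure_isSigmaFinite.Build _ _ _ lebesgue_cons
  lebesgue_cons_sigma_finite.
End step.

(* Lebesgue measure on the Borel sets of R^n, as an iterated product of the
   one-dimensional one transported along R * 'rV_n ~ 'rV_n.+1. *)
Fixpoint lebesgue_rV n : {sigma_finite_measure set 'rV[R]_n -> \bar R} :=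
  match n with
  | 0 => [the {sigma_finite_measure set _ -> \bar R} of \d_(0 : 'rV[R]_0)]
  | k.+1 => [the {sigma_finite_measure set _ -> \bar R} of
             lebesgue_cons (lebesgue_rV k)]
  end.

End lebesgue_rV.

Lemma lebesgue_rV_box (R : realType) n (A : 'I_n -> set R) :
  (forall i, measurable (A i)) ->
  lebesgue_rV n [set x : 'rV[R]_n | forall i, A i (x ord0 i)] =
  (\prod_(i < n) lebesgue_measure (A i))%E.
Proof.
elim: n A => [A _|n IH A mA].
  by rewrite big_ord0 /= diracE mem_set// => -[].
rewrite big_ord_recl -IH//= /lebesgue_cons /pushforward.
rewrite [X in product_measure1 _ _ X](_ : _ = A ord0 `*`
    [set x : 'rV[R]_n | forall i, A (lift ord0 i) (x ord0 i)]).
  rewrite product_measure1E//; first exact: mA.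
  rewrite (_ : mkset _ = \bigcap_(i : 'I_n) [set x : 'rV[R]_n | A (lift ord0 i) (x ord0 i)]).
    apply: fin_bigcap_measurable => // i _.
    by rewrite -[X in measurable X]setTI; exact: (measurable_coord i).
  by apply/seteqP; split=> x /= Ax i; [move=> _; exact: Ax|exact: Ax].
apply/seteqP; split=> -[x v] /=.
  move=> Ax; split=> [|i].
    by have := Ax ord0; rewrite mxE unlift_none.
  by have := Ax (lift ord0 i); rewrite mxE liftK.
by move=> [Ax Av] i; rewrite mxE; case: unliftP => [j ->|->] /=.
Qed.

Section dirichlet_p_laplacian.
Context {R : realType} {N : nat}.
Local Notation mu := (@lebesgue_rV R N).
Implicit Types (p r l : R) (A D Omega : set 'rV[R]_N) (x : 'rV[R]_N).
Implicit Types (f phi : 'rV[R]_N -> R) (g : 'rV[R]_N -> 'rV[R]_N).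

Definition dotp (x y : 'rV[R]_N) : R := \sum_i x ord0 i * y ord0 i.

(* The norm `|x| of 'rV[R]_N is the sup norm, hence a separate definition. *)
Definition enorm x : R := Num.sqrt (dotp x x).

Definition eball r : set 'rV[R]_N := [set x | enorm x < r].

Definition partial (i : 'I_N) f : 'rV[R]_N -> R :=
  fun x => 'D_(delta_mx ord0 i) f x.

Definition gradient f : 'rV[R]_N -> 'rV[R]_N := fun x => \row_i partial i f x.

Definition iter_partial (s : seq 'I_N) f := foldr partial f s.

(* 'D_v f x is a total function, so that existence of the partial derivatives
   has to be required. *)
Definition smooth f := forall s : seq 'I_N,
  continuous (iter_partial s f) /\
  forall i x, derivable (iter_partial s f) x (delta_mx ord0 i).

Definition test_function A : set ('rV[R]_N -> R) :=
  [set phi | [/\ smooth phi,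
    compact (closure [set x | phi x != 0]) &
    closure [set x | phi x != 0] `<=` A]].

Definition pint p D f : \bar R := (\int[mu]_(x in D) (`|f x| `^ p)%:E)%E.

Definition pint_grad p D g : \bar R :=
  (\int[mu]_(x in D) (enorm (g x) `^ p)%:E)%E.

Definition Lp_norm p D f : \bar R := 'N[mu]_p%:E[(EFin \o f) \_ D]%E.

Definition lambda_p p A : \bar R :=
  ereal_inf [set pint_grad p A (gradient phi) | phi in
    [set phi | test_function A phi /\ pint p A phi = 1%E]].

(* A Sobolev function together with its weak gradient, which is unique almost
   everywhere.  Elements are functions rather than classes modulo equality
   almost everywhere; only their values on Omega matter. *)
Record sobolev p Omega := Sobolev {
  sobolev_fun :> 'rV[R]_N -> R ;
  weak_grad : 'rV[R]_N -> 'rV[R]_N ;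
  sobolev_measurable : measurable_fun Omega sobolev_fun ;
  weak_grad_measurable : measurable_fun Omega weak_grad ;
  sobolev_Lp : (pint p Omega sobolev_fun < +oo)%E ;
  weak_grad_Lp : (pint_grad p Omega weak_grad < +oo)%E ;
  weak_gradP : forall phi (i : 'I_N), test_function Omega phi ->
    \int[mu]_(x in Omega) (sobolev_fun x * partial i phi x) =
    - \int[mu]_(x in Omega) (weak_grad x ord0 i * phi x) }.

Definition sobolev_norm p Omega f g : \bar R :=
  ((pint p Omega f + pint_grad p Omega g) `^ p^-1)%E.

Definition sobolev0 p Omega : set (sobolev p Omega) :=
  [set u : sobolev p Omega | forall e : R, 0 < e ->
    exists2 phi, test_function Omega phi &
    (sobolev_norm p Omega (fun x => u x - phi x)%R
       (fun x => weak_grad u x - gradient phi x)%R < e%:E)%E].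

(* The norm of W^{-1,p'}(Omega), the dual of W^{1,p}_0(Omega) = sobolev0. *)
Definition dual_norm p Omega (F : sobolev p Omega -> R) : \bar R :=
  ereal_sup [set `|F v|%:E | v in
    [set v : sobolev p Omega | sobolev0 v /\
      (sobolev_norm p Omega v (weak_grad v) <= 1)%E]].

(* For p < 2 the value given to 0 `^ (p - 2) is immaterial: it multiplies 0. *)
Definition p_laplacian p Omega (u v : sobolev p Omega) : R :=
  \int[mu]_(x in Omega)
    dotp (enorm (weak_grad u x) `^ (p - 2) *: weak_grad u x) (weak_grad v x).

Definition p_power p Omega (u v : sobolev p Omega) : R :=
  \int[mu]_(x in Omega) (`|u x| `^ (p - 2) * u x * v x).

Definition eigen_spectrum p Omega : set R :=
  [set l | exists u : sobolev p Omega, [/\ sobolev0 u,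
    ~ {ae mu, forall x, Omega x -> u x = 0} &
    forall v : sobolev p Omega, sobolev0 v -> p_laplacian u v = l * p_power u v]].

Definition palais_smale p Omega l (u_ : (sobolev p Omega)^nat) :=
  [/\ forall n, sobolev0 (u_ n),
      forall n, Lp_norm p Omega (u_ n) = 1%E,
      (pint_grad p Omega (weak_grad (u_ n)) @[n --> \oo] --> l%:E)%E &
      dual_norm (fun v => p_laplacian (u_ n) v - l * p_power (u_ n) v)
        @[n --> \oo] --> 0%E].

Definition singular p Omega (u_ : (sobolev p Omega)^nat) :=
  forall r, 0 < r -> (Lp_norm p (Omega `&` eball r) (u_ n) @[n --> \oo] --> 0)%E.

Definition essential_spectrum p Omega : set R :=
  [set l | exists2 u_ : (sobolev p Omega)^nat,
    palais_smale l u_ & singular u_].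

Definition variational_spectrum p Omega : set R :=
  essential_spectrum p Omega `|` eigen_spectrum p Omega.

End dirichlet_p_laplacian.

(* Main.v *)
(** Let l = lambda_p(Omega), P(u) the p-th power of the L^p norm of u and G(u) that of
    its gradient.  By density l P <= G on W^{1,p}_0; testing the eigenvalue
    equation with the eigenfunction itself, or passing to the limit along a
    Palais-Smale sequence, every spectral value is at least l.

    For the converse no variational principle is needed: expanding
    0 <= (G - l P)(u + t v) to first order in t, uniformly in v, gives
      |(G - l P)'(u) v| <= (G(u) - l P(u)) / d + e (G(u) + G(v)),
    so every normalized minimizing sequence u_n of test functions is a
    Palais-Smale sequence.  If it is singular, l is in the essential spectrum.
    Otherwise a subsequence keeps a fixed amount of mass in some ball; by Rellich
    it converges in L^p on bounded sets, and testing the difference of the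
    equations of u_n and u_m with a cutoff of u_n - u_m, the monotonicity of
    a |-> |a|^(p-2) a makes the gradients converge as well.  The limit u is a
    nonzero element of W^{1,p}_0, and testing with cutoffs of u_n yields
    G(u) <= l P(u).  The displayed inequality with G(u) - l P(u) = 0 and e -> 0 is then
    the eigenvalue equation. *)

Require Import Defs.
From mathcomp Require Import all_boot all_order all_algebra.
From mathcomp Require Import all_classical all_reals all_analysis.
From mathcomp Require Import measurable_realfun ring lra.

Import Order.TTheory GRing.Theory Num.Theory.
Import numFieldTopology.Exports numFieldNormedType.Exports.

Local Open Scope classical_set_scope.
Local Open Scope ring_scope.

Set Implicit Arguments.
Unset Strict Implicit.
Unset Printing Implicit Defensive.

(** Two difficulties shape the argument. Mass of a minimizing sequence may escape to infinity, so
    compactness is only local, and lower semicontinuity would not suffice: it bounds the energy of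
    the limit by l, although the norm of the limit may be below 1. Moreover, the classical
    inequalities for |a|^(p-2) a differ for p < 2 and p >= 2. Here the expansion and the
    quantitative monotonicity come from convexity, homogeneity and compactness of the unit ball, at
    the price of an arbitrarily small multiple of |a|^p + |b|^p; this error is harmless because the
    energies stay bounded. For the same reason weighted Young inequalities take the place of
    Hölder's inequality. Minimizing sequences are kept among the test functions. Extended by zero,
    these live on the whole space, so the translation estimates ask nothing of the boundary of
    Omega; and a smooth cutoff times a test function is a test function, so the classical Leibniz
    rule is enough. Convergence on cubes is always strong, hence no weak limit of a nonlinear term
    has to be identified. *)

Lemma continuous_sum (R : realType) (T : topologicalType) (I : Type) (s : seq I)
    (F : I -> T -> R) (t : T) : (forall i, {for t, continuous (F i)}) ->
  {for t, continuous (fun x => \sum_(i <- s) F i x)}.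
Proof.
move=> cF; elim: s => [|i s IH].
  rewrite (_ : (fun _ => _) = fun=> 0); first exact: cst_continuous.
  by apply/funext => y; rewrite big_nil.
rewrite (_ : (fun _ => _) = (F i \+ (fun y => \sum_(j <- s) F j y))).
  exact: (continuousD (cF i) IH).
by apply/funext => y; rewrite big_cons.
Qed.

(** * Powers and the field a |-> |a|^(p-2) a *)

Section scalar_powers.
Context {R : realType}.
Implicit Types (p x y e : R).

Lemma powRB1M p x : 1 < p -> 0 <= x -> x `^ (p - 1) * x = x `^ p.
Proof. by move=> p1 x0; rewrite mulrC mulr_powRB1// (lt_trans _ p1). Qed.

(** The tangent line of t^p at [x], obtained from Young's inequality for [y] and x^(p-1) with the
    exponents p and p/(p-1). *)
Lemma powR_conv p x y : 1 < p -> 0 <= x -> 0 <= y ->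
  x `^ p + p * (x `^ (p - 1) * (y - x)) <= y `^ p.
Proof.
move=> p1 x0 y0; have p0 : 0 < p by rewrite (lt_trans _ p1).
have pm : 0 < p - 1 by rewrite subr_gt0.
have pn : p != 0 by rewrite gt_eqF.
have pmn : p - 1 != 0 by rewrite gt_eqF.
have := @conjugate_powR R y (x `^ (p - 1)) p (p / (p - 1)) y0 (powR_ge0 _ _) p0.
rewrite divr_gt0// => /(_ isT).
rewrite invf_div (_ : p^-1 + (p - 1) / p = 1); last by field.
move=> /(_ erefl); rewrite -powRrM (_ : (p - 1) * _ = p); last by field.
move=> H; rewrite mulrBr powRB1M// -subr_ge0.
have : 0 <= p * (y `^ p / p + x `^ p * ((p - 1) / p) - y * x `^ (p - 1)).
  by rewrite mulr_ge0 ?(ltW p0)// subr_ge0.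
by congr (0 <= _); field.
Qed.

(** According to whether [y] is below [e * x] or above it, one of the two terms on the right already
    suffices. Sharp constants are irrelevant; what matters is that the first coefficient can be as
    small as desired. *)
Lemma powR_young p x y e : 1 < p -> 0 <= x -> 0 <= y -> 0 < e ->
  x `^ (p - 1) * y <= e * x `^ p + e `^ (1 - p) * y `^ p.
Proof.
move=> p1 x0 y0 e0; have [yx|xy] := leP y (e * x).
  rewrite (@le_trans _ _ (e * x `^ p))//; last first.
    by rewrite lerDl mulr_ge0 ?powR_ge0.
  by rewrite -(powRB1M p1 x0) mulrCA ler_wpM2l ?powR_ge0// mulrC.
rewrite (@le_trans _ _ (e `^ (1 - p) * y `^ p))//; last first.
  by rewrite lerDr mulr_ge0 ?powR_ge0 ?ltW.
rewrite -(powRB1M p1 y0) mulrA ler_wpM2r//.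
rewrite -(ler_pM2l (powR_gt0 (p - 1) e0)) mulrA -powRD; last first.
  by rewrite (gt_eqF e0) implybT.
rewrite subrKA subrr powRr0 mul1r -powRM ?(ltW e0)//.
by rewrite ge0_ler_powR ?nnegrE ?mulr_ge0 ?(ltW e0) ?(ltW xy) ?subr_ge0 ?(ltW p1).
Qed.

Lemma powR_young1 p x y : 1 < p -> 0 <= x -> 0 <= y ->
  x `^ (p - 1) * y <= x `^ p + y `^ p.
Proof. by move=> p1 x0 y0; have := powR_young p1 x0 y0 ltr01; rewrite powR1 !mul1r. Qed.

Lemma powR_add p x y : 1 < p -> 0 <= x -> 0 <= y ->
  (x + y) `^ p <= 2 `^ p * (x `^ p + y `^ p).
Proof.
move=> p1 x0 y0; have p0 : 0 <= p by rewrite ltW// (lt_trans _ p1).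
wlog xy : x y x0 y0 / x <= y => [H|].
  have [|/ltW] := leP x y; first exact: H.
  by move=> yx; rewrite addrC [X in _ * X]addrC; exact: H.
rewrite (@le_trans _ _ ((2 * y) `^ p))//.
  by rewrite ge0_ler_powR ?nnegrE ?mulr_ge0 ?addr_ge0// mulr_natl mulr2n lerD2r.
by rewrite powRM// ler_wpM2l ?powR_ge0// lerDr powR_ge0.
Qed.

End scalar_powers.

(** * Euclidean inner product and norm on R^N *)

Section euclidean.
Context {R : realType} {N : nat}.
Implicit Types (x y z : 'rV[R]_N) (s t : R).

Lemma dotpC x y : dotp x y = dotp y x.
Proof. by apply: eq_bigr => i _; rewrite mulrC. Qed.

Lemma dotpDl x y z : dotp (x + y) z = dotp x z + dotp y z.
Proof. by rewrite -big_split; apply: eq_bigr => i _; rewrite mxE mulrDl. Qed.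

Lemma dotpZl s x y : dotp (s *: x) y = s * dotp x y.
Proof. by rewrite mulr_sumr; apply: eq_bigr => i _; rewrite mxE mulrA. Qed.

Lemma dotpDr x y z : dotp z (x + y) = dotp z x + dotp z y.
Proof. by rewrite dotpC dotpDl !(dotpC z). Qed.

Lemma dotpZr s x y : dotp x (s *: y) = s * dotp x y.
Proof. by rewrite dotpC dotpZl dotpC. Qed.

Lemma dotp0l x : dotp 0 x = 0.
Proof. by rewrite -(scale0r 0) dotpZl mul0r. Qed.

Lemma dotp0r x : dotp x 0 = 0.
Proof. by rewrite dotpC dotp0l. Qed.

Lemma dotpNl x y : dotp (- x) y = - dotp x y.
Proof. by rewrite -scaleN1r dotpZl mulN1r. Qed.

Lemma dotpNr x y : dotp x (- y) = - dotp x y.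
Proof. by rewrite dotpC dotpNl dotpC. Qed.

Lemma dotpBl x y z : dotp (x - y) z = dotp x z - dotp y z.
Proof. by rewrite dotpDl dotpNl. Qed.

Lemma dotpBr x y z : dotp z (x - y) = dotp z x - dotp z y.
Proof. by rewrite dotpDr dotpNr. Qed.

Definition dotpE := (dotpDl, dotpDr, dotpNl, dotpNr, dotpZl, dotpZr).

Lemma dotp_ge0 x : 0 <= dotp x x.
Proof. by apply: sumr_ge0 => i _; rewrite -expr2 sqr_ge0. Qed.

Lemma enorm_ge0 x : 0 <= enorm x.
Proof. exact: sqrtr_ge0. Qed.

Lemma enorm_sq x : enorm x ^+ 2 = dotp x x.
Proof. by rewrite sqr_sqrtr// dotp_ge0. Qed.

Lemma enormZ s x : enorm (s *: x) = `|s| * enorm x.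
Proof. by rewrite /enorm !dotpE mulrA -expr2 sqrtrM ?sqr_ge0// sqrtr_sqr. Qed.

Lemma enormN x : enorm (- x) = enorm x.
Proof. by rewrite -scaleN1r enormZ normrN1 mul1r. Qed.

Lemma enorm0 : enorm (0 : 'rV[R]_N) = 0.
Proof. by rewrite -(scale0r 0) enormZ normr0 mul0r. Qed.

Lemma coord_le_enorm x i : `|x ord0 i| <= enorm x.
Proof.
rewrite -sqrtr_sqr ler_sqrt ?dotp_ge0// /dotp (bigD1 i)//= -expr2 lerDl.
by apply: sumr_ge0 => j _; rewrite -expr2 sqr_ge0.
Qed.

Lemma enorm_eq0 x : enorm x = 0 -> x = 0.
Proof.
by move=> x0; apply/rowP => i; apply/eqP; rewrite mxE -normr_le0 -x0 coord_le_enorm.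
Qed.

(** Cauchy-Schwarz, by expanding the square of [enorm y *: x - enorm x *: y]; zero vectors are split
    off so that the factor of the result can be cancelled. *)
Lemma dotp_le_enorm x y : dotp x y <= enorm x * enorm y.
Proof.
have [/enorm_eq0 ->|x0] := eqVneq (enorm x) 0.
  by rewrite enorm0 mul0r dotp0l.
have [/enorm_eq0 ->|y0] := eqVneq (enorm y) 0.
  by rewrite enorm0 mulr0 dotp0r.
have c0 : 0 < 2 * (enorm x * enorm y).
  by rewrite !mulr_gt0// lt_neqAle enorm_ge0 andbT eq_sym.
have := dotp_ge0 (enorm y *: x - enorm x *: y); rewrite !dotpE (dotpC y x) -!enorm_sq.
rewrite [leRHS](_ : _ = 2 * (enorm x * enorm y) * (enorm x * enorm y - dotp x y)).
  by rewrite pmulr_rge0// subr_ge0.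
by ring.
Qed.

Lemma normr_dotp x y : `|dotp x y| <= enorm x * enorm y.
Proof. by rewrite ler_norml dotp_le_enorm andbT lerNl -dotpNl -(enormN x) dotp_le_enorm. Qed.

Lemma enormD x y : enorm (x + y) <= enorm x + enorm y.
Proof.
rewrite -(@ler_pXn2r _ 2) ?nnegrE ?addr_ge0 ?enorm_ge0// sqrrD !enorm_sq !dotpE (dotpC y x).
have := dotp_le_enorm x y; lra.
Qed.

Lemma enormB x y : enorm (x - y) <= enorm x + enorm y.
Proof. by rewrite (le_trans (enormD _ _))// enormN. Qed.

Lemma enorm_le_sum x : enorm x <= \sum_i `|x ord0 i|.
Proof.
rewrite -(@ler_pXn2r _ 2) ?nnegrE ?sumr_ge0 ?enorm_ge0// enorm_sq expr2 mulr_suml.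
apply: ler_sum => i _; rewrite (le_trans (ler_norm _))// normrM ler_wpM2l//.
by rewrite (bigD1 i)//= lerDl sumr_ge0.
Qed.

Lemma mx_norm_le_enorm x : `|x| <= enorm x.
Proof.
have [->|/mx_norm_neq0[[k i] /= H]] := eqVneq `|x| 0; first exact: enorm_ge0.
by rewrite [leLHS]H ord1 coord_le_enorm.
Qed.

Lemma continuous_dotp (T : topologicalType) (f g : T -> 'rV[R]_N) (t : T) :
  {for t, continuous f} -> {for t, continuous g} ->
  {for t, continuous (fun u => dotp (f u) (g u))}.
Proof.
move=> cf cg; apply: continuous_sum => i; apply: continuousM.
  exact: (continuous_comp cf (@coord_continuous _ _ _ ord0 i _)).
exact: (continuous_comp cg (@coord_continuous _ _ _ ord0 i _)).
Qed.

Lemma enorm_continuous : continuous (@enorm R N).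
Proof.
move=> x; apply: (@continuous_comp _ _ _ (fun x => dotp x x)); last exact: sqrt_continuous.
by apply: continuous_dotp; exact: cvg_id.
Qed.

End euclidean.

(** * Continuity, monotonicity and first-order expansion of the field of the p-Laplacian *)

Section plap.
Context {R : realType} {N : nat} {p : R} (p1 : 1 < p).
Implicit Types (a b : 'rV[R]_N) (s t e : R).

(** The gradient of |a|^p / p. The factor [a] makes it vanish at 0, whatever the power is there. *)
Definition plap p a : 'rV[R]_N := enorm a `^ (p - 2) *: a.

Let p0 : 0 < p. Proof. exact: lt_trans p1. Qed.

Lemma powR_enormB1 a : enorm a `^ (p - 2) * enorm a = enorm a `^ (p - 1).
Proof.
have pm : p - 1 != 0 by rewrite subr_eq0 gt_eqF.
have [->|a0] := eqVneq (enorm a) 0; first by rewrite mulr0 powR0.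
rewrite -{2}(powRr1 (enorm_ge0 a)) -powRD; last by rewrite a0 implybT.
by congr (_ `^ _); ring.
Qed.

Lemma enorm_plap a : enorm (plap p a) = enorm a `^ (p - 1).
Proof. by rewrite enormZ ger0_norm ?powR_ge0// powR_enormB1. Qed.

Lemma dotp_plap a : dotp (plap p a) a = enorm a `^ p.
Proof.
by rewrite dotpZl -enorm_sq expr2 mulrA powR_enormB1 powRB1M ?enorm_ge0.
Qed.

Lemma plapZ s a : 0 <= s -> plap p (s *: a) = s `^ (p - 1) *: plap p a.
Proof.
rewrite le_eqVlt => /predU1P[<-|s0].
  by rewrite scale0r /plap enorm0 scaler0 powR0 ?scale0r// subr_eq0 gt_eqF.
rewrite /plap enormZ gtr0_norm// powRM ?enorm_ge0 ?ltW// !scalerA; congr (_ *: _).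
rewrite mulrAC; congr (_ * _); rewrite -{2}(powRr1 (ltW s0)) -powRD.
  by congr (_ `^ _); ring.
by rewrite (gt_eqF s0) implybT.
Qed.

Lemma dotp_plapBZ s a b : 0 <= s ->
  dotp (plap p (s *: a) - plap p (s *: b)) (s *: a - s *: b) =
  s `^ p * dotp (plap p a - plap p b) (a - b).
Proof.
move=> s0; rewrite (plapZ a s0) (plapZ b s0).
rewrite -(scalerBr (s `^ (p - 1)) (plap p a) (plap p b)) -(scalerBr s a b).
by rewrite dotpZl dotpZr mulrA; congr (_ * _); exact: powRB1M.
Qed.

Lemma normr_dotp_plap a b : `|dotp (plap p a) b| <= enorm a `^ (p - 1) * enorm b.
Proof. by rewrite (le_trans (normr_dotp _ _))// enorm_plap. Qed.

Lemma enorm_conv a b :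
  enorm a `^ p + p * dotp (plap p a) (b - a) <= enorm b `^ p.
Proof.
apply: le_trans (powR_conv p1 (enorm_ge0 a) (enorm_ge0 b)).
rewrite lerD2l ler_wpM2l ?(ltW p0)// dotpBr dotp_plap mulrBr powRB1M ?enorm_ge0// lerD2r.
by rewrite (le_trans (ler_norm _))// normr_dotp_plap.
Qed.

(** At the origin the factor |a|^(p-2) may blow up, so continuity there is read off from the norm
    |a|^(p-1) of the field; elsewhere the field is a product of continuous maps. *)
Lemma plap_continuous : continuous (@plap p).
Proof.
move=> a; have [->|a0] := eqVneq a 0.
  rewrite /continuous_at (_ : plap p 0 = 0); last by rewrite /plap scaler0.
  have F0 : Filter (nbhs (0 : 'rV[R]_N)) by exact: nbhs_filter.
  apply/cvgr0Pnorm_lt => e e0.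
  have := @enorm_continuous R N 0; rewrite /continuous_at enorm0.
  move=> /cvgr0Pnorm_lt /(_ (e `^ (p - 1)^-1)); rewrite powR_gt0// => /(_ isT).
  apply: filterS => x; rewrite ger0_norm ?enorm_ge0// => xe.
  apply: (le_lt_trans (mx_norm_le_enorm _)); rewrite enorm_plap//.
  have pm : 0 < p - 1 by rewrite subr_gt0.
  rewrite (_ : e = (e `^ (p - 1)^-1) `^ (p - 1)).
    by rewrite gt0_ltr_powR ?nnegrE ?enorm_ge0 ?powR_ge0.
  by rewrite -powRrM mulVf ?gt_eqF// powRr1// ltW.
apply: (@continuousZ _ _ _ (fun x => enorm x `^ (p - 2)) id); last exact: cvg_id.
apply: (@continuous_comp _ _ _ (@enorm R N) (fun x => x `^ (p - 2))).
  exact: enorm_continuous.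
apply/differentiable_continuous/derivable1_diffP/derivable_powR.
rewrite in_itv/= andbT lt_neqAle enorm_ge0 andbT eq_sym.
by apply: contra_neq a0; exact: enorm_eq0.
Qed.

(** If the norms A and B differ, Cauchy-Schwarz bounds the product below by (A^(p-1) - B^(p-1)) (A -
    B), which is positive. If they agree, the field is the same positive multiple of [a] and of [b],
    and the product is a multiple of |a - b|^2. *)
Lemma plap_monotone a b : a != b -> 0 < dotp (plap p a - plap p b) (a - b).
Proof.
move=> ab; set A := enorm a; set B := enorm b.
have A0 : 0 <= A := enorm_ge0 a. have B0 : 0 <= B := enorm_ge0 b.
have E : dotp (plap p a - plap p b) (a - b) =
    A `^ p + B `^ p - dotp (plap p a) b - dotp (plap p b) a.
  by rewrite !(dotpBl, dotpBr) !dotp_plap -/A -/B; ring.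
have pm : 0 < p - 1 by rewrite subr_gt0.
have [AB|AB] := eqVneq A B.
  have A1 : 0 < A.
    rewrite lt_neqAle A0 andbT eq_sym; apply: contra_neq ab => A0'.
    by rewrite (enorm_eq0 A0') (@enorm_eq0 _ _ b)// -[LHS]AB.
  rewrite /plap -/A -/B -AB -scalerBr dotpZl mulr_gt0 ?powR_gt0//.
  rewrite -enorm_sq exprn_gt0// lt_neqAle enorm_ge0 andbT eq_sym.
  by apply: contra_neq ab => /enorm_eq0/eqP; rewrite subr_eq0 => /eqP.
rewrite E.
have H1 : dotp (plap p a) b <= A `^ (p - 1) * B.
  by rewrite (le_trans (ler_norm _))// normr_dotp_plap.
have H2 : dotp (plap p b) a <= B `^ (p - 1) * A.
  by rewrite (le_trans (ler_norm _))// normr_dotp_plap.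
suff : 0 < (A `^ (p - 1) - B `^ (p - 1)) * (A - B).
  rewrite -(powRB1M p1 A0) -(powRB1M p1 B0).
  move: (A `^ _) (B `^ _) (dotp _ b) (dotp _ a) H1 H2 => u v c d; clear; lra.
move: AB; rewrite neq_lt => /orP[] AB.
  rewrite nmulr_rgt0 ?subr_lt0//.
  by rewrite gt0_ltr_powR ?nnegrE.
by rewrite mulr_gt0 ?subr_gt0// gt0_ltr_powR ?nnegrE.
Qed.

(* By homogeneity it suffices to treat pairs in the unit ball. *)
Lemma scale_to_ball a b : exists s a' b', [/\ 0 <= s, a = s *: a', b = s *: b',
  enorm a' <= 1 /\ enorm b' <= 1 & s `^ p <= enorm a `^ p + enorm b `^ p].
Proof.
set s := Num.max (enorm a) (enorm b).
have s0 : 0 <= s by rewrite le_max enorm_ge0.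
have sp : s `^ p <= enorm a `^ p + enorm b `^ p.
  by rewrite /s maxEle; case: ifP => _; rewrite ?lerDl ?lerDr powR_ge0.
have [sz|sn] := eqVneq s 0.
  have ea : enorm a = 0 by apply/le_anti; rewrite enorm_ge0 -sz le_max lexx.
  have eb : enorm b = 0 by apply/le_anti; rewrite enorm_ge0 -sz le_max lexx orbT.
  by exists s, 0, 0; rewrite enorm0 !scaler0 ler01 (enorm_eq0 ea) (enorm_eq0 eb) enorm0 sz powR0 ?gt_eqF// addr0.
have sp0 : 0 < s by rewrite lt_neqAle eq_sym sn.
exists s, (s^-1 *: a), (s^-1 *: b); rewrite !scalerA divff// !scale1r !enormZ.
by split=> //; rewrite gtr0_norm ?invr_gt0// !(mulrC s^-1) !ler_pdivrMr// !mul1r !le_max !lexx orbT.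
Qed.

Let K := [set a : 'rV[R]_N | enorm a <= 1].

Let compact_K : compact K.
Proof.
apply: bounded_closed_compact.
  by exists 1; split=> // r r1 a Ka; apply: (le_trans (mx_norm_le_enorm a)); apply: (le_trans Ka); exact: ltW.
apply: (@closed_comp _ _ (@enorm R N) [set x | x <= 1]) => [a _|]; [exact: enorm_continuous|exact: closed_le].
Qed.

(** Both sides are p-homogeneous in the pair ([a], [b]) while [t] is unaffected by a common scaling,
    so the pair may be taken in the unit ball. There the left side is continuous and vanishes at t =
    0, and compactness makes its smallness uniform. *)
Lemma plap_uniform e : 0 < e -> exists2 d, 0 < d & forall t a b, `|t| <= d ->
  `|dotp (plap p (a + t *: b) - plap p a) b| <= e * (enorm a `^ p + enorm b `^ p).
Proof.
move=> e0.
have /compact_near_coveringP cK := compact_setX compact_K compact_K.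
pose h (z : ('rV[R]_N * 'rV[R]_N) * R) :=
  dotp (plap p (z.1.1 + z.2 *: z.1.2) - plap p z.1.1) z.1.2.
have ch : continuous h.
  move=> z; rewrite /h.
  have c11 : {for z, continuous (fun w : ('rV[R]_N * 'rV[R]_N) * R => w.1.1)}.
    by apply: (@continuous_comp _ _ _ fst fst); exact: cvg_fst.
  have c12 : {for z, continuous (fun w : ('rV[R]_N * 'rV[R]_N) * R => w.1.2)}.
    by apply: (@continuous_comp _ _ _ fst snd); [exact: cvg_fst|exact: cvg_snd].
  apply: (@continuous_dotp _ _ _ (fun w : ('rV[R]_N * 'rV[R]_N) * R => plap p (w.1.1 + w.2 *: w.1.2) - plap p w.1.1) (fun w => w.1.2)) => //.
  apply: cvgB.
    apply: (@continuous_comp _ _ _ (fun w : ('rV[R]_N * 'rV[R]_N) * R => w.1.1 + w.2 *: w.1.2)); last exact: plap_continuous.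
    by apply: cvgD => //; apply: cvgZ => //; exact: cvg_snd.
  exact: (continuous_comp c11 (@plap_continuous _)).
have [x _|d /= d0 Hd] := cK R (nbhs (0:R)) (fun t z => `|h (z, t)| < e) _.
  have : nbhs (x, 0 : R) (fun z => `|h z| < e).
    have := ch (x, 0 : R) => /cvgr_norm_lt; apply.
    by rewrite /h/= scale0r addr0 subrr dotp0l normr0.
  case=> -[/= U V] [nU nV] UV; exists (U, V) => // -[y t] /UV.
exists (d / 2); first by rewrite divr_gt0.
move=> t a b td; have [s [a' [b' [s0 -> -> [Ka Kb] sp]]]] := scale_to_ball a b.
rewrite (le_trans _ (ler_wpM2l (ltW e0) sp))//.
rewrite scalerA mulrC -scalerA -scalerDr !plapZ// -scalerBr dotpZl dotpZr.
rewrite mulrA powRB1M// normrM ger0_norm ?powR_ge0// mulrC ler_wpM2r ?powR_ge0// ltW//.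
apply: (Hd t _ (a', b')) => //=.
by rewrite sub0r normrN (le_lt_trans td)// ltr_pdivrMr// ltr_pMr// ltr1n.
Qed.

(** Convexity at the end point [a + t *: b] bounds the increment by the field at that point;
    [plap_uniform] moves the field back to [a]. *)
Lemma enorm_expand e : 0 < e -> exists2 d, 0 < d & forall t a b, `|t| <= d ->
  enorm (a + t *: b) `^ p <= enorm a `^ p + p * t * dotp (plap p a) b +
    p * `|t| * e * (enorm a `^ p + enorm b `^ p).
Proof.
move=> /plap_uniform[d d0 Hd]; exists d => // t a b td; have {}Hd := Hd t a b td.
have := enorm_conv (a + t *: b) a.
rewrite opprD addNKr dotpNr dotpZr mulrN lerBlDr => /le_trans; apply.
have -> : dotp (plap p (a + t *: b)) b =
  dotp (plap p a) b + dotp (plap p (a + t *: b) - plap p a) b.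
  by rewrite dotpBl [RHS]addrC subrK.
rewrite mulrDr mulrDr addrA !mulrA lerD2l -!mulrA ler_wpM2l ?(ltW p0)//.
by rewrite (le_trans (ler_norm _))// normrM ler_wpM2l.
Qed.

(** Quantitative monotonicity for all p > 1 at once. After scaling to the unit ball, pairs closer
    than e^(1/p) are absorbed by the first term; the remaining pairs form a compact set on which
    strict monotonicity has a positive minimum. *)
Lemma enormB_le_plap e : 0 < e -> exists2 C, 0 < C & forall a b,
  enorm (a - b) `^ p <= e * (enorm a `^ p + enorm b `^ p) +
    C * dotp (plap p a - plap p b) (a - b).
Proof.
move=> e0.
pose h (z : 'rV[R]_N * 'rV[R]_N) := dotp (plap p z.1 - plap p z.2) (z.1 - z.2).
have ch : continuous h.
  move=> z; apply: (@continuous_dotp _ _ _ (fun z : 'rV[R]_N * 'rV[R]_N => plap p z.1 - plap p z.2) (fun z => z.1 - z.2)).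
    by apply: cvgB; (apply: continuous_comp; last exact: plap_continuous); [exact: cvg_fst|exact: cvg_snd].
  by apply: cvgB; [exact: cvg_fst|exact: cvg_snd].
have h0 a b : 0 <= h (a, b).
  have [->|/plap_monotone/ltW//] := eqVneq a b.
  by rewrite /h/= !subrr dotp0l.
pose A := (K `*` K) `&` [set z | e `^ p^-1 <= enorm (z.1 - z.2)].
have cA : compact A.
  apply: compact_closedI; first exact: compact_setX.
  apply: (@closed_comp _ _ (fun z : 'rV[R]_N * 'rV[R]_N => enorm (z.1 - z.2)) [set x | e `^ p^-1 <= x]) => [z _|]; last exact: closed_ge.
  apply: (@continuous_comp _ _ _ (fun z : 'rV[R]_N * 'rV[R]_N => z.1 - z.2)); last exact: enorm_continuous.
  by apply: cvgB; [exact: cvg_fst|exact: cvg_snd].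
(* 2^p is the largest value that |a - b|^p can take in the unit ball. *)
have [C C0 HC] : exists2 C, 0 < C & forall z, A z -> 2 `^ p <= C * h z.
  have [A0|/set0P/negP/negPn/eqP A0] := pselect (A !=set0); last first.
    by exists 1 => // z; rewrite A0.
  have [|c /set_mem[_ /= Ac] Hc] := @compact_EVT_min _ _ h A A0 cA.
    by apply: continuous_subspaceT.
  have hc : 0 < h c.
    apply: plap_monotone; apply: contraTneq Ac => ->.
    by rewrite subrr enorm0 -ltNge powR_gt0.
  exists (2 `^ p / h c); first by rewrite divr_gt0// powR_gt0.
  move=> z /mem_set Az; rewrite mulrAC ler_pdivlMr// ler_wpM2l ?powR_ge0//.
  exact: Hc.
exists C => // a b.
have [s [a' [b' [s0 -> -> [Ka Kb] sp]]]] := scale_to_ball a b.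
have E1 : enorm (s *: a' - s *: b') `^ p = s `^ p * enorm (a' - b') `^ p.
  by rewrite -scalerBr enormZ ger0_norm// powRM ?enorm_ge0.
have E2 : dotp (plap p (s *: a') - plap p (s *: b')) (s *: a' - s *: b') =
    s `^ p * h (a', b').
  exact: dotp_plapBZ.
rewrite E1 E2.
apply: le_trans (lerD (ler_wpM2l (ltW e0) sp) (lexx _)).
rewrite [C * _]mulrCA (mulrC e) -mulrDr ler_wpM2l ?powR_ge0//.
have [H|H] := leP (e `^ p^-1) (enorm (a' - b')).
  apply: (@le_trans _ _ (2 `^ p)); last first.
    by rewrite (le_trans (HC (a', b') _))// lerDr ltW.
  rewrite ge0_ler_powR ?nnegrE ?enorm_ge0 ?(ltW p0)//.
  exact: le_trans (enormB _ _) (lerD Ka Kb).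
apply: (@le_trans _ _ e); last by rewrite lerDl mulr_ge0 ?(ltW C0)// h0.
rewrite -[leRHS](powRr1 (ltW e0)) -(@mulVf _ p) ?gt_eqF// powRrM.
by rewrite ge0_ler_powR ?nnegrE ?enorm_ge0 ?powR_ge0 ?(ltW p0) ?(ltW H).
Qed.

End plap.

(** * Lebesgue measure on R^N *)

Section rV_measurability.
Context {R : realType} {N : nat}.
Local Notation X := 'rV[R]_N.

Lemma measurable_ball_rV (x : X) (e : R) : measurable (ball x e).
Proof.
have [e0|e0] := ltP 0 e; last first.
  rewrite (_ : ball x e = set0)//; apply/seteqP; split => // y [].
  by rewrite ltNge e0.
rewrite (_ : ball x e = \bigcap_(i : 'I_N) [set y : X | ball (x ord0 i) e (y ord0 i)]).
  apply: fin_bigcap_measurable => // i _.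
  rewrite -[X in measurable X]setTI; apply: (measurable_coord i) => //.
  by apply: open_measurable; exact: ball_open.
apply/seteqP; split => [y [_ xy] i _|y xy]; first exact: xy.
by split=> // i j; rewrite (ord1 i); exact: xy.
Qed.

(** The sigma-algebra is generated by the coordinates, so an open set has to be exhausted by
    countably many boxes: the balls of the sup norm with rational centre and radius 1/(n+1) that it
    contains. *)
Lemma open_measurable_rV (A : set X) : open A -> measurable A.
Proof.
move=> oA.
pose B (qn : 'rV[rat]_N * nat) : set X := ball (map_mx ratr qn.1 : X) qn.2.+1%:R^-1.
pose F qn : set X := if pselect (B qn `<=` A) then B qn else set0.
rewrite (_ : A = \bigcup_qn F qn).
  apply: countable_bigcupT_measurable => // qn; rewrite /F.
  by case: (pselect (B qn `<=` A)) => /= _; [exact: measurable_ball_rV|exact: measurable0].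
apply/seteqP; split => [x Ax|x [qn _]]; last first.
  by by rewrite /F; case: (pselect (B qn `<=` A)) => //= BA /BA.
have /nbhs_ballP[/= e e0 xeA] := open_nbhs_nbhs (conj oA Ax).
have [n n0] : exists n, (n.+1%:R^-1 : R) < e / 2.
  exists (Num.truncn (e / 2)^-1); rewrite invf_plt ?posrE ?divr_gt0//.
  by rewrite truncnS_gt.
have rx i : exists q : rat, ratr q \in `](x ord0 i - n.+1%:R^-1), (x ord0 i + n.+1%:R^-1)[.
  by apply: rat_in_itvoo; rewrite ltrD2l (@lt_trans _ _ 0)// ?oppr_lt0 ?invr_gt0 ltr0n.
pose q : 'rV[rat]_N := \row_i sval (cid (rx i)).
have Bx : ball (map_mx ratr q : X) n.+1%:R^-1 x.
  split; first by rewrite invr_gt0 ltr0n.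
  move=> i j; rewrite (ord1 i) !mxE; case: cid => r /=; rewrite in_itv/= => /andP[r1 r2].
  by rewrite -ball_normE /= ltr_distl; apply/andP.
exists (q, n) => //; rewrite /F; case: (pselect (B (q, n) `<=` A)) => //= -[]; rewrite /B/=.
apply: subset_trans xeA => y By.
rewrite (splitr e); apply: (@ball_triangle _ _ (map_mx ratr q : X)).
  by apply/ball_sym; apply: le_ball Bx; exact: ltW.
by apply: le_ball By; exact: ltW.
Qed.

Lemma continuous_measurable_rV (f : X -> R) : continuous f ->
  measurable_fun [set: X] f.
Proof.
move=> cf; apply: (measurability _ (RGenOpens.measurableE R)) => _ [_ [a [b ->] <-]].
rewrite setTI; apply: open_measurable_rV; apply: open_comp => [x _|]; first exact: cf.
exact: interval_open.
Qed.

End rV_measurability.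

(** * Translation invariance of Lebesgue measure *)

Section shift_invariance.
Context {R : realType}.
Local Open Scope ereal_scope.

Lemma lebesgue_measure_shift (z : R) (A : set R) : measurable A ->
  pushforward lebesgue_measure
    (fun x : measurableTypeR R => (x + z)%R : measurableTypeR R) A =
  lebesgue_measure A.
Proof.
move=> mA; have ms : measurable_fun [set: measurableTypeR R]
    (fun x : measurableTypeR R => (x + z)%R : measurableTypeR R).
  exact: measurable_funD.
pose nu : {measure set (measurableTypeR R) -> \bar R} :=
  measure_function_pushforward__canonical__measure_function_Measure lebesgue_measure ms.
apply/esym; apply: (@lebesgue_measure_unique R nu) => //= _ [[a b]] _ <-.
rewrite /pushforward.
rewrite (_ : _ @^-1` _ = `](a - z)%R, (b - z)%R]%classic).
  by rewrite !lebesgue_measure_itv/= !lte_fin ltrD2r opprB -!EFinD addrA subrK.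
by apply/seteqP; split => x /=; rewrite !in_itv/= ltrBlDr lerBrDr.
Qed.

Lemma ge0_integral_shiftR (z : R) (f : R -> \bar R) :
  measurable_fun [set: R] f -> (forall x, 0 <= f x) ->
  \int[lebesgue_measure]_x f (x + z)%R = \int[lebesgue_measure]_x f x.
Proof.
move=> mf f0; have ms : measurable_fun [set: measurableTypeR R]
    (fun x : measurableTypeR R => (x + z)%R : measurableTypeR R).
  exact: measurable_funD.
have := @ge0_integral_pushforward _ _ _ _ R _ ms lebesgue_measure setT f measurableT mf.
rewrite preimage_setT => <-//.
by apply: eq_measure_integral => A mA _; exact: lebesgue_measure_shift.
Qed.

Lemma ge0_integral_consrV n (f : 'rV[R]_n.+1 -> \bar R) :
  measurable_fun setT f -> (forall x, 0 <= f x) ->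
  \int[lebesgue_rV n.+1]_x f x =
  \int[lebesgue_measure]_x \int[lebesgue_rV n]_v f (consrV (x, v)).
Proof.
move=> mf f0.
rewrite -[LHS]/(\int[pushforward (lebesgue_measure \x lebesgue_rV n)%E
  (@consrV R n)]_x f x).
rewrite ge0_integral_pushforward//; last exact: measurable_consrV.
rewrite preimage_setT fubini_tonelli1//; last by move=> z; exact: f0.
exact: (measurableT_comp mf (@measurable_consrV R n)).
Qed.

Lemma measurable_shift n (z : 'rV[R]_n) : measurable_fun setT (fun x : 'rV[R]_n => (x + z)%R).
Proof.
apply/measurable_fun_rVP => i; under eq_fun do rewrite mxE.
by apply: measurable_funD => //; exact: measurable_coord.
Qed.

(** Induction on the dimension: Tonelli separates the first coordinate, where the one-dimensional
    invariance applies, from the others. *)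
Lemma ge0_integral_shift n (z : 'rV[R]_n) (f : 'rV[R]_n -> \bar R) :
  measurable_fun setT f -> (forall x, 0 <= f x) ->
  \int[lebesgue_rV n]_x f (x + z)%R = \int[lebesgue_rV n]_x f x.
Proof.
elim: n z f => [|n IH] z f mf f0.
  by apply: eq_integral => x _; congr f; apply/rowP => -[].
rewrite (ge0_integral_consrV mf f0).
have mfz : measurable_fun setT (fun x : 'rV[R]_n.+1 => f (x + z)%R).
  exact: (measurableT_comp mf (measurable_shift z)).
rewrite (ge0_integral_consrV mfz (fun x => f0 (x + z)%R)).
pose z' := (\row_i z ord0 (lift ord0 i))%R.
have E x v : (consrV (x, v) + z = consrV (x + z ord0 ord0, v + z'))%R.
  apply/rowP => i; rewrite !mxE/=; case: unliftP => [j ->|->] //=; by rewrite !mxE.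
have mg : measurable_fun [set: R * 'rV[R]_n] (fun w => f (consrV w)).
  exact: (measurableT_comp mf (@measurable_consrV R n)).
under eq_integral => x _.
  under eq_integral do rewrite E.
  rewrite (IH z' (fun v => f (consrV ((x + z ord0 ord0)%R, v))))//; last first.
    exact: (measurableT_comp mg (measurable_pair1 _)).
  over.
apply: (@ge0_integral_shiftR (z ord0 ord0)
  (fun x => \int[lebesgue_rV n]_v f (consrV (x, v)))) => [|x].
  exact: (measurable_fun_fubini_tonelli_F (fun w => f (consrV w))).
exact: integral_ge0.
Qed.

Lemma integral_shift n (z : 'rV[R]_n) (f : 'rV[R]_n -> \bar R) :
  measurable_fun setT f ->
  \int[lebesgue_rV n]_x f (x + z)%R = \int[lebesgue_rV n]_x f x.
Proof.
move=> mf; rewrite [LHS]integralE [RHS]integralE.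
have Ep := ge0_integral_shift z (measurable_funepos mf).
have En := ge0_integral_shift z (measurable_funeneg mf).
rewrite -Ep// -En//; congr (_ - _); apply: eq_integral => x _.
  by rewrite !funeposE.
by rewrite !funenegE.
Qed.

End shift_invariance.

(** * Smooth functions and test functions *)

Section line_derivative.
Context {R : realType} {V : normedModType R}.
Implicit Types (f : V -> R) (x v : V) (t k : R).

(** Reduces directional derivatives to one-variable calculus along a line, where the chain rule and
    the fundamental theorem apply. *)
Lemma is_derive_lineP f x v t d :
  is_derive (x + t *: v) v f d <-> is_derive t 1 (fun s => f (x + s *: v)) d.
Proof.
have E : (fun h : R => h^-1 *: ((f \o shift (x + t *: v)) (h *: v) - f (x + t *: v))) =
    (fun h : R => h^-1 *: (((fun s => f (x + s *: v)) \o shift t) (h *: (1 : R)) - f (x + t *: v))).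
  by apply/funext => h /=; rewrite [h *: 1]mulr1 scalerDl addrCA.
by split => -[D1 D2]; split; [rewrite /derivable -E|rewrite /derive -E|
  rewrite /derivable E|rewrite /derive E].
Qed.

Lemma is_derive_line f x v t : derivable f (x + t *: v) v ->
  is_derive t 1 (fun s => f (x + s *: v)) ('D_v f (x + t *: v)).
Proof. by move=> /derivableP/is_derive_lineP. Qed.

Lemma is_derive_scale f k x v : derivable f (k *: x) v ->
  is_derive x v (fun y => f (k *: y)) (k * 'D_v f (k *: x)).
Proof.
move=> df; rewrite -{1}[x]addr0 -(scale0r v); apply/is_derive_lineP.
rewrite (_ : (fun s => _) = (fun s => f (k *: x + s *: v)) \o ( *%R k)); last first.
  by apply/funext => s /=; rewrite scalerDr scalerA.
rewrite mulrC; apply: is_derive1_comp.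
  rewrite -{2}[k *: x]addr0 -(scale0r v) -{2}(mulr0 k).
  by apply: is_derive_line; rewrite mulr0 scale0r addr0.
have := @is_deriveZ _ _ _ (id : R -> R) k 0 1 1 (is_derive_id _ _).
by rewrite [X in is_derive _ _ _ X]mulr1.
Qed.

End line_derivative.

Section smooth_functions.
Context {R : realType} {N : nat}.
Local Notation X := 'rV[R]_N.
Implicit Types (f g : X -> R) (S : set (X -> R)).

Lemma smooth_continuous f : smooth f -> continuous f.
Proof. by case/(_ [::]). Qed.

Lemma smooth_derivable f i x : smooth f -> derivable f x (delta_mx ord0 i).
Proof. by case/(_ [::]) => _; exact. Qed.

Lemma smooth_partial f i : smooth f -> smooth (partial i f).
Proof. by move=> sf s; have := sf (rcons s i); rewrite /iter_partial foldr_rcons. Qed.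

(** [smooth] ranges over all iterated partial derivatives; a class stable under partial derivatives
    therefore needs only a check at order zero and one. *)
Lemma smooth_coinduction S : (forall f, S f ->
    [/\ continuous f, (forall i x, derivable f x (delta_mx ord0 i)) &
      forall i, S (partial i f)]) ->
  forall f, S f -> smooth f.
Proof.
move=> HS f Sf s; have : S (iter_partial s f).
  by elim: s => //= i s /HS[_ _]; exact.
by move=> /HS[].
Qed.

(** The algebra generated by [S]: Leibniz' rule leads out of [S] itself, but not out of this
    algebra. *)
Inductive generated S : set (X -> R) :=
| gen_base f : S f -> generated S f
| gen_cst c : generated S (cst c)
| gen_add f g : generated S f -> generated S g -> generated S (f \+ g)
| gen_mul f g : generated S f -> generated S g -> generated S (f \* g).

Lemma partial_cst (c : R) i : partial i (cst c : X -> R) = cst 0.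
Proof. by apply/funext => x; exact: derive_cst. Qed.

Lemma generated_smooth S : (forall f, S f ->
    [/\ continuous f, (forall i x, derivable f x (delta_mx ord0 i)) &
      forall i, generated S (partial i f)]) ->
  forall f, generated S f -> smooth f.
Proof.
move=> HS; apply: smooth_coinduction => f; elim.
- by move=> {}f /HS.
- move=> c; split; first exact: cst_continuous.
    by move=> i x; exact: derivable_cst.
  by move=> i; rewrite partial_cst; exact: gen_cst.
- move=> {}f g _ [cf df pf] _ [cg dg pg]; split.
  + by move=> x; exact: (continuousD (cf x) (cg x)).
  + by move=> i x; exact: derivableD.
  + move=> i; rewrite (_ : partial _ _ = partial i f \+ partial i g).
      exact: gen_add.
    by apply/funext => x; exact: deriveD.
- move=> {}f g Gf [cf df pf] Gg [cg dg pg]; split.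
  + by move=> x; exact: (continuousM (cf x) (cg x)).
  + by move=> i x; exact: derivableM.
  + move=> i; rewrite (_ : partial _ _ = (f \* partial i g) \+ (g \* partial i f)).
      by apply: gen_add; exact: gen_mul.
    by apply/funext => x; exact: deriveM.
Qed.

Let smooth_gen f : generated (@smooth R N) f -> smooth f.
Proof.
apply: generated_smooth => {}f sf; split; first exact: smooth_continuous.
- by move=> i x; exact: smooth_derivable.
- by move=> i; apply: gen_base; exact: smooth_partial.
Qed.

Lemma smooth_cst (c : R) : smooth (cst c : X -> R).
Proof. exact/smooth_gen/gen_cst. Qed.

Lemma smoothD f g : smooth f -> smooth g -> smooth (f \+ g).
Proof. by move=> sf sg; apply/smooth_gen/gen_add; exact: gen_base. Qed.

Lemma smoothM f g : smooth f -> smooth g -> smooth (f \* g).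
Proof. by move=> sf sg; apply/smooth_gen/gen_mul; exact: gen_base. Qed.

Lemma smoothZ (c : R) f : smooth f -> smooth (fun x => c * f x).
Proof. by move=> sf; exact: (smoothM (smooth_cst c)). Qed.

Lemma smoothB f g : smooth f -> smooth g -> smooth (fun x => f x - g x).
Proof.
move=> sf sg; rewrite (_ : (fun _ => _) = f \+ (fun x => -1 * g x)).
  exact: (smoothD sf (smoothZ (-1) sg)).
by apply/funext => x /=; rewrite mulN1r.
Qed.

Lemma partialM f g i : smooth f -> smooth g ->
  partial i (f \* g) = (f \* partial i g) \+ (g \* partial i f).
Proof. by move=> sf sg; apply/funext => x; apply: deriveM; exact: smooth_derivable. Qed.

Lemma partialZ (c : R) f i x : smooth f ->
  partial i (fun x => c * f x) x = c * partial i f x.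
Proof. by move=> sf; apply: deriveZ; exact: smooth_derivable. Qed.

Lemma gradientM f g x : smooth f -> smooth g ->
  gradient (f \* g) x = f x *: gradient g x + g x *: gradient f x.
Proof. by move=> sf sg; apply/rowP => i; rewrite !mxE partialM. Qed.

Lemma gradientZ c f x : smooth f -> gradient (fun y => c * f y) x = c *: gradient f x.
Proof. by move=> sf; apply/rowP => i; rewrite !mxE partialZ. Qed.

Lemma gradientB f g x : smooth f -> smooth g ->
  gradient (fun y => f y - g y) x = gradient f x - gradient g x.
Proof.
move=> sf sg; apply/rowP => i; rewrite !mxE.
by apply: deriveB; exact: smooth_derivable.
Qed.

Lemma partial_scale f k i x : smooth f ->
  partial i (fun y => f (k *: y)) x = k * partial i f (k *: x).
Proof. by move=> sf; apply: (@derive_val _ _ _ _ _ _ _ (is_derive_scale _)); exact: smooth_derivable. Qed.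

Lemma smooth_scale f k : smooth f -> smooth (fun y => f (k *: y)).
Proof.
(* The stable class carries a constant factor because each derivative brings out one more [k]. *)
move=> sf; apply: (@smooth_coinduction [set h | exists c g, smooth g /\ h = fun y => c * g (k *: y)]); last first.
  by exists 1, f; split => //; apply/funext => y; rewrite mul1r.
move=> _ [c [g [sg ->]]]; have dg i x : is_derive x (delta_mx ord0 i) (fun y => g (k *: y)) (k * partial i g (k *: x)).
  by apply: is_derive_scale; exact: smooth_derivable.
split.
- move=> x; apply: continuousM; first exact: cst_continuous.
  apply: (@continuous_comp _ _ _ (fun y : X => k *: y) g); last exact: smooth_continuous.
  exact: scaler_continuous.
- by move=> i x; apply: derivableM; [exact: derivable_cst|exact: ex_derive].
- move=> i; exists (c * k), (partial i g); split; first exact: smooth_partial.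
  apply/funext => x; rewrite /partial.
  rewrite [LHS](@deriveZ _ _ _ (fun y => g (k *: y)) c); last exact: ex_derive.
  by rewrite derive_val -mulrA.
Qed.

End smooth_functions.

(** * Supports and test functions *)

Section test_functions.
Context {R : realType} {N : nat}.
Local Notation X := 'rV[R]_N.
Implicit Types (f g : X -> R) (A : set X) (x : X).

Definition supp f : set X := closure [set x | f x != 0].

Lemma closure_min (A B : set X) : closed B -> A `<=` B -> closure A `<=` B.
Proof. by move=> cB AB; rewrite [B](closure_id B).1//; exact: closureS. Qed.

Lemma notin_supp f x : ~ supp f x -> f x = 0.
Proof. by move=> H; apply/eqP/negPn/negP => f0; apply: H; exact: subset_closure. Qed.

Lemma supp_subset f g : (forall x, ~ supp f x -> g x = 0) -> supp g `<=` supp f.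
Proof.
move=> H; apply: closure_min; first exact: closed_closure.
by move=> x /= gx; apply: contrapT => /H gx0; rewrite gx0 eqxx in gx.
Qed.

Lemma partial_notin_supp f i x : ~ supp f x -> partial i f x = 0.
Proof.
move=> fx; rewrite /partial (@near_eq_derive _ _ _ _ (cst 0)) ?derive_cst//.
have : open (~` supp f) by apply: closed_openC; exact: closed_closure.
move=> oS; apply: filterS (open_nbhs_nbhs (conj oS fx)) => y.
exact: notin_supp.
Qed.

Lemma test_supp A f g : smooth g -> (forall x, ~ supp f x -> g x = 0) ->
  test_function A f -> test_function A g.
Proof.
move=> sg /supp_subset fg [sf cf fA]; split => //; last exact: subset_trans fA.
by apply: subclosed_compact cf fg; exact: closed_closure.
Qed.

Lemma test_smooth A f : test_function A f -> smooth f. Proof. by case. Qed.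

Lemma test_partial A f i : test_function A f -> test_function A (partial i f).
Proof.
move=> tf; apply: test_supp (tf); first exact/smooth_partial/(test_smooth tf).
by move=> x; exact: partial_notin_supp.
Qed.

Lemma testM A f g : smooth g -> test_function A f -> test_function A (g \* f).
Proof.
move=> sg tf; apply: test_supp (tf); first exact/smoothM/(test_smooth tf).
by move=> x /notin_supp /= ->; rewrite mulr0.
Qed.

Lemma testZ A c f : test_function A f -> test_function A (fun x => c * f x).
Proof. by apply: testM; exact: smooth_cst. Qed.

Lemma testB A f g : test_function A f -> test_function A g ->
  test_function A (fun x => f x - g x).
Proof.
move=> [sf cf fA] [sg cg gA].
have H : supp (fun x => f x - g x) `<=` supp f `|` supp g.
  apply: closure_min; first by apply: closedU; exact: closed_closure.
  move=> x /= fgx; apply: contrapT => /not_orP[/notin_supp fx /notin_supp gx].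
  by rewrite fx gx subrr eqxx in fgx.
split; [exact: smoothB| |].
  by apply: subclosed_compact (compactU cf cg) H; exact: closed_closure.
by apply: (subset_trans H) => x [/fA|/gA].
Qed.

Lemma testS A B f : A `<=` B -> test_function A f -> test_function B f.
Proof. by move=> AB [sf cf fA]; split => //; exact: subset_trans AB. Qed.

Lemma test_out A f x : test_function A f -> ~ A x -> f x = 0.
Proof. by move=> [_ _ fA] Ax; apply: notin_supp => /fA. Qed.

Lemma gradient_out A f x : test_function A f -> ~ A x -> gradient f x = 0.
Proof.
by move=> [_ _ fA] Ax; apply/rowP => i; rewrite !mxE partial_notin_supp// => /fA.
Qed.

Lemma test_box A f : test_function A f ->
  exists2 r, 0 < r & forall x, ~ supp f x \/ `|x| <= r.
Proof.
move=> [sf /compact_bounded[r [rr H]] _]; exists (Num.max 1 (r + 1)).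
  by rewrite lt_max ltr01.
move=> x; have [fx|fx] := pselect (supp f x); [right|by left].
by apply: H fx; rewrite lt_max ltrDl ltr01 orbT.
Qed.

Lemma test_bounded A f : test_function A f ->
  exists2 M, 0 < M & forall x, `|f x| <= M.
Proof.
move=> [sf cf _].
have : compact (f @` supp f).
  by apply: continuous_compact => //; apply: continuous_subspaceT; exact: smooth_continuous.
move=> /compact_bounded[r [rr H]]; exists (Num.max 1 (r + 1)).
  by rewrite lt_max ltr01.
move=> x; have [fx|/notin_supp ->] := pselect (supp f x).
  by apply: H; [rewrite lt_max ltrDl ltr01 orbT|exists x].
by rewrite normr0 le_max ler01.
Qed.

Lemma gradient_bounded A f : test_function A f ->
  exists2 M, 0 < M & forall x, enorm (gradient f x) <= M.
Proof.
move=> tf; have /choice[M HM] i : exists M, 0 < M /\ forall x, `|partial i f x| <= M.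
  by have [M M0 HM] := test_bounded (test_partial i tf); exists M.
exists (1 + \sum_i M i) => [|x].
  by rewrite ltr_pwDl// sumr_ge0// => i _; rewrite ltW// (HM i).1.
rewrite (le_trans (enorm_le_sum _))// (@le_trans _ _ (\sum_i M i)) ?lerDr//.
by apply: ler_sum => i _; rewrite mxE; exact: (HM i).2.
Qed.

Lemma measurable_smooth f : smooth f -> measurable_fun [set: X] f.
Proof. by move=> /smooth_continuous; exact: continuous_measurable_rV. Qed.

Lemma measurable_gradient f : smooth f -> measurable_fun [set: X] (gradient f).
Proof.
move=> sf; apply/measurable_fun_rVP => i; under eq_fun do rewrite mxE.
by apply: (@measurable_smooth (partial i f)); exact: smooth_partial.
Qed.

End test_functions.

(** * Smooth bumps and cutoffs *)

Section bump.
Context {R : realType}.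
Implicit Types (P : {poly R}) (t y : R).

(* These functions P(1/t) exp(-1/t), extended by 0, are closed under derivation. *)
Definition flat P t : R := if 0 < t then P.[t^-1] * expR (- t^-1) else 0.

(** Coefficient by coefficient: y^i exp(-y) is at most i! by the exponential series. *)
Lemma poly_expR_bounded P : exists2 C, 0 <= C & forall y, 0 < y ->
  `|P.[y] * expR (- y)| <= C.
Proof.
exists (\sum_(i < size P) `|P`_i| * i`!%:R) => [|y y0].
  by apply: sumr_ge0 => i _; rewrite mulr_ge0.
rewrite horner_coef mulr_suml (le_trans (ler_norm_sum _ _ _))//.
apply: ler_sum => i _; rewrite -mulrA normrM ler_wpM2l//.
rewrite ger0_norm ?mulr_ge0 ?exprn_ge0 ?expR_ge0 ?(ltW y0)// expRN ler_pdivrMr ?expR_gt0//.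
case: (i : nat) => [|n]; first by rewrite expr0 fact0 mul1r -expR0 ler_expR ltW.
rewrite mulrC -ler_pdivrMr ?ltr0n ?fact_gt0//.
by rewrite (le_trans _ (expR_ge1Dxn n (ltW y0)))// lerDr.
Qed.

(** The previous bound for X^2 P at 1/t. A quadratic bound at 0 makes the function differentiable
    there with derivative 0. *)
Lemma flat_quadratic P : exists2 C, 0 <= C & forall t, `|flat P t| <= C * t ^+ 2.
Proof.
have [C C0 HC] := poly_expR_bounded ('X^2 * P); exists C => // t; rewrite /flat.
case: ifPn => t0; last by rewrite normr0 mulr_ge0// sqr_ge0.
have := HC t^-1; rewrite invr_gt0 => /(_ t0).
rewrite hornerM hornerXn -mulrA normrM ger0_norm ?sqr_ge0// exprVn mulrC.
by rewrite ler_pdivrMr// exprn_gt0.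
Qed.

(** The derivative of P(1/t) exp(-1/t) is t^-2 (P - P')(1/t) exp(-1/t). *)
Definition flat_deriv P : {poly R} := 'X^2 * (P - P^`()).

Lemma is_derive_flat P t : is_derive t 1 (flat P) (flat (flat_deriv P) t).
Proof.
have [t0|t0|->] := ltgtP t 0.
- rewrite {2}/flat ltNge (ltW t0)/=.
  apply: (@near_eq_is_derive _ _ _ (cst 0) (flat P)).
    near=> s; rewrite /flat ltNge (_ : s <= 0)//; near: s.
    by apply: filterS (lt_nbhsl t0) => s /ltW.
- rewrite {2}/flat t0.
  have dinv : is_derive t 1 (fun s : R => s^-1) (- t ^- 2).
    have := @is_deriveV R id t 1 1; rewrite /= gt_eqF// => /(_ isT (is_derive_id _ _)).
    by rewrite [X in is_derive _ _ _ X -> _]mulr1.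
  have d1 : is_derive t 1 (fun s : R => P.[s^-1]) (P^`().[t^-1] * - t ^- 2).
    by apply: (@is_derive1_comp _ (horner P) (fun s => s^-1)); exact: is_derive_poly.
  have d2 : is_derive t 1 (fun s : R => expR (- s^-1)) (expR (- t^-1) * t ^- 2).
    apply: (@is_derive1_comp _ expR (fun s => - s^-1)).
    by rewrite -[t ^- 2]opprK; exact: is_deriveN.
  have d3 := is_deriveM d1 d2; apply: is_derive_eq.
    apply: near_eq_is_derive d3; near=> s; rewrite /flat ifT//; near: s.
    exact: lt_nbhsr.
  rewrite /flat_deriv hornerM hornerXn hornerD hornerN -exprVn; rewrite /GRing.scale/=; ring.
- have [C C0 HC] := flat_quadratic P.
  rewrite {2}/flat ltxx.
  have F0 : flat P 0 = 0 by rewrite /flat ltxx.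
  have H : h^-1 *: ((flat P \o shift 0) (h *: 1) - flat P 0) @[h --> 0^'] --> (0 : R).
    rewrite F0.
    apply/cvgr0Pnorm_lt => e e0; near=> h.
    have h0 : h != 0 by near: h; exact: nbhs_dnbhs_neq.
    rewrite /= subr0 addr0 [h *: 1]mulr1 normrZ normfV ltr_pdivrMl ?normr_gt0//.
    rewrite (le_lt_trans (HC h))// -[h ^+ 2]ger0_norm ?sqr_ge0// normrX expr2.
    rewrite mulrA mulrC ltr_pM2l ?normr_gt0//.
    have hC : `|h| < e / (C + 1).
      near: h; apply: dnbhs0_lt; rewrite divr_gt0// ltr_wpDl//.
    rewrite (@le_lt_trans _ _ ((C + 1) * `|h|))// ?ler_wpM2r ?lerDl//.
    by rewrite mulrC -ltr_pdivlMr// ltr_wpDl.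
  by split; [apply/cvg_ex; exists 0|exact: cvg_lim].
Unshelve. all: by end_near. Qed.

End bump.

Section bump_rV.
Context {R : realType} {N : nat}.
Local Notation X := 'rV[R]_N.

Definition flat_coord : set (X -> R) :=
  [set f | exists P a b j, f = fun x : X => flat P (a * x ord0 j + b)].

Lemma flat_coord_smooth (f : X -> R) : generated flat_coord f -> smooth f.
Proof.
apply: generated_smooth => _ [P [a [b [j ->]]]].
have D i (x : X) : is_derive x (delta_mx ord0 i) (fun x : X => flat P (a * x ord0 j + b))
    (flat (flat_deriv P) (a * x ord0 j + b) * (a * (j == i)%:R)).
  rewrite -{1}[x]addr0 -(scale0r (delta_mx ord0 i)); apply/is_derive_lineP.
  set d : R := (j == i)%:R.
  rewrite (_ : (fun s => _) = flat P \o (fun s => a * d * s + (a * x ord0 j + b))); last first.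
    by apply/funext => s /=; congr (flat P _); rewrite !mxE eqxx/= -/d; ring.
  apply: is_derive1_comp; first by rewrite mulr0 add0r; exact: is_derive_flat.
  have := @is_deriveZ _ _ _ (id : R -> R) (a * d) 0 1 1 (is_derive_id _ _).
  rewrite [X in is_derive _ _ _ X]mulr1 => H.
  have C : is_derive (0 : R) (1 : R) (cst (a * x ord0 j + b) : R -> R) 0 by exact: is_derive_cst.
  by have := is_deriveD H C; rewrite addr0.
split.
- move=> x; apply: (@continuous_comp _ _ _ (fun x : X => a * x ord0 j + b) (flat P)).
    apply: (@continuousD _ _ _ (fun x : X => a * x ord0 j) (cst b)); last exact: cst_continuous.
    apply: (@continuousM _ _ (cst a) (fun x : X => x ord0 j)); first exact: cst_continuous.
    exact: coord_continuous.
  have := is_derive_flat P (a * x ord0 j + b) => /@ex_derive.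
  by move=> /derivable1_diffP/differentiable_continuous.
- by move=> i x; have := D i x => /@ex_derive.
- move=> i; rewrite (_ : partial i _ =
      (fun x : X => flat (flat_deriv P) (a * x ord0 j + b)) \* cst (a * (j == i)%:R)).
    by apply: gen_mul; [apply: gen_base; exists (flat_deriv P), a, b, j|exact: gen_cst].
  by apply/funext => x; exact: (@derive_val _ _ _ _ _ _ _ (D i x)).
Qed.

(** A tensor product. The two factors in coordinate j are exp(-1/s) at s = 1 + (x_j - c_j)/r and s =
    1 - (x_j - c_j)/r, extended by 0; for r > 0 both are positive exactly when |x_j - c_j| < r. *)
Definition bump (c : X) (r : R) (x : X) : R :=
  \prod_j (flat 1 (r^-1 * x ord0 j + (1 - r^-1 * c ord0 j)) *
           flat 1 (- r^-1 * x ord0 j + (1 + r^-1 * c ord0 j))).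

Lemma bump_smooth c r : smooth (bump c r).
Proof.
apply: flat_coord_smooth; rewrite /bump.
elim: (index_enum _) => [|j s IH].
  rewrite (_ : (fun x => _) = cst 1); first exact: gen_cst.
  by apply/funext => x; rewrite big_nil.
rewrite (_ : (fun x => _) = (
   (fun x : X => flat 1 (r^-1 * x ord0 j + (1 - r^-1 * c ord0 j))) \*
   (fun x : X => flat 1 (- r^-1 * x ord0 j + (1 + r^-1 * c ord0 j)))) \*
   (fun x : X => \prod_(j <- s) (flat 1 (r^-1 * x ord0 j + (1 - r^-1 * c ord0 j)) *
           flat 1 (- r^-1 * x ord0 j + (1 + r^-1 * c ord0 j))))).
  apply: gen_mul => //; apply: gen_mul; apply: gen_base.
    by exists 1, r^-1, (1 - r^-1 * c ord0 j), j.
  by exists 1, (- r^-1), (1 + r^-1 * c ord0 j), j.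
by apply/funext => x; rewrite big_cons.
Qed.

Lemma flat1_ge0 (t : R) : 0 <= flat 1 t.
Proof. by rewrite /flat; case: ifP => // _; rewrite hornerC mul1r expR_ge0. Qed.

Lemma bump_ge0 c r x : 0 <= bump c r x.
Proof. by apply: prodr_ge0 => j _; rewrite mulr_ge0 ?flat1_ge0. Qed.

Lemma bump_center c r : 0 < bump c r c.
Proof.
apply: prodr_gt0 => j _; rewrite addrCA subrr addr0 mulNr addrCA addNr addr0.
by rewrite mulr_gt0// /flat ltr01 hornerC mul1r expR_gt0.
Qed.

Lemma bump_out c r x : 0 < r -> r < `|x - c| -> bump c r x = 0.
Proof.
move=> r0; rewrite [`|_|]mx_normrE => rx.
have [j Hj] : exists j, r < `|x ord0 j - c ord0 j|.
  apply: contrapT => H; move: rx; apply/negP; rewrite -leNgt.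
  apply: bigmax_le; first exact: ltW.
  move=> [i j] _ /=; rewrite !mxE (ord1 i) leNgt; apply/negP => Hj.
  by apply: H; exists j.
rewrite /bump (bigD1 j)//=; apply/eqP; rewrite !mulf_eq0 -orbA.
move: Hj; rewrite lter_normr => /orP[] Hj.
  apply/orP; right; apply/orP; left; rewrite /flat ifF//; apply/negbTE; rewrite -leNgt.
  have : 1 < r^-1 * (x ord0 j - c ord0 j) by rewrite mulrC ltr_pdivlMr// mul1r.
  rewrite mulrBr mulNr; lra.
apply/orP; left; rewrite /flat ifF//; apply/negbTE; rewrite -leNgt.
have : 1 < r^-1 * - (x ord0 j - c ord0 j) by rewrite mulrC ltr_pdivlMr// mul1r.
rewrite opprB mulrBr; lra.
Qed.

Lemma bump_test (A : set X) c r : 0 < r -> (forall x, `|x - c| <= r -> A x) ->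
  test_function A (bump c r).
Proof.
move=> r0 HA; pose B := [set x : X | `|x - c| <= r].
have cB : closed B.
  apply: (@closed_comp _ _ (fun x : X => `|x - c|) [set y | y <= r]); last exact: closed_le.
  move=> x _; apply: continuous_comp; last exact: norm_continuous.
  by apply: (@continuousD _ _ _ (id : X -> X) (cst (- c))); [exact: cvg_id|exact: cst_continuous].
have sB : supp (bump c r) `<=` B.
  apply: closure_min => // x /=; rewrite /B/= leNgt => bx; apply/negP => /(bump_out r0) H.
  by rewrite H eqxx in bx.
split; [exact: bump_smooth| |by move=> x /sB /HA].
apply: subclosed_compact sB; first exact: closed_closure.
apply: bounded_closed_compact => //; exists (r + `|c|); split; first exact: num_real.
move=> s rs x Bx; apply: le_trans (ltW rs); rewrite -[X in `|X|](subrK c x).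
exact: le_trans (ler_normD _ _) (lerD Bx (lexx _)).
Qed.

(** A bump normalised at the origin. A plateau on which it equals 1 is dispensable: under dilation
    the values tend to 1 pointwise, and the lower bound 1/2 near the origin serves for local
    estimates. *)
Lemma cutoff_exists : exists psi : X -> R, exists rho M : R,
  [/\ test_function setT psi, psi 0 = 1, 0 < rho, (forall x, 0 <= psi x <= M) &
     forall x, `|x| <= rho -> 2^-1 <= psi x].
Proof.
pose psi x : R := (bump 0 1 0)^-1 * bump 0 1 x.
have tp : test_function setT psi by apply: testZ; exact: bump_test.
have p0 : psi 0 = 1 by rewrite /psi mulVf// gt_eqF// bump_center.
have [M M0 HM] := test_bounded tp.
have : nbhs (0 : X) (fun x => 2^-1 < psi x).
  have := smooth_continuous (test_smooth tp) (x := 0).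
  rewrite /continuous_at p0 => /cvgr_gt; apply.
  by rewrite invf_lt1// ltr1n.
move=> /nbhs_ballP[e /= e0 He].
exists psi, (e / 2), M; split => //; first by rewrite divr_gt0.
- move=> x; rewrite (le_trans (ler_norm _) (HM x)) andbT.
  by rewrite mulr_ge0 ?bump_ge0// invr_ge0 bump_ge0.
- move=> x xe; apply/ltW/He; rewrite -ball_normE /= sub0r normrN.
  by rewrite (le_lt_trans xe)// ltr_pdivrMr// ltr_pMr// ltr1n.
Qed.

End bump_rV.

(** * Translation estimates and Rellich compactness *)

Section jensen.
Context d (T : measurableType d) (R : realType) (nu : {measure set T -> \bar R}).

(** The tangent-line inequality of t^p at the mean value [a] of |g|, integrated over [D]: the linear
    terms cancel. *)
Lemma jensen_powR (D : set T) (g : T -> R) (p : R) : 1 < p -> measurable D ->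
  (nu D < +oo)%E -> 0 < fine (nu D) ->
  nu.-integrable D (EFin \o g) ->
  nu.-integrable D (EFin \o (fun x => `|g x| `^ p)) ->
  `|\int[nu]_(x in D) g x| `^ p <=
  fine (nu D) `^ (p - 1) * \int[nu]_(x in D) (`|g x| `^ p).
Proof.
move=> p1 mD fD; set M := fine _ => M0 ig igp.
have p0 : 0 < p by rewrite (lt_trans _ p1).
have ing : nu.-integrable D (EFin \o (fun x => `|g x|)) by exact: integrable_norm.
set al := \int[nu]_(x in D) `|g x|.
have al0 : 0 <= al by apply: Rintegral_ge0.
have al_le : `|\int[nu]_(x in D) g x| <= al by exact: le_normr_Rintegral.
apply: (@le_trans _ _ (al `^ p)); first by rewrite ge0_ler_powR ?nnegrE// ltW.
set a := al / M; have a0 : 0 <= a by rewrite divr_ge0// ltW.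
have icst c : nu.-integrable D (EFin \o cst c).
  apply/integrableP; split; first exact/measurable_EFinP/measurable_cst.
  rewrite /= integral_cst//; apply: lte_mul_pinfty => //.
have H : \int[nu]_(x in D) (a `^ p - p * a `^ (p - 1) * a + p * a `^ (p - 1) * `|g x|) <=
         \int[nu]_(x in D) (`|g x| `^ p).
  apply: le_Rintegral => //.
    apply: (@integrableD _ _ _ _ _ mD (EFin \o cst (a `^ p - p * a `^ (p - 1) * a))
      (EFin \o (fun x => p * a `^ (p - 1) * `|g x|))) => //.
    exact: (integrableZl mD _ ing).
  move=> x _; apply: le_trans (powR_conv p1 a0 (normr_ge0 (g x))).
  by rewrite le_eqVlt; apply/orP; left; apply/eqP; ring.
move: H; rewrite RintegralD//; [|exact: icst|exact: (integrableZl mD _ ing)].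
rewrite Rintegral_cst// RintegralZl// -/al -/M.
have -> : (a `^ p - p * a `^ (p - 1) * a) * M + p * a `^ (p - 1) * al = a `^ p * M.
  have -> : al = a * M by rewrite /a divfK// gt_eqF.
  by ring.
have -> : al = a * M by rewrite /a divfK// gt_eqF.
rewrite (powRM p a0 (ltW M0)) -(powRB1M p1 (ltW M0)) => H.
rewrite mulrCA.
by rewrite ler_wpM2l ?powR_ge0.
Qed.

End jensen.

Section integrals_rV.
Context {R : realType} {N : nat}.
Local Notation X := 'rV[R]_N.
Local Notation mu := (@lebesgue_rV R N).
Implicit Types (f g : X -> R) (r h : R).

Definition cube r : set X := [set x | `|x| <= r].

Lemma cubeE r : 0 <= r -> cube r = [set x : X | forall i, `[- r, r]%classic (x ord0 i)].
Proof.
move=> r0; apply/seteqP; split => x /=.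
  rewrite /cube/= [`|_|]mx_normrE => H i; rewrite in_itv/= -ler_norml.
  by apply: le_trans H; exact: (le_bigmax _ (fun ij : 'I_1 * 'I_N => `|x ij.1 ij.2|) (ord0, i)).
move=> H; rewrite /cube/= [`|_|]mx_normrE; apply: bigmax_le => // -[i j] _ /=.
by rewrite (ord1 i) ler_norml; have := H j; rewrite in_itv.
Qed.

Lemma coord_le_norm (x : X) i : `|x ord0 i| <= `|x|.
Proof.
have : cube `|x| x by rewrite /cube/=.
by rewrite cubeE// => /(_ i); rewrite /= in_itv/= -ler_norml.
Qed.

Lemma measurable_cube r : measurable (cube r).
Proof.
have [r0|r0] := leP 0 r; last first.
  rewrite (_ : cube r = set0)//; apply/seteqP; split => // x /= H.
  by have := le_lt_trans (le_trans (normr_ge0 x) H) r0; rewrite ltxx.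
rewrite cubeE// (_ : [set x | _] = \bigcap_(i : 'I_N) [set x : X | `[- r, r]%classic (x ord0 i)]).
  apply: fin_bigcap_measurable => // i _.
  by rewrite -[X in measurable X]setTI; exact: (measurable_coord i).
by apply/seteqP; split => x /= Ax i; [move=> _; exact: Ax|exact: Ax].
Qed.

Lemma cube_fin r : (mu (cube r) < +oo)%E.
Proof.
have [r0|r0] := leP 0 r; last first.
  rewrite (_ : cube r = set0) ?measure0//; apply/seteqP; split => // x /= H.
  by have := le_lt_trans (le_trans (normr_ge0 x) H) r0; rewrite ltxx.
rewrite cubeE// (@lebesgue_rV_box R N (fun=> `[- r, r]%classic))//.
suff : (\prod_(i < N) lebesgue_measure `[(- r)%R, r])%E \is a fin_num.
  by rewrite fin_numElt => /andP[].
elim/big_ind : _ => // [a b|i _]; first exact: fin_numM.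
by rewrite lebesgue_measure_itv/=; case: ifP => _; rewrite -?EFinB.
Qed.

Lemma integrable_cube g r (M : R) : measurable_fun [set: X] g ->
  (forall x, `|g x| <= M) -> (forall x, ~ cube r x -> g x = 0) ->
  mu.-integrable setT (EFin \o g).
Proof.
move=> mg gM g0; rewrite (_ : EFin \o g = (EFin \o g) \_ (cube r)).
  rewrite -integrable_mkcond; last exact: measurable_cube.
  apply: measurable_bounded_integrable.
  - exact: measurable_cube.
  - exact: cube_fin.
  - exact: measurable_funTS.
  - by exists M; split; [exact: num_real|move=> z Mz x _; apply: le_trans (gM x) (ltW Mz)].
by apply/funext => x; rewrite patchE; case: ifPn => //; rewrite notin_setE => /g0 /= ->.
Qed.

End integrals_rV.

(** * Translation estimates in L^p for test functions *)

Section translation_estimate.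
Context {R : realType} {N : nat}.
Local Notation X := 'rV[R]_N.
Local Notation mu := (@lebesgue_rV R N).
Implicit Types (f g : X -> R) (r h t s : R) (i : 'I_N).

Lemma smooth_line f i (x : X) t s : smooth f ->
  is_derive s 1 (fun s => f (x + (t * s) *: delta_mx ord0 i))
    (partial i f (x + (t * s) *: delta_mx ord0 i) * t).
Proof.
move=> sf.
have D1 : is_derive (t * s) 1 (fun u => f (x + u *: delta_mx ord0 i))
    (partial i f (x + (t * s) *: delta_mx ord0 i)).
  by apply: is_derive_line; exact: smooth_derivable.
apply: (@is_derive1_comp _ (fun u => f (x + u *: delta_mx ord0 i)) ( *%R t)) => //.
have := @is_deriveZ _ _ _ (id : R -> R) t s 1 1 (is_derive_id _ _).
by rewrite [X in is_derive _ _ _ X]mulr1.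
Qed.

Lemma continuous_line f i (x : X) t : continuous f ->
  continuous (fun s => f (x + (t * s) *: delta_mx ord0 i)).
Proof.
move=> cf s; apply: (@continuous_comp _ _ _ (fun s => x + (t * s) *: delta_mx ord0 i) f); last exact: cf.
apply: (@continuousD _ _ _ (cst x) (fun s => (t * s) *: delta_mx ord0 i)); first exact: cst_continuous.
apply: (@continuousZ _ _ _ (fun s => t * s) (cst (delta_mx ord0 i))); last exact: cst_continuous.
exact: mulrl_continuous.
Qed.

(** The segment is parametrised by [0, 1], a probability space that depends neither on the length
    nor on the sign of [t]. *)
Lemma smooth_FTC f i (x : X) t : smooth f ->
  f (x + t *: delta_mx ord0 i) - f x =
  \int[lebesgue_measure]_(s in `[0, 1]) (partial i f (x + (t * s) *: delta_mx ord0 i) * t).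
Proof.
move=> sf; pose F s := f (x + (t * s) *: delta_mx ord0 i).
pose g s := partial i f (x + (t * s) *: delta_mx ord0 i) * t.
have dF s : is_derive s 1 F (g s) by exact: smooth_line.
have cF : continuous F by exact/continuous_line/smooth_continuous.
have cg : continuous g.
  move=> s; apply: (@continuousM _ _ (fun s => partial i f (x + (t * s) *: delta_mx ord0 i)) (cst t)); last exact: cst_continuous.
  exact/continuous_line/smooth_continuous/smooth_partial.
rewrite /Rintegral (@continuous_FTC2 R g F 0 1)//.
- by rewrite /F !mulr1 mulr0 scale0r addr0.
- exact: continuous_subspaceT.
- split.
  + by move=> s _; have := dF s => /@ex_derive.
  + exact: (cvg_at_right_filter (cF 0)).
  + exact: (cvg_at_left_filter (cF 1)).
- by move=> s _; rewrite derive1E; exact: (@derive_val _ _ _ _ _ _ _ (dF s)).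
Qed.

Lemma integral_cst01 (c : \bar R) :
  (\int[lebesgue_measure]_(s in (`[0%R, 1%R]%classic : set R)) c = c)%E.
Proof.
rewrite integral_cst; last exact: measurable_itv.
rewrite -[X in (c * X)%E]/(lebesgue_measure (`[0%R, 1%R]%classic : set R)).
by rewrite lebesgue_measure_itv/= lte_fin ltr01 -EFinB subr0 mule1.
Qed.

Lemma integrable01 (M : R) (g : R -> R) : measurable_fun [set: R] g ->
  (forall s, `|g s| <= M) ->
  lebesgue_measure.-integrable (`[0, 1]%classic : set (measurableTypeR R)) (EFin \o g).
Proof.
move=> mg gM; apply: measurable_bounded_integrable.
- exact: measurable_itv.
- rewrite [ltLHS](_ : _ = lebesgue_measure (`[0%R, 1%R]%classic : set R))//.
  by rewrite lebesgue_measure_itv/= lte_fin ltr01 -EFinB subr0 ltry.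
- exact: measurable_funTS.
- by exists M; split; [exact: num_real|move=> z Mz s _; exact: le_trans (gM s) (ltW Mz)].
Qed.

Lemma jensen01 (p M : R) (g : R -> R) : 1 < p -> measurable_fun [set: R] g ->
  (forall s, `|g s| <= M) ->
  ((`|\int[lebesgue_measure]_(s in `[0%R, 1%R]) g s| `^ p)%:E <=
   \int[lebesgue_measure]_(s in `[0%R, 1%R]) (`|g s| `^ p)%:E)%E.
Proof.
move=> p1 mg gM; have p0 : 0 <= p by rewrite ltW// (lt_trans _ p1).
have M0 : 0 <= M := le_trans (normr_ge0 _) (gM 0).
pose D : set (measurableTypeR R) := `[0, 1]%classic.
have leb1 : lebesgue_measure D = 1%:E.
  by rewrite lebesgue_measure_itv/= lte_fin ltr01 -EFinB subr0.
have mD : measurable D by exact: measurable_itv.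
have leb1lt : (lebesgue_measure D < +oo)%E by rewrite leb1 ltry.
have ig := integrable01 mg gM.
have igp : lebesgue_measure.-integrable D (EFin \o (fun s => `|g s| `^ p)).
  apply: (@integrable01 (M `^ p)) => [|s].
    apply: (measurableT_comp (measurable_powR p)).
    exact: (measurableT_comp (@normr_measurable R setT) mg).
  by rewrite /= ger0_norm ?powR_ge0// ge0_ler_powR ?nnegrE.
have fleb1 : fine (lebesgue_measure D) = 1 by rewrite leb1.
have H := @jensen_powR _ (measurableTypeR R) R lebesgue_measure D g p p1 mD leb1lt.
rewrite fleb1 powR1 mul1r in H; have {}H := H ltr01 ig igp.
rewrite -[leRHS]fineK; last exact: (integrable_fin_num mD igp).
by rewrite lee_fin; exact: H.
Qed.

Lemma measurable_line i t : measurable_fun [set: X * R]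
  (fun z : X * R => z.1 + (t * z.2) *: delta_mx ord0 i).
Proof.
apply/measurable_fun_rVP => j; under eq_fun do rewrite !mxE.
apply: measurable_funD.
  exact: (measurableT_comp (measurable_coord j) measurable_fst).
by apply: measurable_funM => //; apply: measurable_funM => //; exact: measurable_snd.
Qed.

Lemma measurable_line_partial f i t : smooth f -> measurable_fun [set: X * R]
  (fun z : X * R => \1_(`[0, 1]%classic : set R) z.2 * (partial i f (z.1 + (t * z.2) *: delta_mx ord0 i) * t)).
Proof.
move=> sf; apply: measurable_funM.
  exact: measurableT_comp.
apply: measurable_funM => //.
apply: (measurableT_comp _ (measurable_line i t)).
by apply: (@measurable_smooth _ _ (partial i f)); exact: smooth_partial.
Qed.

(** Jensen on the segment, then Tonelli: for each fixed parameter the integral over space is that of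
    the partial derivative, by translation invariance. *)
Lemma shift_coord_estimate (p : R) f i t : 1 < p -> test_function setT f ->
  (\int[mu]_x (`|f (x + t *: delta_mx ord0 i) - f x| `^ p)%:E <=
  (`|t| `^ p)%:E * \int[mu]_x (`|partial i f x| `^ p)%:E)%E.
Proof.
move=> p1 tf; have sf := test_smooth tf.
have spf := smooth_partial i sf.
have p0 : 0 < p by rewrite (lt_trans _ p1).
have [M M0 HM] := test_bounded (test_partial i tf).
(* The indicator turns the integral over [0, 1] into one over R, so that Tonelli applies on the full
   product. *)
pose k (z : X * R) := \1_(`[0, 1]%classic : set R) z.2 * (partial i f (z.1 + (t * z.2) *: delta_mx ord0 i) * t).
have mk := measurable_line_partial i t sf.
have mkp : measurable_fun setT (fun z => (`|k z| `^ p)%:E).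
  apply/measurable_EFinP; apply: (measurableT_comp (measurable_powR p)).
  exact: (measurableT_comp (@normr_measurable R setT) mk).
have lhs : (\int[mu]_x (`|f (x + t *: delta_mx ord0 i) - f x| `^ p)%:E <=
   \int[mu]_x \int[lebesgue_measure]_s (`|k (x, s)| `^ p)%:E)%E.
  apply: ge0_le_integral => //.
  - apply/measurable_EFinP; apply: (measurableT_comp (measurable_powR p)).
    apply: (measurableT_comp (@normr_measurable R setT)).
    apply: measurable_funB; last exact: measurable_smooth.
    exact: (measurableT_comp (measurable_smooth sf) (measurable_shift _)).
  - exact: (@measurable_fun_fubini_tonelli_F _ _ _ (measurableTypeR R) R lebesgue_measure _ mkp).
  move=> x _.
  have E : (\int[lebesgue_measure]_s (`|k (x, s)| `^ p)%:E =
     \int[lebesgue_measure]_(s in `[0%R, 1%R]) (`|partial i f (x + (t * s) *: delta_mx ord0 i) * t| `^ p)%:E)%E.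
    rewrite [RHS]integral_mkcond; apply: eq_integral => s _; rewrite patchE /k/= indicE.
    case: ifPn => _; first by rewrite mul1r.
    by rewrite mul0r normr0 powR0// gt_eqF.
  have mg : measurable_fun [set: R] (fun s => partial i f (x + (t * s) *: delta_mx ord0 i) * t).
    apply: measurable_funM => //; apply: continuous_measurable_fun.
    exact/continuous_line/smooth_continuous.
  rewrite E smooth_FTC//; apply: (jensen01 p1 mg (M := M * `|t|)) => s.
  by rewrite normrM ler_wpM2r.
have kp0 z : (0 <= (`|k z| `^ p)%:E)%E by rewrite lee_fin powR_ge0.
apply: (le_trans lhs).
rewrite [leLHS](@fubini_tonelli _ _ _ (measurableTypeR R) R mu lebesgue_measure _ mkp kp0).
set G := (\int[mu]_x (`|partial i f x| `^ p)%:E)%E.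
rewrite (_ : (\int[lebesgue_measure]_y _)%E =
    (\int[lebesgue_measure]_(s in `[0%R, 1%R]) ((`|t| `^ p)%:E * G))%E).
  by rewrite integral_cst01.
rewrite [RHS]integral_mkcond; apply: eq_integral => s _; rewrite patchE.
case: ifPn => s01; last first.
  apply: integral0_eq => x _.
  by rewrite /k/= indicE (negbTE s01) mul0r normr0 powR0// gt_eqF.
rewrite /G -ge0_integralZl//.
- rewrite -[RHS](ge0_integral_shift ((t * s) *: delta_mx ord0 i)).
  + by apply: eq_integral => x _; rewrite /k/= indicE s01 mul1r normrM powRM// mulrC.
  + apply: measurable_funeM; apply/measurable_EFinP; apply: (measurableT_comp (measurable_powR p)).
    exact: (measurableT_comp (@normr_measurable R setT) (measurable_smooth spf)).
  + by move=> x; rewrite -EFinM lee_fin mulr_ge0 ?powR_ge0.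
- apply/measurable_EFinP; apply: (measurableT_comp (measurable_powR p)).
  exact: (measurableT_comp (@normr_measurable R setT) (measurable_smooth spf)).
Qed.

End translation_estimate.

Section shift_estimates.
Context {R : realType} {N : nat}.
Local Notation X := 'rV[R]_N.
Local Notation mu := (@lebesgue_rV R N).
Implicit Types (f g : X -> R) (i : 'I_N).

Lemma measurable_powR_norm (p : R) d (T : measurableType d) (D : set T) (g : T -> R) :
  measurable_fun D g -> measurable_fun D (fun x => `|g x| `^ p).
Proof.
move=> mg; apply: (measurableT_comp (measurable_powR p)).
exact: (measurableT_comp (@normr_measurable R setT) mg).
Qed.

Lemma measurable_enorm : measurable_fun [set: X] (@enorm R N).
Proof. by apply: continuous_measurable_rV; exact: enorm_continuous. Qed.

Lemma measurable_powR_enorm (p : R) d (T : measurableType d) (D : set T) (g : T -> X) :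
  measurable_fun D g -> measurable_fun D (fun x => enorm (g x) `^ p).
Proof.
move=> mg; apply: (measurableT_comp (measurable_powR p)).
exact: (measurableT_comp measurable_enorm mg).
Qed.

(** The translation is carried out one coordinate at a time, each step costing a factor 2^p; lists
    of coordinates make this an induction. *)
Lemma shift_sum_estimate (p : R) (s : seq 'I_N) : 1 < p ->
  exists2 C : R, 0 <= C & forall f (z : X) (h : R), test_function setT f ->
  (forall i, `|z ord0 i| <= h) ->
  (\int[mu]_x (`|f (x + \sum_(i <- s) z ord0 i *: delta_mx ord0 i)%R - f x| `^ p)%:E <=
  (C * h `^ p)%:E * \int[mu]_x (enorm (gradient f x) `^ p)%:E)%E.
Proof.
move=> p1; have p0 : 0 < p by rewrite (lt_trans _ p1).
have G0 f : (0 <= \int[mu]_x (enorm (gradient f x) `^ p)%:E)%E.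
  by apply: integral_ge0 => x _; rewrite lee_fin powR_ge0.
elim: s => [|i s [C C0 IH]].
  exists 0 => // f z h tf _; rewrite mul0r mul0e integral0_eq// => x _.
  by rewrite big_nil addr0 subrr normr0 powR0// gt_eqF.
exists (2 `^ p * (1 + C)) => [|f z h tf zh]; first by rewrite mulr_ge0 ?powR_ge0// addr_ge0.
have sf := test_smooth tf; have mf := measurable_smooth sf.
pose v := \sum_(j <- s) z ord0 j *: delta_mx ord0 j : X.
pose e := z ord0 i *: delta_mx ord0 i : X.
pose g x := `|f (x + e) - f x| `^ p.
have mg : measurable_fun [set: X] g.
  apply: measurable_powR_norm; apply: measurable_funB => //.
  exact: (measurableT_comp mf (measurable_shift e)).
have mgE : measurable_fun [set: X] (EFin \o g) by exact/measurable_EFinP.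
have mh : measurable_fun [set: X] (fun x => `|f (x + v) - f x| `^ p).
  apply: measurable_powR_norm; apply: measurable_funB => //.
  exact: (measurableT_comp mf (measurable_shift v)).
have mgv : measurable_fun [set: X] (fun x => g (x + v)).
  exact: (measurableT_comp mg (measurable_shift v)).
apply: (@le_trans _ _ ((2 `^ p)%:E * (\int[mu]_x (g (x + v))%:E +
    \int[mu]_x (`|f (x + v)%R - f x| `^ p)%:E))%E).
  have g0 x : (0 <= (g x)%:E)%E by rewrite lee_fin powR_ge0.
  have k0 x : (0 <= (`|f (x + v) - f x| `^ p)%:E)%E by rewrite lee_fin powR_ge0.
  have m1 : measurable_fun [set: X] (fun x => (g (x + v))%:E) by exact/measurable_EFinP.
  have m2 : measurable_fun [set: X] (fun x => (`|f (x + v) - f x| `^ p)%:E).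
    exact/measurable_EFinP.
  have m12 := emeasurable_funD m1 m2.
  rewrite -(ge0_integralD mu measurableT (fun x _ => g0 (x + v)) m1 (fun x _ => k0 x) m2).
  rewrite -(ge0_integralZl mu measurableT m12 (fun x _ => adde_ge0 (g0 (x + v)) (k0 x))); last first.
    by rewrite lee_fin powR_ge0.
  apply: ge0_le_integral => //.
  - apply/measurable_EFinP; apply: measurable_powR_norm; apply: measurable_funB => //.
    exact: (measurableT_comp mf (measurable_shift _)).
  - exact: measurable_funeM.
  - move=> x _; rewrite -EFinD -EFinM lee_fin big_cons -/v -/e.
    apply: le_trans (powR_add p1 (normr_ge0 _) (normr_ge0 _)).
    rewrite ge0_ler_powR ?nnegrE ?(ltW p0)// ?addr_ge0//.
    rewrite (_ : f _ - f x = (f (x + v + e) - f (x + v)) + (f (x + v) - f x)).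
      exact: ler_normD.
    by rewrite subrKA [e + v]addrC addrA.
rewrite (ge0_integral_shift v mgE); last by move=> x; rewrite lee_fin powR_ge0.
rewrite -mulrA EFinM -muleA lee_pmul2l ?lte_fin ?powR_gt0//.
rewrite mulrDl mul1r EFinD ge0_muleDl ?lee_fin ?mulr_ge0 ?powR_ge0//.
apply: leeD; last exact: IH.
apply: (le_trans (shift_coord_estimate _ _ p1 tf)).
apply: lee_pmul; rewrite ?lee_fin ?powR_ge0//.
- by apply: integral_ge0 => x _; rewrite lee_fin powR_ge0.
- rewrite ge0_ler_powR ?nnegrE ?(ltW p0)//.
  exact: le_trans (zh i).
- apply: ge0_le_integral => //.
  + apply/measurable_EFinP; apply: measurable_powR_norm.
    by apply: measurable_smooth; exact: smooth_partial.
  + by apply/measurable_EFinP; apply: measurable_powR_enorm; exact: measurable_gradient.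
  + move=> x _; rewrite lee_fin ge0_ler_powR ?nnegrE ?enorm_ge0 ?(ltW p0)//.
    by have := coord_le_enorm (gradient f x) i; rewrite mxE.
Qed.

Lemma shift_estimate (p : R) : 1 < p ->
  exists2 C : R, 0 <= C & forall f (z : X) (h : R), test_function setT f ->
  `|z| <= h ->
  (\int[mu]_x (`|f (x + z)%R - f x| `^ p)%:E <=
  (C * h `^ p)%:E * \int[mu]_x (enorm (gradient f x) `^ p)%:E)%E.
Proof.
move=> p1; have [C C0 HC] := shift_sum_estimate (index_enum 'I_N) p1.
exists C => // f z h tf zh; rewrite {1}[z]row_sum_delta; apply: HC => // i.
exact: le_trans (coord_le_norm _ _) zh.
Qed.

(** The integral of f(x + e_i) - f(x) vanishes by translation invariance; by [smooth_FTC] and Fubini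
    it also equals the integral of the partial derivative. This is the source of integration by
    parts. *)
Lemma integral_partial (f : X -> R) i : test_function setT f ->
  (\int[mu]_x (partial i f x)%:E = 0)%E.
Proof.
move=> tf; have sf := test_smooth tf.
have mpf : measurable_fun [set: X] (partial i f) by apply: measurable_smooth; exact: smooth_partial.
have ig : mu.-integrable setT (EFin \o partial i f).
  have [M M0 HM] := test_bounded (test_partial i tf).
  have [r r0 Hr] := test_box (test_partial i tf).
  apply: (integrable_cube (r := r) mpf HM) => x xr; apply: notin_supp.
  by case: (Hr x).
have if_ : mu.-integrable setT (EFin \o f).
  have [M M0 HM] := test_bounded tf.
  have [r r0 Hr] := test_box tf.
  apply: (integrable_cube (r := r) (measurable_smooth sf) HM) => x xr; apply: notin_supp.
  by case: (Hr x).
pose k (z : X * R) := \1_(`[0, 1]%classic : set R) z.2 *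
  (partial i f (z.1 + (1 * z.2) *: delta_mx ord0 i) * 1).
have mk : measurable_fun [set: X * R] (EFin \o k).
  by apply/measurable_EFinP; exact: measurable_line_partial.
pose I : \bar R := (\int[mu]_x `|(partial i f x)%:E|)%E.
have shiftE (g : X -> \bar R) : measurable_fun setT g -> forall s,
    (\int[mu]_x (g (x + (1 * s) *: delta_mx ord0 i))%R = \int[mu]_x g x)%E.
  by move=> mg s; rewrite integral_shift.
have ik : (mu \x (@lebesgue_measure R))%E.-integrable setT (EFin \o k : X * measurableTypeR R -> \bar R).
  apply/(@integrable21ltyP _ _ _ (measurableTypeR R) R mu lebesgue_measure _ mk).
  rewrite [ltLHS](_ : _ = (\int[lebesgue_measure]_(s in `[0%R, 1%R]) I)%E).
    rewrite integral_cst01; have /integrableP[_] := ig; exact.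
  rewrite [RHS]integral_mkcond; apply: eq_integral => s _; rewrite patchE.
  case: ifPn => s01; last first.
    by apply: integral0_eq => x _; rewrite /k/= indicE (negbTE s01) mul0r normr0.
  rewrite -[RHS](shiftE (fun x => `|(partial i f x)%:E|)%E _ s); last first.
    by apply: measurableT_comp => //; exact/measurable_EFinP.
  by apply: eq_integral => x _; rewrite /k/= indicE s01 mulr1 [true%:R * _]mul1r.
have Fub := @Fubini _ _ _ (measurableTypeR R) R mu lebesgue_measure _ ik.
have R1 : (\int[lebesgue_measure]_s \int[mu]_x (EFin \o k) (x, s) =
    \int[mu]_x (partial i f x)%:E)%E.
  rewrite -[RHS]integral_cst01 [RHS]integral_mkcond; apply: eq_integral => s _; rewrite patchE.
  case: ifPn => s01; last first.
    by apply: integral0_eq => x _; rewrite /k/= indicE (negbTE s01) mul0r.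
  rewrite -[RHS](shiftE (EFin \o partial i f) _ s); last exact/measurable_EFinP.
  by apply: eq_integral => x _; rewrite /k/= indicE s01 mulr1 [true%:R * _]mul1r.
rewrite -R1 -[LHS]Fub.
have mf : measurable_fun [set: X] (EFin \o f).
  by apply/measurable_EFinP; exact: measurable_smooth.
have [M M0 HM] := test_bounded (test_partial i tf).
transitivity (\int[mu]_x ((EFin \o f) (x + (1 * 1) *: delta_mx ord0 i)%R - (EFin \o f) x))%E.
  apply: eq_integral => x _; rewrite /= -EFinB mul1r smooth_FTC//.
  have mg : measurable_fun [set: R] (fun s => partial i f (x + (1 * s) *: delta_mx ord0 i) * 1).
    apply: measurable_funM => //; apply: continuous_measurable_fun.
    by apply: continuous_line; apply: smooth_continuous; exact: smooth_partial.
  have ig01 := @integrable01 _ M _ mg _.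
  rewrite /Rintegral fineK; last first.
    apply: integrable_fin_num; first exact: measurable_itv.
    by apply: ig01 => s; rewrite mulr1.
  rewrite [RHS]integral_mkcond; apply: eq_integral => s _; rewrite patchE /k/= indicE.
  by case: ifPn => _; rewrite ?mul0r// [true%:R * _]mul1r.
have mabs : measurable_fun [set: X] (fun x => `|(f x)%:E|)%E by exact: measurableT_comp.
have ish : mu.-integrable setT (fun x => (EFin \o f) (x + (1 * 1) *: delta_mx ord0 i)).
  apply/integrableP; split; first exact: (measurableT_comp mf (measurable_shift _)).
  by rewrite [ltLHS](shiftE _ mabs 1); have /integrableP[] := if_.
rewrite integralB// [X in (X - _)%E](shiftE (EFin \o f) mf 1) subee//.
exact: integrable_fin_num.
Qed.

End shift_estimates.

(** Tychonoff gives a cluster point of the sequence in a product of segments. The index set being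
    countable, [phi j] can be chosen 1/(j+1)-close to it on the finitely many indices numbered below
    [j]. The bound [j <= phi j] replaces strict monotonicity: it keeps every eventual property. *)
Lemma diagonal_extraction (R : realType) (I : countType) (a : nat -> I -> R) (M : I -> R) :
  (forall k i, `|a k i| <= M i) ->
  exists phi : nat -> nat, (forall j, (j <= phi j)%N) /\
  exists c : I -> R, forall i, a (phi j) i @[j --> \oo] --> c i.
Proof.
move=> aM; pose A i : set R := `[- M i, M i]%classic.
have cA i : compact (A i) by exact: segment_compact.
have [|c [_ cc]] := @tychonoff I (fun=> R) A cA (a k @[k --> \oo]) _.
  by exists 0%N => // k _ i; rewrite /A /= in_itv/= -ler_norml.
(* Only three properties of the neighbourhoods of [c] are kept; afterwards the product topology is
   no longer visible. *)
have [NB [FNB W HNB]] : exists NB : set_system (I -> R), [/\ Filter NB,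
    forall i e, 0 < e -> NB [set f | `|c i - f i| < e] &
    forall B, NB B -> forall j, exists k, (j <= k)%N /\ B (a k)].
  exists (nbhs (c : ArrowAsProduct.prod__canonical__topology_structure_Topological (fun=> R))).
  split; first exact: (nbhs_filter (c : ArrowAsProduct.prod__canonical__topology_structure_Topological (fun=> R))).
    by move=> i e e0; exact: (@proj_continuous I (fun=> R) i c _ (nbhsx_ballx (c i) e e0)).
  move=> B cB j; have [|_ [[k jk <-]] H] := cc (a @` [set k | (j <= k)%N]) _ _ cB.
    by exists j => // k jk; exists k.
  by exists k.
have V (e : R) m : 0 < e -> NB [set f : I -> R | forall i, (pickle i < m)%N -> `|c i - f i| < e].
  move=> e0; elim: m => [|m IH]; first by apply: filterS filterT.
  have [[i0 i0m]|H] := pselect (exists i : I, pickle i = m); last first.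
    apply: filterS IH => f fi i; rewrite ltnS leq_eqVlt => /orP[/eqP im|]; last exact: fi.
    by case: H; exists i.
  apply: filterS (filterI IH (W i0 e e0)) => f /= [f1 f2] i.
  rewrite ltnS leq_eqVlt => /orP[/eqP im|]; last exact: f1.
  by have -> : i = i0 by apply: (pcan_inj pickleK); rewrite im i0m.
have ex j : exists k, (j <= k)%N /\ forall i, (pickle i < j)%N -> `|c i - a k i| < j.+1%:R^-1.
  have j0 : 0 < j.+1%:R^-1 :> R by rewrite invr_gt0.
  by have [k [jk H]] := HNB _ (V _ j j0) j; exists k.
have [phi Hphi] := choice ex; exists phi; split; first by move=> j; have [] := Hphi j.
exists c => i; apply/cvgrPdist_lt => e e0.
exists (maxn (pickle i).+1 (Num.truncn e^-1)) => // j /=; rewrite geq_max => /andP[ij ej].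
apply: lt_trans ((Hphi j).2 i ij) _; rewrite invf_plt ?posrE//.
by rewrite (lt_le_trans (truncnS_gt _))// ler_nat ltnS.
Qed.

Section pint_lemmas.
Context {R : realType} {N : nat}.
Local Notation X := 'rV[R]_N.
Local Notation mu := (@lebesgue_rV R N).
Variables (p : R) (p1 : 1 < p).
Implicit Types (f g h : X -> R) (D : set X).

Let p0 : 0 < p. Proof. exact: lt_trans p1. Qed.

Lemma pint_ge0 D f : (0 <= pint p D f)%E.
Proof. by apply: integral_ge0 => x _; rewrite lee_fin powR_ge0. Qed.

Lemma measurable_pint D f : measurable_fun D f ->
  measurable_fun D (fun x => (`|f x| `^ p)%:E).
Proof. by move=> mf; apply/measurable_EFinP; exact: measurable_powR_norm. Qed.

Lemma pint_subset D E f : measurable D -> measurable E -> D `<=` E ->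
  measurable_fun E f -> (pint p D f <= pint p E f)%E.
Proof.
move=> mD mE DE mf; apply: ge0_subset_integral => //; exact: measurable_pint.
Qed.

Lemma pint_add D f g : measurable D -> measurable_fun D f -> measurable_fun D g ->
  (pint p D (fun x => (f x + g x)%R) <= (2 `^ p)%:E * (pint p D f + pint p D g))%E.
Proof.
move=> mD mf mg.
have f0 x : (0 <= (`|f x| `^ p)%:E)%E by rewrite lee_fin powR_ge0.
have g0 x : (0 <= (`|g x| `^ p)%:E)%E by rewrite lee_fin powR_ge0.
have m1 := measurable_pint mf; have m2 := measurable_pint mg.
have m12 := emeasurable_funD m1 m2.
rewrite /pint -(ge0_integralD mu mD (fun x _ => f0 x) m1 (fun x _ => g0 x) m2).
rewrite -(ge0_integralZl mu mD m12 (fun x _ => adde_ge0 (f0 x) (g0 x))); last first.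
  by rewrite lee_fin powR_ge0.
apply: ge0_le_integral => //.
- by apply: measurable_pint; exact: measurable_funD.
- exact: measurable_funeM.
- move=> x _; rewrite -EFinD -EFinM lee_fin.
  apply: le_trans (powR_add p1 (normr_ge0 _) (normr_ge0 _)).
  by rewrite ge0_ler_powR ?nnegrE ?(ltW p0)// ?addr_ge0// ler_normD.
Qed.

Lemma pintN D f : pint p D (fun x => - f x) = pint p D f.
Proof. by apply: eq_integral => x _; rewrite normrN. Qed.

Lemma pint_tri D f g h : measurable D -> measurable_fun D f -> measurable_fun D g ->
  measurable_fun D h ->
  (pint p D (fun x => (f x - g x)%R) <= (2 `^ p)%:E *
    (pint p D (fun x => (f x - h x)%R) + pint p D (fun x => (h x - g x)%R)))%E.
Proof.
move=> mD mf mg mh.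
rewrite (_ : (fun x => f x - g x) = (fun x => (f x - h x) + (h x - g x))); last first.
  by apply/funext => x; rewrite subrKA.
by apply: pint_add => //; exact: measurable_funB.
Qed.

End pint_lemmas.

(** * Averages over the cells of a cubic grid *)

Section cells.
Context {R : realType} {N : nat}.
Local Notation X := 'rV[R]_N.
Local Notation mu := (@lebesgue_rV R N).
Variable n : nat.

Definition grid (x : X) : 'rV[int]_N := \row_i Num.floor (n.+1%:R * x ord0 i).

Definition cell (z : 'rV[int]_N) : set X := [set x | grid x = z].

Definition cellvol : R := n.+1%:R^-1 ^+ N.

Lemma cellvol_gt0 : 0 < cellvol.
Proof. by rewrite exprn_gt0// invr_gt0. Qed.

Lemma cellE z : cell z =
  [set x : X | forall i, `[(z ord0 i)%:~R / n.+1%:R, ((z ord0 i) + 1)%:~R / n.+1%:R[%classic (x ord0 i)].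
Proof.
have n0 : 0 < n.+1%:R :> R by [].
have E (t : R) (k : int) : (Num.floor (n.+1%:R * t) = k) <->
    `[k%:~R / n.+1%:R, (k + 1)%:~R / n.+1%:R[%classic t.
  rewrite /= in_itv/= ler_pdivrMr// ltr_pdivlMr// mulrC.
  by split => [<-|/floor_def//]; rewrite floor_itv.
apply/seteqP; split => x /=.
  by move=> <- i; apply/E; rewrite mxE.
by move=> H; apply/rowP => i; rewrite mxE; apply/E; exact: H.
Qed.

Lemma measurable_cell z : measurable (cell z).
Proof.
rewrite cellE (_ : [set x | _] = \bigcap_(i : 'I_N) [set x : X |
    `[(z ord0 i)%:~R / n.+1%:R, ((z ord0 i) + 1)%:~R / n.+1%:R[%classic (x ord0 i)]).
  apply: fin_bigcap_measurable => // i _.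
  by rewrite -[X in measurable X]setTI; exact: (measurable_coord i).
by apply/seteqP; split => x /= Ax i; [move=> _; exact: Ax|exact: Ax].
Qed.

Lemma mu_cell z : mu (cell z) = cellvol%:E.
Proof.
rewrite cellE (@lebesgue_rV_box R N (fun i => `[(z ord0 i)%:~R / n.+1%:R, ((z ord0 i) + 1)%:~R / n.+1%:R[%classic))//.
rewrite (eq_bigr (fun=> (n.+1%:R^-1)%:E)) => [|i _].
  by rewrite prodEFin/= prodr_const card_ord.
rewrite lebesgue_measure_itv/= lte_fin ltr_pM2r ?invr_gt0// ltr_int ltzD1 lexx.
by rewrite -EFinB -mulrBl -rmorphB/= addrC addKr mul1r.
Qed.

Lemma cell_fin z : (mu (cell z) < +oo)%E.
Proof. by rewrite mu_cell ltry. Qed.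

Lemma fine_cell z : fine (mu (cell z)) = cellvol.
Proof. by rewrite mu_cell. Qed.

Lemma same_cell x y : grid x = grid y -> `|x - y| <= n.+1%:R^-1.
Proof.
move=> xy; rewrite [`|_|]mx_normrE; apply: bigmax_le; first by rewrite invr_ge0.
move=> [i j] _ /=; rewrite (ord1 i) !mxE.
have := congr1 (fun z : 'rV[int]_N => z ord0 j) xy; rewrite !mxE => H.
have n0 : 0 < n.+1%:R :> R by [].
rewrite -(ler_pM2l n0) mulfV ?gt_eqF// -[X in X * `|_|]ger0_norm// -normrM mulrBr.
have /andP[] := floor_itv (n.+1%:R * x ord0 j); have /andP[] := floor_itv (n.+1%:R * y ord0 j).
rewrite H intrD; move: (_ * y ord0 j) (_ * x ord0 j) => a b H1 H2 H3 H4.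
by rewrite ler_norml; apply/andP; split; lra.
Qed.

Lemma measurable_grid (h : 'rV[int]_N -> R) : measurable_fun [set: X] (fun x => h (grid x)).
Proof.
move=> _ Y _; rewrite setTI (_ : _ @^-1` Y = \bigcup_z (if `[< Y (h z) >] then cell z else set0)).
  apply: countable_bigcupT_measurable => // z.
  by case: ifP => _; [exact: measurable_cell|exact: measurable0].
apply/seteqP; split => x /=.
  by move=> Yx; exists (grid x) => //; rewrite asboolT.
by move=> [z _]; case: asboolP => // Yz ->.
Qed.

Definition cell_int (u : X -> R) (z : 'rV[int]_N) : R := \int[mu]_(y in cell z) u y.

Definition cell_avg (u : X -> R) (x : X) : R := cellvol^-1 * cell_int u (grid x).

End cells.

Section cell_estimates.
Context {R : realType} {N : nat}.
Local Notation X := 'rV[R]_N.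
Local Notation mu := (@lebesgue_rV R N).
Variables (p : R) (p1 : 1 < p).
Implicit Types (u : X -> R) (n : nat).

Let p0 : 0 < p. Proof. exact: lt_trans p1. Qed.

Lemma integrable_cell n z (g : X -> R) (M : R) : measurable_fun [set: X] g ->
  (forall x, `|g x| <= M) -> mu.-integrable (cell n z) (EFin \o g).
Proof.
move=> mg gM; apply: measurable_bounded_integrable.
- exact: measurable_cell.
- exact: cell_fin.
- exact: measurable_funTS.
- by exists M; split; [exact: num_real|move=> t Mt s _; exact: le_trans (gM s) (ltW Mt)].
Qed.

(** From |u| <= 1 + |u|^p. The bound is the same for all functions of L^p mass at most [A], as the
    diagonal extraction demands. *)
Lemma cell_int_bound n z u (A : R) : test_function setT u -> (pint p setT u <= A%:E)%E ->
  `|cell_int n u z| <= @cellvol R N n + A.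
Proof.
move=> tu uA; have mu_ := measurable_smooth (test_smooth tu).
have [M M0 HM] := test_bounded tu.
have iu := integrable_cell n z mu_ HM.
have iup : mu.-integrable (cell n z) (EFin \o (fun x => `|u x| `^ p)).
  apply: (@integrable_cell _ _ _ (M `^ p)); first exact: measurable_powR_norm.
  by move=> x; rewrite ger0_norm ?powR_ge0// ge0_ler_powR ?nnegrE ?(ltW p0)// ltW.
have mc := measurable_cell (R := R) n z.
have i1 : mu.-integrable (cell n z) (EFin \o cst 1).
  by apply: (@integrable_cell _ _ _ 1) => // x; rewrite normr1.
rewrite /cell_int; apply: le_trans (le_normr_Rintegral mc iu) _.
apply: (@le_trans _ _ (\int[mu]_(x in cell n z) (1 + `|u x| `^ p))).
  apply: le_Rintegral => //.
  - exact: integrable_norm.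
  - exact: (integrableD mc i1 iup).
  - move=> x _; have := powR_young1 p1 (ler01) (normr_ge0 (u x)).
    by rewrite !powR1 mul1r.
rewrite RintegralD// Rintegral_cst// mul1r [fine _]fine_cell lerD2l -lee_fin /Rintegral fineK; last first.
  exact: integrable_fin_num.
apply: le_trans uA; apply: pint_subset => //.
Qed.

(** u(x) minus its average is an average of u(x) - u(y) over y in the cell of x. Jensen applies, the
    cell is enlarged to the cube of radius 1/(n+1) around x, and Tonelli leaves one translation
    estimate for each displacement in that cube. *)
Lemma cell_avg_estimate : exists2 C : R, 0 <= C & forall n u, test_function setT u ->
  (pint p setT (fun x => (u x - cell_avg n u x)%R) <=
   (C * n.+1%:R^-1 `^ p)%:E * pint_grad p setT (gradient u))%E.
Proof.
have [C C0 HC] := shift_estimate (N := N) p1.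
(* 2^N is the ratio of the volume of the cube of radius 1/(n+1) to that of a cell. *)
exists (2 ^+ N * C) => [|n u tu]; first by rewrite mulr_ge0.
set v := @cellvol R N n; have v0 : 0 < v by exact: cellvol_gt0.
set h : R := n.+1%:R^-1; have h0 : 0 <= h by rewrite invr_ge0.
have mu_ := measurable_smooth (test_smooth tu).
have [M M0 HM] := test_bounded tu.
pose k (w : X * X) : R := \1_(cube h) w.2 * `|u (w.1 + w.2) - u w.1| `^ p.
have mk : measurable_fun [set: X * X] (EFin \o k).
  apply/measurable_EFinP; apply: measurable_funM.
    apply: (measurableT_comp _ (@measurable_snd _ _ X X)).
    by apply: measurable_indic; exact: measurable_cube.
  apply: measurable_powR_norm; apply: measurable_funB.
    apply: (measurableT_comp mu_); apply/measurable_fun_rVP => i.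
    under eq_fun do rewrite mxE.
    by apply: measurable_funD; apply: (measurableT_comp (measurable_coord i)).
  exact: (measurableT_comp mu_ (@measurable_fst _ _ X X)).
have k0 w : (0 <= (EFin \o k) w)%E by rewrite lee_fin mulr_ge0 ?powR_ge0// indicE.
have pw x : ((`|(u x - cell_avg n u x)%R| `^ p)%:E <=
    (v^-1)%:E * \int[mu]_y (k (x, y))%:E)%E.
  pose g y := u y - u x.
  have mg : measurable_fun [set: X] g by exact: measurable_funB.
  have gM y : `|g y| <= 2 * M.
    by rewrite (le_trans (ler_normB _ _))// mulr_natl mulr2n lerD.
  have ig := integrable_cell n (grid n x) mg gM.
  have mgp : measurable_fun [set: X] (fun y => `|g y| `^ p) by exact: measurable_powR_norm.
  have igp : mu.-integrable (cell n (grid n x)) (EFin \o (fun y => `|g y| `^ p)).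
    apply: (@integrable_cell _ _ _ ((2 * M) `^ p) mgp) => y.
    by rewrite ger0_norm ?powR_ge0// ge0_ler_powR ?nnegrE ?(ltW p0)// mulr_ge0// ltW.
  have mc := measurable_cell (R := R) n (grid n x).
  have cv : fine (mu (cell n (grid n x))) = v by exact: fine_cell.
  have E : u x - cell_avg n u x = - (v^-1 * \int[mu]_(y in cell n (grid n x)) g y).
    rewrite RintegralB//; last 2 first.
    - exact: (integrable_cell n (grid n x) mu_ HM).
    - by apply: (@integrable_cell _ _ _ `|u x|).
    rewrite Rintegral_cst// cv mulrBr opprB /cell_avg /cell_int [u x * _]mulrC mulrA.
    by rewrite mulVf ?gt_eqF// mul1r.
  have J := fun H1 H2 => jensen_powR p1 mc H1 H2 ig igp.
  rewrite [fine _]cv in J; have {}J := J (cell_fin _ _) v0.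
  rewrite E normrN normrM ger0_norm ?invr_ge0 ?(ltW v0)// powRM ?invr_ge0 ?(ltW v0)//.
  apply: (@le_trans _ _ ((v^-1 * \int[mu]_(y in cell n (grid n x)) (`|g y| `^ p))%:E)).
    rewrite lee_fin; apply: le_trans (ler_wpM2l (powR_ge0 _ _) J) _.
    rewrite mulrA -powR_inv1 ?(ltW v0)// -powRrM mulN1r -powRD; last by rewrite (gt_eqF v0) implybT.
    by rewrite addrA addNr add0r.
  rewrite EFinM; apply: lee_pmul => //.
  - by rewrite lee_fin invr_ge0 ltW.
  - by rewrite lee_fin; apply: Rintegral_ge0 => y _; exact: powR_ge0.
  rewrite /Rintegral fineK; last exact: integrable_fin_num.
  have mkx : measurable_fun [set: X] (fun y => (k (x, y - x))%:E).
    have mkx' : measurable_fun [set: X] (fun y => (EFin \o k) (x, y)).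
      exact: (measurableT_comp mk (measurable_pair1 x)).
    exact: (measurableT_comp mkx' (measurable_shift (- x))).
  rewrite [leRHS](_ : _ = \int[mu]_y (k (x, y - x))%:E)%E; last first.
    rewrite -[RHS](ge0_integral_shift x mkx); last by move=> y; exact: k0.
    by apply: eq_integral => y _; rewrite addrK.
  rewrite integral_mkcond; apply: ge0_le_integral => //.
  - move=> y _; rewrite patchE; case: ifP => _ //; by rewrite lee_fin powR_ge0.
  - by apply/(measurable_restrictT _ mc); apply: measurable_funTS; exact/measurable_EFinP.
  - move=> y _; rewrite patchE; case: ifPn => [/set_mem yc|_]; last exact: k0.
    rewrite lee_fin /k/= addrCA subrr addr0 indicE mem_set ?mul1r//.
    exact: same_cell.
apply: (@le_trans _ _ (\int[mu]_x ((v^-1)%:E * \int[mu]_y (k (x, y))%:E))%E).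
  apply: ge0_le_integral => //.
  - apply: measurable_pint; apply: measurable_funB => //.
    by apply: measurable_funM => //; exact: measurable_grid.
  - apply: measurable_funeM.
    exact: (@measurable_fun_fubini_tonelli_F _ _ X X R mu _ mk k0).
rewrite ge0_integralZl//; last 3 first.
- exact: (@measurable_fun_fubini_tonelli_F _ _ X X R mu _ mk k0).
- by move=> x _; apply: integral_ge0 => y _; exact: k0.
- by rewrite lee_fin invr_ge0 ltW.
rewrite (@fubini_tonelli _ _ X X R mu mu _ mk k0).
set G := pint_grad _ _ _.
have G0 : (0 <= G)%E by apply: integral_ge0 => x _; rewrite lee_fin powR_ge0.
have ki y : (\int[mu]_x (EFin \o k) (x, y) <= (\1_(cube h) y)%:E * ((C * h `^ p)%:E * G))%E.
  rewrite /k/= indicE; case: (boolP (y \in _)) => [/set_mem yh|_]; last first.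
    by rewrite mul0e integral0_eq// => x _; rewrite mul0r.
  rewrite mul1e; under eq_integral do rewrite mul1r.
  exact: HC.
apply: (@le_trans _ _ ((v^-1)%:E * \int[mu]_y ((\1_(cube h) y)%:E * ((C * h `^ p)%:E * G)))%E).
  apply: lee_wpmul2l; first by rewrite lee_fin invr_ge0 ltW.
  apply: ge0_le_integral => //.
  - by move=> y _; apply: integral_ge0 => x _; exact: k0.
  - exact: (@measurable_fun_fubini_tonelli_G _ _ X X R mu _ mk k0).
  - apply: emeasurable_funM => //; apply/measurable_EFinP.
    by apply: measurable_indic; exact: measurable_cube.
have CG0 : (0 <= (C * h `^ p)%:E * G)%E by rewrite mule_ge0// lee_fin mulr_ge0 ?powR_ge0.
rewrite ge0_integralZr//; last first.
  by apply/measurable_EFinP; apply: measurable_indic; exact: measurable_cube.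
rewrite integral_indic ?setIT//; last exact: measurable_cube.
have muh : mu (cube h) = (2 ^+ N * v)%:E.
  rewrite cubeE// (@lebesgue_rV_box R N (fun=> `[- h, h]%classic))//.
  rewrite (eq_bigr (fun=> (2 * h)%:E)) => [|i _].
    by rewrite prodEFin/= prodr_const card_ord exprMn.
  rewrite lebesgue_measure_itv/= lte_fin; case: ifPn => hh.
    by rewrite -EFinB opprK mulr_natl mulr2n.
  suff -> : h = 0 by rewrite mulr0.
  by apply/eqP; rewrite eq_le h0 andbT; lra.
rewrite [X in (_ * (X * _))%E]muh !muleA -!EFinM le_eqVlt; apply/orP; left; apply/eqP.
by congr (_%:E * G)%E; field; rewrite gt_eqF.
Qed.

End cell_estimates.

Lemma cvge_lt_near (R : realType) (f : nat -> \bar R) (l e : R) :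
  f j @[j --> \oo] --> l%:E -> l < e -> \forall j \near \oo, (f j < e%:E)%E.
Proof. by move=> fl le; exact: (fl _ (@nbhs_open_ereal_lt R l (fun=> e) le)). Qed.

(** * Rellich compactness on bounded sets *)

Section rellich.
Context {R : realType} {N : nat}.
Local Notation X := 'rV[R]_N.
Local Notation mu := (@lebesgue_rV R N).
Variables (p : R) (p1 : 1 < p).

Let p0 : 0 < p. Proof. exact: lt_trans p1. Qed.

Lemma cvg_powR_norm0 (f : nat -> R) : f j @[j --> \oo] --> (0 : R) ->
  ((`|f j| `^ p)%:E @[j --> \oo] --> 0)%E.
Proof.
move=> f0; apply: cvg_EFin; first exact: nearW.
apply/cvgr0Pnorm_lt => e e0; move/cvgr0Pnorm_lt : f0 => /(_ (e `^ p^-1)).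
rewrite powR_gt0// => /(_ isT); apply: filterS => j /= fj.
rewrite ger0_norm ?powR_ge0// -[ltRHS](powRr1 (ltW e0)) -(@mulVf _ p) ?gt_eqF// powRrM.
by rewrite gt0_ltr_powR ?nnegrE ?powR_ge0.
Qed.

(* The averages of [u k] over the cells of a grid of mesh 1/n approximate [u k] in
   L^p uniformly in k, by the translation estimate; a diagonal extraction makes them
   all converge. *)
Lemma rellich (u : nat -> X -> R) (A B : R) :
  (forall k, test_function setT (u k)) ->
  (forall k, pint p setT (u k) <= A%:E)%E ->
  (forall k, pint_grad p setT (gradient (u k)) <= B%:E)%E ->
  exists phi : nat -> nat, (forall j, (j <= phi j)%N) /\
  forall r e : R, 0 < e -> exists n0, forall i j, (n0 <= i)%N -> (n0 <= j)%N ->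
    (pint p (cube r) (fun x => (u (phi i) x - u (phi j) x)%R) <= e%:E)%E.
Proof.
move=> tu uA uB.
have A0 : 0 <= A by rewrite -lee_fin (le_trans _ (uA 0%N))// pint_ge0.
have [C C0 HC] := @cell_avg_estimate R N p p1.
pose a k (t : nat * 'rV[int]_N) := cell_int t.1 (u k) t.2.
have [phi [phi_ge [c Hc]]] := @diagonal_extraction R _ a
  (fun t => @cellvol R N t.1 + A) (fun k t => cell_int_bound p1 t.1 t.2 (tu k) (uA k)).
exists phi; split=> // r e e0.
pose g n (x : X) := (@cellvol R N n)^-1 * c (n, grid n x).
have mg n : measurable_fun [set: X] (g n).
  by apply: measurable_funM => //; exact: (measurable_grid n (fun z => c (n, z))).
have mu_ k : measurable_fun [set: X] (u k) := measurable_smooth (test_smooth (tu k)).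
have ma n k : measurable_fun [set: X] (cell_avg n (u k)).
  by apply: measurable_funM => //; exact: (measurable_grid n (cell_int n (u k))).
have cB n z : `|c (n, z)| <= @cellvol R N n + A.
  have : `|a (phi j) (n, z)| @[j --> \oo] --> `|c (n, z)| by apply: cvg_norm; exact: Hc.
  move=> cn; rewrite -(cvg_lim (@Rhausdorff R) cn); apply: limr_le.
    by apply/cvg_ex; exists `|c (n, z)|.
  by apply: nearW => j; exact: (cell_int_bound p1).
(* For a fixed grid the averages converge pointwise and are uniformly bounded, so dominated
   convergence applies on a cube of finite measure. *)
have avg_cvg n : (pint p (cube r) (fun x => (cell_avg n (u (phi j)) x - g n x)%R) @[j --> \oo] --> 0%E)%E.
  pose v := @cellvol R N n; have v0 : 0 < v := cellvol_gt0 n.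
  pose K := (2 * (v^-1 * (v + A))) `^ p.
  have iK : mu.-integrable (cube r) (EFin \o cst K).
    apply: measurable_bounded_integrable; [exact: measurable_cube|exact: cube_fin|
      exact: measurable_cst|].
    exists `|K|; split; [exact: num_real|move=> t Kt x _; exact: ltW].
  have [] := @dominated_convergence _ _ R mu (cube r) (measurable_cube r)
    (fun j x => (`|cell_avg n (u (phi j)) x - g n x| `^ p)%:E) (cst 0%E) (EFin \o cst K).
  - move=> j; apply: measurable_pint; apply: measurable_funTS; exact: measurable_funB.
  - exact: measurable_cst.
  - apply: aeW => x _.
    have : (cell_avg n (u (phi j)) x - g n x) @[j --> \oo] --> (0 : R).
      rewrite -(subrr (g n x)); apply: cvgB; last exact: cvg_cst.
      exact: (cvgM (cvg_cst v^-1) (Hc (n, grid n x))).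
    exact: cvg_powR_norm0.
  - exact: iK.
  - apply: aeW => x j _; rewrite /= ger0_norm ?powR_ge0// lee_fin ge0_ler_powR ?nnegrE ?(ltW p0)//.
      by rewrite !mulr_ge0 ?invr_ge0 ?addr_ge0// ltW.
    rewrite -mulrBr normrM ger0_norm ?invr_ge0 ?(ltW v0)// mulrCA ler_wpM2l ?invr_ge0 ?(ltW v0)//.
    rewrite (le_trans (ler_normB _ _))// mulr_natl mulr2n lerD//.
    exact: (cell_int_bound p1).
  - by move=> _ _; rewrite integral0.
pose L := 2 `^ p; have L1 : 0 < L by rewrite powR_gt0.
(* The quasi-triangle inequality is used twice, each time with the factor 2^p and two summands. *)
pose e1 := e / (2 * L * (2 * L)).
have e10 : 0 < e1 by rewrite divr_gt0// !mulr_gt0.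
have B0 : 0 <= B.
  rewrite -lee_fin (le_trans _ (uB 0%N))//.
  by apply: integral_ge0 => x _; rewrite lee_fin powR_ge0.
(* Since (1/(n+1))^p is at most 1/(n+1), this mesh makes the distance to the averages at most [e1],
   for every function of the sequence. *)
pose n := Num.truncn (C * B / e1).
have nB : C * n.+1%:R^-1 `^ p * B <= e1.
  have n1 : n.+1%:R^-1 `^ p <= n.+1%:R^-1 :> R.
    by rewrite ge1r_powR ?invr_gt0 ?ltr0n ?(ltW p1)// invf_le1// ler1n.
  rewrite mulrAC (le_trans (ler_wpM2l _ n1)) ?mulr_ge0// ler_pdivrMr// [e1 * _]mulrC -ler_pdivrMr//.
  exact/ltW/truncnS_gt.
have [n0 _ Hn0] : \forall j \near \oo,
    (pint p (cube r) (fun x => (cell_avg n (u (phi j)) x - g n x)%R) < e1%:E)%E.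
  exact: (cvge_lt_near (avg_cvg n) e10).
have ug j : (n0 <= j)%N ->
    (pint p (cube r) (fun x => (u (phi j) x - g n x)%R) <= (2 * L * e1)%:E)%E.
  move=> jn; apply: (le_trans (pint_tri p1 (measurable_cube r)
    (measurable_funTS (mu_ (phi j))) (measurable_funTS (mg n)) (measurable_funTS (ma n (phi j))))).
  rewrite -/L [2 * L]mulrC -mulrA EFinM lee_pmul2l ?lte_fin// mulr_natl mulr2n EFinD.
  apply: leeD; last exact/ltW/Hn0.
  have mua : measurable_fun [set: X] (fun x => u (phi j) x - cell_avg n (u (phi j)) x).
    exact: measurable_funB.
  apply: (le_trans (pint_subset p (measurable_cube r) measurableT (@subsetT _ _) mua)).
  apply: (le_trans (HC n _ (tu (phi j)))).
  apply: le_trans (_ : _ <= (C * n.+1%:R^-1 `^ p)%:E * B%:E)%E _; last by rewrite -EFinM lee_fin.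
  by apply: lee_wpmul2l; rewrite ?lee_fin ?mulr_ge0 ?powR_ge0.
exists n0 => i j i0 j0.
apply: (le_trans (pint_tri p1 (measurable_cube r) (measurable_funTS (mu_ (phi i)))
   (measurable_funTS (mu_ (phi j))) (measurable_funTS (mg n)))).
have -> : e = L * (2 * L * e1 + 2 * L * e1).
  by rewrite /e1; field; rewrite gt_eqF.
rewrite -/L EFinM lee_pmul2l ?lte_fin// EFinD; apply: leeD; first exact: ug.
rewrite (_ : (fun x => _) = (fun x => - (u (phi j) x - g n x))); last first.
  by apply/funext => x; rewrite opprB.
by rewrite pintN; exact: ug.
Qed.

End rellich.

(** * The space W^{1,p}_0 and the first variation *)

Section scalar_plap.
Context {R : realType} {p : R} (p1 : 1 < p).
Implicit Types (u v : R).

(* Scalars are treated as vectors of R^1, so that the inequalities for [plap] also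
   apply to |u|^(p-2) u. *)
Definition vec1 u : 'rV[R]_1 := const_mx u.

Lemma dotp_vec1 u v : dotp (vec1 u) (vec1 v) = u * v.
Proof. by rewrite /dotp big_ord_recl big_ord0 addr0 !mxE. Qed.

Lemma enorm_vec1 u : enorm (vec1 u) = `|u|.
Proof. by rewrite /enorm dotp_vec1 -expr2 sqrtr_sqr. Qed.

Lemma dotp_plap_vec1 u v : dotp (plap p (vec1 u)) (vec1 v) = `|u| `^ (p - 2) * u * v.
Proof. by rewrite dotpZl dotp_vec1 enorm_vec1 mulrA. Qed.

Lemma vec1D u v : vec1 (u + v) = vec1 u + vec1 v.
Proof. by apply/rowP => i; rewrite !mxE. Qed.

Lemma vec1N u : vec1 (- u) = - vec1 u.
Proof. by apply/rowP => i; rewrite !mxE. Qed.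

Lemma vec1Z u v : vec1 (u * v) = u *: vec1 v.
Proof. by apply/rowP => i; rewrite !mxE. Qed.

Lemma normr_power u v : `| `|u| `^ (p - 2) * u * v| <= `|u| `^ (p - 1) * `|v|.
Proof. by have := normr_dotp_plap p1 (vec1 u) (vec1 v); rewrite dotp_plap_vec1 !enorm_vec1. Qed.

Lemma norm_conv u v t :
  `|u| `^ p + p * t * (`|u| `^ (p - 2) * u * v) <= `|u + t * v| `^ p.
Proof.
have := enorm_conv p1 (vec1 u) (vec1 (u + t * v)).
rewrite -vec1N -vec1D addrAC subrr add0r vec1Z dotpZr dotp_plap_vec1 !enorm_vec1.
by rewrite !mulrA.
Qed.

Lemma plap_young_dotp N (e : R) (a b : 'rV[R]_N) : 0 < e ->
  `|dotp (plap p a) b| <= e * enorm a `^ p + e `^ (1 - p) * enorm b `^ p.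
Proof.
move=> e0; apply: le_trans (normr_dotp_plap p1 a b) _.
by apply: powR_young => //; exact: enorm_ge0.
Qed.

(** A form of the continuity of |a|^p that can be integrated term by term. Convexity at [a] and at
    [b] gives both signs, Young's inequality isolates |a - b|^p, and the remaining |a|^p is traded
    for |b|^p by [powR_add]. *)
Lemma enorm_powB N (e : R) : 0 < e -> exists2 C, 0 < C & forall a b : 'rV[R]_N,
  `|enorm a `^ p - enorm b `^ p| <= e * enorm b `^ p + C * enorm (a - b) `^ p.
Proof.
move=> e0; have p0 : 0 < p by rewrite (lt_trans _ p1).
have q1 : 1 <= 2 `^ p :> R by rewrite -[leLHS](powRr0 2) ler_powR ?ler1n ?(ltW p0).
have q0 : 0 < 2 `^ p :> R by rewrite powR_gt0.
(* Chosen so that p * d * 2^p = e, where 2^p is the cost of replacing |a|^p by |b|^p. *)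
pose d := e / (p * 2 `^ p); have d0 : 0 < d by rewrite divr_gt0// mulr_gt0.
have H (a b : 'rV[R]_N) : enorm a `^ p - enorm b `^ p <=
    p * (d * enorm a `^ p + d `^ (1 - p) * enorm (a - b) `^ p).
  have H2 := enorm_conv p1 a b; rewrite -[b - a]opprB dotpNr mulrN in H2.
  rewrite lerBlDr -lerBlDl; apply: le_trans H2; rewrite lerD2l lerN2 ler_wpM2l ?(ltW p0)//.
  exact: le_trans (ler_norm _) (plap_young_dotp a (a - b) d0).
exists (e + p * d `^ (1 - p)) => [|a b].
  by rewrite addr_gt0// mulr_gt0// powR_gt0.
have T : enorm a `^ p <= 2 `^ p * (enorm b `^ p + enorm (a - b) `^ p).
  apply: le_trans (powR_add p1 (enorm_ge0 _) (enorm_ge0 _)).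
  rewrite ge0_ler_powR ?nnegrE ?addr_ge0 ?enorm_ge0 ?(ltW p0)//.
  by rewrite -{1}(subrK b a) addrC enormD.
have pd : p * d * 2 `^ p = e by rewrite /d; field; rewrite !gt_eqF.
have Ha := H a b; have Hb := H b a; rewrite -[b - a]opprB enormN in Hb.
have dab : 0 <= enorm (a - b) `^ p := powR_ge0 _ _.
have db : 0 <= enorm b `^ p := powR_ge0 _ _.
have pd0 : 0 <= p * d by rewrite mulr_ge0// ltW.
have e1 : p * d * enorm b `^ p <= e * enorm b `^ p by rewrite ler_wpM2r// -pd ler_peMr.
have e2 : 0 <= e * enorm (a - b) `^ p by rewrite mulr_ge0// ltW.
have e3 : p * d * enorm a `^ p <= e * (enorm b `^ p + enorm (a - b) `^ p).
  by rewrite -pd -[leRHS]mulrA ler_wpM2l.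
rewrite mulrDr mulrA in Ha; rewrite mulrDr mulrA in Hb; rewrite mulrDr in e3.
rewrite [(e + _) * _]mulrDl -[p * _ * _]mulrA.
have [e4 e5] : p * d * enorm a `^ p <= e * enorm b `^ p + e * enorm (a - b) `^ p /\
    p * d * enorm b `^ p <= e * enorm b `^ p + e * enorm (a - b) `^ p.
  split; first exact: e3.
  by apply: le_trans e1 _; rewrite lerDl; exact: e2.
by rewrite ler_norml; apply/andP; split; [rewrite lerNl opprB|];
  [apply: le_trans Hb _|apply: le_trans Ha _]; rewrite addrA lerD2r.
Qed.

End scalar_plap.

(** * Real-valued integrals over Omega *)

Section integrals_on_domain.
Context {R : realType} {N : nat} (Omega : set 'rV[R]_N) (mO : measurable Omega).
Local Notation X := 'rV[R]_N.
Local Notation mu := (@lebesgue_rV R N).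
Implicit Types (f h : X -> R) (c : R).

Definition itg f := mu.-integrable Omega (EFin \o f).
Definition Int f := \int[mu]_(x in Omega) f x.

Lemma itg_le f h : measurable_fun Omega f -> (forall x, Omega x -> `|f x| <= h x) ->
  itg h -> itg f.
Proof.
move=> mf fh; apply: le_integrable => //; first exact/measurable_EFinP.
move=> x Ox; rewrite lee_fin; apply: le_trans (fh x Ox) (ler_norm _).
Qed.

Lemma itgD f h : itg f -> itg h -> itg (fun x => f x + h x).
Proof. by move=> itf ith; exact: (integrableD mO itf ith). Qed.

Lemma itgZ c f : itg f -> itg (fun x => c * f x).
Proof. by move=> itf; exact: (integrableZl mO c itf). Qed.

Lemma itgB f h : itg f -> itg h -> itg (fun x => f x - h x).
Proof. by move=> itf ith; exact: (integrableB mO itf ith). Qed.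

Lemma itg_measurable f : itg f -> measurable_fun Omega f.
Proof. by move=> /integrableP[/measurable_EFinP]. Qed.

Lemma IntD f h : itg f -> itg h -> Int (fun x => f x + h x) = Int f + Int h.
Proof. by move=> itf ith; exact: RintegralD. Qed.

Lemma IntB f h : itg f -> itg h -> Int (fun x => f x - h x) = Int f - Int h.
Proof. by move=> itf ith; exact: RintegralB. Qed.

Lemma IntZ c f : itg f -> Int (fun x => c * f x) = c * Int f.
Proof. by move=> itf; exact: RintegralZl. Qed.

Lemma Int_le f h : itg f -> itg h -> (forall x, Omega x -> f x <= h x) -> Int f <= Int h.
Proof. by move=> itf ith fh; exact: le_Rintegral. Qed.

Lemma Int_ge0 f : (forall x, Omega x -> 0 <= f x) -> 0 <= Int f.
Proof. by move=> f0; exact: Rintegral_ge0. Qed.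

Lemma Int_eq f h : (forall x, Omega x -> f x = h x) -> Int f = Int h.
Proof. by move=> fh; apply: eq_Rintegral => x /set_mem /fh. Qed.

Lemma normr_Int f h : itg f -> itg h -> (forall x, Omega x -> `|f x| <= h x) ->
  `|Int f| <= Int h.
Proof.
move=> itf ith fh; apply: le_trans (le_normr_Rintegral mO itf) _.
by apply: Int_le => //; exact: integrable_norm.
Qed.

Lemma EFin_Int f : itg f -> (\int[mu]_(x in Omega) (f x)%:E)%E = (Int f)%:E.
Proof. by move=> itf; rewrite /Int /Rintegral fineK//; exact: integrable_fin_num. Qed.

Lemma itg_lty f : measurable_fun Omega f -> (forall x, Omega x -> 0 <= f x) ->
  (\int[mu]_(x in Omega) (f x)%:E < +oo)%E -> itg f.
Proof.
move=> mf f0 flt; apply/integrableP; split; first exact/measurable_EFinP.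
rewrite [ltLHS](_ : _ = \int[mu]_(x in Omega) (f x)%:E)%E//.
by apply: eq_integral => x /set_mem Ox /=; rewrite ger0_norm// f0.
Qed.

Lemma Int0 f : (forall x, Omega x -> f x = 0) -> Int f = 0.
Proof.
move=> f0; rewrite (Int_eq (h := fun=> 0))// /Int /Rintegral.
by rewrite integral0.
Qed.

End integrals_on_domain.

#[local] Opaque Int powR enorm dotp.

(** * The space W^{1,p}_0 as a space of pairs *)

Section sobolev_pairs.
Context {R : realType} {N : nat} {p : R} (p1 : 1 < p).
Variables (Omega : set 'rV[R]_N).
Hypothesis oO : open Omega.
Local Notation X := 'rV[R]_N.
Local Notation mu := (@lebesgue_rV R N).
Implicit Types (f h u v : X -> R) (g gu gv : X -> X) (c : R).

Let p0 : 0 < p. Proof. exact: lt_trans p1. Qed.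

Let mO : measurable Omega. Proof. exact: open_measurable_rV. Qed.
Local Notation Int := (Int Omega).
Local Notation itg := (itg Omega).

Definition powInt f := Int (fun x => `|f x| `^ p).
Definition gradInt g := Int (fun x => enorm (g x) `^ p).

(** Integrability only; the two components are tied together in [W01], through approximation by test
    functions and their gradients. *)
Definition W1 f g := [/\ measurable_fun Omega f, measurable_fun Omega g,
  itg (fun x => `|f x| `^ p) & itg (fun x => enorm (g x) `^ p)].

(* W^{1,p}_0 as pairs (function, gradient); that the second component is the weak
   gradient of the first is [W01_weak_grad]. *)
Definition W01 f g := W1 f g /\ forall e, 0 < e -> exists2 phi,
  test_function Omega phi &
  powInt (fun x => f x - phi x) + gradInt (fun x => g x - gradient phi x) < e.

Lemma powInt_ge0 f : 0 <= powInt f.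
Proof. by apply: Int_ge0 => x _; exact: powR_ge0. Qed.

Lemma gradInt_ge0 g : 0 <= gradInt g.
Proof. by apply: Int_ge0 => x _; exact: powR_ge0. Qed.

Lemma measurable_coords g : measurable_fun Omega g <->
  forall i, measurable_fun Omega (fun x => g x ord0 i).
Proof.
split=> [mg i|mg]; first exact: measurableT_comp (@measurable_coord _ _ _ i) mg.
apply: (measurability (\big[setU/set0]_(i < N)
  preimage_set_system setT (fun x : 'rV[R]_N => x ord0 i) measurable)) => //.
move=> _ [B + <-]; rewrite -bigcup_seq => -[i _ [C mC <-]].
by rewrite setTI; exact: mg.
Qed.

Lemma measurable_vecD g gu : measurable_fun Omega g -> measurable_fun Omega gu ->
  measurable_fun Omega (fun x => g x + gu x).
Proof.
move=> /measurable_coords mg /measurable_coords mh; apply/measurable_coords => i.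
by under eq_fun do rewrite mxE; apply: measurable_funD.
Qed.

Lemma measurable_vecS f g : measurable_fun Omega f -> measurable_fun Omega g ->
  measurable_fun Omega (fun x => f x *: g x).
Proof.
move=> mf /measurable_coords mg; apply/measurable_coords => i.
by under eq_fun do rewrite mxE; apply: measurable_funM.
Qed.

Lemma measurable_vecZ c g : measurable_fun Omega g ->
  measurable_fun Omega (fun x => c *: g x).
Proof. by move=> mg; apply: measurable_vecS => //; exact: measurable_cst. Qed.

Lemma measurable_vecB g gu : measurable_fun Omega g -> measurable_fun Omega gu ->
  measurable_fun Omega (fun x => g x - gu x).
Proof.
move=> mg mh; apply: measurable_vecD => //.
by under eq_fun do rewrite -scaleN1r; apply: measurable_vecZ.
Qed.

Lemma measurable_dotp g gu : measurable_fun Omega g -> measurable_fun Omega gu ->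
  measurable_fun Omega (fun x => dotp (g x) (gu x)).
Proof.
move=> /measurable_coords mg /measurable_coords mh; apply: measurable_sum => i.
by apply: measurable_funM.
Qed.

Lemma measurable_plap g : measurable_fun Omega g ->
  measurable_fun Omega (fun x => plap p (g x)).
Proof.
by move=> mg; apply: measurable_vecS => //; exact: measurable_powR_enorm.
Qed.

Lemma enormB_powR (a b : X) : enorm (a - b) `^ p <= 2 `^ p * (enorm a `^ p + enorm b `^ p).
Proof.
apply: le_trans (powR_add p1 (enorm_ge0 _) (enorm_ge0 _)).
by rewrite ge0_ler_powR ?nnegrE ?addr_ge0 ?enorm_ge0 ?(ltW p0)//; exact: enormB.
Qed.

Lemma enormD_powR (a b : X) : enorm (a + b) `^ p <= 2 `^ p * (enorm a `^ p + enorm b `^ p).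
Proof. by rewrite -{1}[b]opprK -[enorm b]enormN; exact: enormB_powR. Qed.

Lemma normrD_powR (a b : R) : `|a + b| `^ p <= 2 `^ p * (`|a| `^ p + `|b| `^ p).
Proof.
apply: le_trans (powR_add p1 (normr_ge0 _) (normr_ge0 _)).
by rewrite ge0_ler_powR ?nnegrE ?addr_ge0 ?(ltW p0)//; exact: ler_normD.
Qed.

Lemma enormZ_powR c (a : X) : enorm (c *: a) `^ p = `|c| `^ p * enorm a `^ p.
Proof. by rewrite enormZ powRM// enorm_ge0. Qed.

Lemma W1D f g u gu : W1 f g -> W1 u gu -> W1 (fun x => f x + u x) (fun x => g x + gu x).
Proof.
move=> [mf mg itf itg'] [mu' mgu itu itgu]; split.
- exact: measurable_funD.
- exact: measurable_vecD.
- apply: (itg_le mO _ _ (itgZ mO (2 `^ p) (itgD mO itf itu))) => [|x _].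
    by apply: measurable_powR_norm; exact: measurable_funD.
  by rewrite ger0_norm ?powR_ge0//; exact: normrD_powR.
- apply: (itg_le mO _ _ (itgZ mO (2 `^ p) (itgD mO itg' itgu))) => [|x _].
    by apply: measurable_powR_enorm; exact: measurable_vecD.
  by rewrite ger0_norm ?powR_ge0//; exact: enormD_powR.
Qed.

Lemma W1Z c f g : W1 f g -> W1 (fun x => c * f x) (fun x => c *: g x).
Proof.
move=> [mf mg itf itg']; split.
- by apply: measurable_funM => //; exact: measurable_cst.
- exact: measurable_vecZ.
- by under eq_fun do rewrite normrM powRM//; exact: itgZ.
- by under eq_fun do rewrite enormZ_powR; exact: itgZ.
Qed.

Lemma W1B f g u gu : W1 f g -> W1 u gu -> W1 (fun x => f x - u x) (fun x => g x - gu x).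
Proof.
move=> Wf /(W1Z (-1)) Wu; have := W1D Wf Wu.
by under eq_fun do rewrite mulN1r; under [X in W1 _ X -> _]eq_fun do rewrite scaleN1r.
Qed.

Lemma powInt_add f u : itg (fun x => `|f x| `^ p) -> itg (fun x => `|u x| `^ p) ->
  measurable_fun Omega f -> measurable_fun Omega u ->
  powInt (fun x => f x + u x) <= 2 `^ p * (powInt f + powInt u).
Proof.
move=> itf itu mf mu'; have it := itgZ mO (2 `^ p) (itgD mO itf itu).
rewrite /powInt -IntD// -IntZ//; last exact: itgD.
have le x : `|f x + u x| `^ p <= 2 `^ p * (`|f x| `^ p + `|u x| `^ p) by exact: normrD_powR.
apply: Int_le => [|||x _]; [exact: mO| |exact: it|exact: le].
apply: (itg_le mO _ _ it) => [|x _].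
  by apply: measurable_powR_norm; exact: measurable_funD.
by rewrite ger0_norm ?powR_ge0.
Qed.

Lemma gradInt_add g gu : itg (fun x => enorm (g x) `^ p) -> itg (fun x => enorm (gu x) `^ p) ->
  measurable_fun Omega g -> measurable_fun Omega gu ->
  gradInt (fun x => g x + gu x) <= 2 `^ p * (gradInt g + gradInt gu).
Proof.
move=> itg' itu mg mu'; have it := itgZ mO (2 `^ p) (itgD mO itg' itu).
rewrite /gradInt -IntD// -IntZ//; last exact: itgD.
have le x : enorm (g x + gu x) `^ p <= 2 `^ p * (enorm (g x) `^ p + enorm (gu x) `^ p).
  exact: enormD_powR.
apply: Int_le => [|||x _]; [exact: mO| |exact: it|exact: le].
apply: (itg_le mO _ _ it) => [|x _].
  by apply: measurable_powR_enorm; exact: measurable_vecD.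
by rewrite ger0_norm ?powR_ge0.
Qed.

Lemma powIntZ c f : itg (fun x => `|f x| `^ p) -> powInt (fun x => c * f x) = `|c| `^ p * powInt f.
Proof. by move=> itf; rewrite /powInt -IntZ//; apply: Int_eq => x _; rewrite normrM powRM. Qed.

Lemma gradIntZ c g : itg (fun x => enorm (g x) `^ p) ->
  gradInt (fun x => c *: g x) = `|c| `^ p * gradInt g.
Proof. by move=> itf; rewrite /gradInt -IntZ//; apply: Int_eq => x _; rewrite enormZ_powR. Qed.

Lemma itg_cube h r (M : R) : measurable_fun [set: X] h -> (forall x, `|h x| <= M) ->
  (forall x, ~ cube r x -> h x = 0) -> itg h.
Proof.
move=> mh hM h0; apply: (@integrableS _ _ _ _ setT) => //.
exact: integrable_cube mh hM h0.
Qed.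

Lemma test_W1 phi : test_function Omega phi -> W1 phi (gradient phi).
Proof.
move=> T; have mf := measurable_smooth (test_smooth T).
have mg := measurable_gradient (test_smooth T).
have [r r0 br] := test_box T; split.
- exact: measurable_funS mf.
- exact: measurable_funS mg.
- have [M M0 bM] := test_bounded T; apply: (@itg_cube _ r (M `^ p)).
  + exact: measurable_powR_norm.
  + move=> x; rewrite ger0_norm ?powR_ge0// ge0_ler_powR ?nnegrE ?(ltW p0) ?(ltW M0)//.
  + move=> x nx; have [/notin_supp ->|//] := br x.
    by rewrite normr0 powR0 ?gt_eqF.
- have [M M0 bM] := gradient_bounded T; apply: (@itg_cube _ r (M `^ p)).
  + exact: measurable_powR_enorm.
  + move=> x; rewrite ger0_norm ?powR_ge0//.
    by rewrite ge0_ler_powR ?nnegrE ?enorm_ge0 ?(ltW p0) ?(ltW M0).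
  + move=> x nx; have [nS|//] := br x.
    rewrite (_ : gradient phi x = 0) ?enorm0 ?powR0 ?gt_eqF//.
    by apply/rowP => i; rewrite !mxE partial_notin_supp.
Qed.

Lemma test_W01 phi : test_function Omega phi -> W01 phi (gradient phi).
Proof.
move=> T; split=> [|e e0]; first exact: test_W1.
exists phi => //; rewrite (_ : powInt _ = 0); last first.
  by apply: Int0 => x _; rewrite subrr normr0 powR0 ?gt_eqF.
rewrite (_ : gradInt _ = 0) ?addr0//.
by apply: Int0 => x _; rewrite subrr enorm0 powR0 ?gt_eqF.
Qed.

Lemma W01Z c f g : W01 f g -> W01 (fun x => c * f x) (fun x => c *: g x).
Proof.
move=> [Wf Hf]; split=> [|e e0]; first exact: W1Z.
have c0 : 0 < `|c| `^ p + 1 by rewrite ltr_wpDl ?powR_ge0.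
have [phi T lt] := Hf _ (divr_gt0 e0 c0).
have [m1 m2 i1 i2] := W1B Wf (test_W1 T).
exists (fun x => c * phi x); first exact: testZ.
rewrite (_ : powInt _ = powInt (fun x => c * (f x - phi x))); last first.
  by apply: Int_eq => x _; rewrite mulrBr.
rewrite (_ : gradInt _ = gradInt (fun x => c *: (g x - gradient phi x))); last first.
  by apply: Int_eq => x _; rewrite scalerBr gradientZ//; exact: test_smooth T.
rewrite powIntZ// gradIntZ// -mulrDr.
rewrite ltr_pdivlMr// mulrC in lt; apply: le_lt_trans lt.
by rewrite ler_wpM2r ?addr_ge0 ?powInt_ge0 ?gradInt_ge0// lerDl.
Qed.

Lemma W01D f g u gu : W01 f g -> W01 u gu -> W01 (fun x => f x + u x) (fun x => g x + gu x).
Proof.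
move=> [Wf Hf] [Wu Hu]; split=> [|e e0]; first exact: W1D.
have q0 : 0 < 2 * 2 `^ p :> R by rewrite mulr_gt0// powR_gt0.
have d0 := divr_gt0 e0 q0.
have [phi T lt] := Hf _ d0; have [psi S lt'] := Hu _ d0.
have [m1 m2 i1 i2] := W1B Wf (test_W1 T).
have [m1' m2' i1' i2'] := W1B Wu (test_W1 S).
have S' := testZ (-1) S.
exists (fun x => phi x - (-1 * psi x)); first exact: testB.
rewrite (_ : powInt _ = powInt (fun x => (f x - phi x) + (u x - psi x))); last first.
  by apply: Int_eq => x _; rewrite mulN1r opprK addrACA opprD.
rewrite (_ : gradInt _ = gradInt (fun x => (g x - gradient phi x) + (gu x - gradient psi x))); last first.
  apply: Int_eq => x _; rewrite gradientB; [|exact: test_smooth T|exact: test_smooth S'].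
  rewrite (gradientZ _ _ (test_smooth S)) scaleN1r opprK; congr (enorm _ `^ p).
  by rewrite addrACA opprD.
apply: le_lt_trans (lerD (powInt_add i1 i1' m1 m1') (gradInt_add i2 i2' m2 m2')) _.
rewrite -mulrDr addrACA mulrC -ltr_pdivlMr ?powR_gt0//.
apply: lt_le_trans (ltrD lt lt') _.
by rewrite invfM mulrA -mulrDl -splitr.
Qed.
End sobolev_pairs.

Lemma ler_epsM (R : realType) (a b K : R) : 0 <= K ->
  (forall e, 0 < e -> a <= b + e * K) -> a <= b.
Proof.
move=> K0 H; apply/ler_addgt0Pr => e e0.
have K1 : 0 < K + 1 by rewrite ltr_wpDl.
apply: le_trans (H _ (divr_gt0 e0 K1)) _; rewrite lerD2l -mulrA ler_piMr ?(ltW e0)//.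
by rewrite mulrC ler_pdivrMr// mul1r lerDl.
Qed.

Lemma norm_powB (R : realType) (p e : R) : 1 < p -> 0 < e ->
  exists2 C, 0 < C & forall a b : R,
  `| `|a| `^ p - `|b| `^ p| <= e * `|b| `^ p + C * `|a - b| `^ p.
Proof.
move=> p1 e0; have [C C0 H] := enorm_powB p1 1 e0; exists C => // a b.
by have := H (vec1 a) (vec1 b); rewrite -vec1N -vec1D !enorm_vec1.
Qed.

(** * The Poincaré inequality and the first variation of the energy *)

Section variational.
Context {R : realType} {N : nat} {p : R} (p1 : 1 < p).
Variables (Omega : set 'rV[R]_N) (l : R).
Hypothesis oO : open Omega.
Local Notation X := 'rV[R]_N.
Local Notation mu := (@lebesgue_rV R N).
Implicit Types (f h u v : X -> R) (g gu gv : X -> X) (c : R).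
Local Notation Int := (Int Omega).
Local Notation itg := (itg Omega).
Local Notation powInt := (@powInt R N p Omega).
Local Notation gradInt := (@gradInt R N p Omega).
Local Notation W1 := (@W1 R N p Omega).
Local Notation W01 := (@W01 R N p Omega).

Let p0 : 0 < p. Proof. exact: lt_trans p1. Qed.

Let mO : measurable Omega. Proof. exact: open_measurable_rV. Qed.

Definition plapInt gu gv := Int (fun x => dotp (plap p (gu x)) (gv x)).
Definition powerInt u v := Int (fun x => `|u x| `^ (p - 2) * u x * v x).
(* The derivative of (gradInt - l powInt) / p at u in the direction v. *)
Definition dEnergy u gu v gv := plapInt gu gv - l * powerInt u v.

Lemma itg_young gu gv : measurable_fun Omega gu -> measurable_fun Omega gv ->
  itg (fun x => enorm (gu x) `^ p) -> itg (fun x => enorm (gv x) `^ p) ->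
  itg (fun x => dotp (plap p (gu x)) (gv x)).
Proof.
move=> mgu mgv iu iv.
apply: (itg_le mO _ _ (itgD mO (itgZ mO 1 iu) (itgZ mO (1 `^ (1 - p)) iv))) => [|x _].
  by apply: measurable_dotp => //; exact: measurable_plap.
exact: plap_young_dotp.
Qed.

Lemma young_power (e a b : R) : 0 < e ->
  `| `|a| `^ (p - 2) * a * b| <= e * `|a| `^ p + e `^ (1 - p) * `|b| `^ p.
Proof. by move=> e0; apply: le_trans (normr_power p1 _ _) _; exact: powR_young. Qed.

Lemma itg_power u v : measurable_fun Omega u -> measurable_fun Omega v ->
  itg (fun x => `|u x| `^ p) -> itg (fun x => `|v x| `^ p) ->
  itg (fun x => `|u x| `^ (p - 2) * u x * v x).
Proof.
move=> mu' mv iu iv.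
apply: (itg_le mO _ _ (itgD mO (itgZ mO 1 iu) (itgZ mO (1 `^ (1 - p)) iv))) => [|x _].
  apply: measurable_funM => //; apply: measurable_funM => //.
  exact: measurable_powR_norm.
exact: young_power.
Qed.

Lemma powInt_approx (e : R) : 0 < e -> exists2 C, 0 < C & forall f h,
  measurable_fun Omega f -> measurable_fun Omega h ->
  itg (fun x => `|f x| `^ p) -> itg (fun x => `|h x| `^ p) ->
  itg (fun x => `|f x - h x| `^ p) ->
  `|powInt f - powInt h| <= e * powInt f + C * powInt (fun x => f x - h x).
Proof.
move=> e0; have [C C0 H] := norm_powB p1 e0; exists C => // f h mf mh iF iH iD.
rewrite distrC /powInt -!IntZ// -IntB// -IntD//; [|exact: itgZ|exact: itgZ].
apply: normr_Int => [//|||x _]; [exact: itgB|by apply: itgD => //; exact: itgZ|].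
by rewrite -[`|f x - _|]distrC; exact: H.
Qed.

Lemma gradInt_approx (e : R) : 0 < e -> exists2 C, 0 < C & forall g gu,
  itg (fun x => enorm (g x) `^ p) -> itg (fun x => enorm (gu x) `^ p) ->
  itg (fun x => enorm (g x - gu x) `^ p) ->
  `|gradInt g - gradInt gu| <= e * gradInt g + C * gradInt (fun x => g x - gu x).
Proof.
move=> e0; have [C C0 H] := enorm_powB p1 N e0; exists C => // f h iF iH iD.
rewrite distrC /gradInt -!IntZ// -IntB// -IntD//; [|exact: itgZ|exact: itgZ].
apply: normr_Int => [//|||x _]; [exact: itgB|by apply: itgD => //; exact: itgZ|].
by rewrite -[f x - h x]opprB enormN; exact: H.
Qed.

Hypotheses (l0 : 0 <= l) (lP : forall phi, test_function Omega phi ->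
  l * powInt phi <= gradInt (gradient phi)).

(** Density: replacing the pair by a close test function changes both integrals by at most [e] times
    a quantity that does not depend on [e]. *)
Lemma W01_poincare f g : W01 f g -> l * powInt f <= gradInt g.
Proof.
move=> [Wf Hf]; have P0 := powInt_ge0 (p := p) Omega f; have G0 := gradInt_ge0 (p := p) Omega g.
apply: (@ler_epsM _ _ _ (gradInt g + 1 + l * (powInt f + 1))) => [|e e0].
  by rewrite !addr_ge0 ?mulr_ge0 ?addr_ge0.
have [C C0 HC] := powInt_approx e0; have [D D0 HD] := gradInt_approx e0.
have M0 : 0 < Num.max C D by rewrite lt_max C0.
have [phi T lt] := Hf _ (divr_gt0 e0 M0).
have [mf mg itf itg'] := Wf; have [m1 m2 i1 i2] := test_W1 p1 oO T.
have [m3 m4 i3 i4] := W1B p1 oO Wf (test_W1 p1 oO T).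
have a1 := HC _ _ mf m1 itf i1 i3; have a2 := HD _ _ itg' i2 i4.
have := lP T.
have P1 := powInt_ge0 (p := p) Omega (fun x => f x - phi x).
have G1 := gradInt_ge0 (p := p) Omega (fun x => g x - gradient phi x).
have b1 : C * powInt (fun x => f x - phi x) <= e.
  apply: le_trans (_ : Num.max C D * powInt (fun x => f x - phi x) <= _).
    by rewrite ler_wpM2r// le_max lexx.
  rewrite mulrC -ler_pdivlMr//; apply: le_trans (ltW lt); by rewrite lerDl.
have b2 : D * gradInt (fun x => g x - gradient phi x) <= e.
  apply: le_trans (_ : Num.max C D * gradInt (fun x => g x - gradient phi x) <= _).
    by rewrite ler_wpM2r// le_max lexx orbT.
  rewrite mulrC -ler_pdivlMr//; apply: le_trans (ltW lt); by rewrite lerDr.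
have {a1 b1} c1 := le_trans (ler_norm _) (le_trans a1 (lerD (lexx _) b1)).
rewrite distrC in a2.
have {a2 b2} c2 := le_trans (ler_norm _) (le_trans a2 (lerD (lexx _) b2)).
move=> c3; have c4 := ler_wpM2l l0 c1.
move: (powInt f) (powInt phi) (gradInt g) (gradInt (gradient phi)) c2 c3 c4 => A B E F c2 c3 c4.
clear -c2 c3 c4; rewrite !mulrDr !mulrN in c4 *; rewrite !mulr1 [e * (l * A)]mulrCA [e * l]mulrC.
move: (l * (e * A)) (l * e) (l * A) (l * B) (e * E) c2 c3 c4 => a b c d k c2 c3 c4; lra.
Qed.

(* [0 <= gradInt - l powInt] at u + t v with t = d and t = - d. *)
Lemma dEnergy_bound (e : R) : 0 < e -> exists2 d, 0 < d & forall u gu v gv,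
  W01 u gu -> W01 v gv ->
  `|dEnergy u gu v gv| <= (gradInt gu - l * powInt u) / (p * d) + e * (gradInt gu + gradInt gv).
Proof.
move=> e0; have [d d0 H] := @enorm_expand R N p p1 e e0; exists d => // u gu v gv Wu Wv.
have [[m1 m2 i1 i2] _] := Wu; have [[m3 m4 i3 i4] _] := Wv.
have iL := itg_young m2 m4 i2 i4; have iP := itg_power m1 m3 i1 i3.
have K t : `|t| = d -> - (t * dEnergy u gu v gv) <= d * ((gradInt gu - l * powInt u) / (p * d) + e * (gradInt gu + gradInt gv)).
  move=> td; have Wt := W01D p1 oO Wu (W01Z p1 oO t Wv).
  have [[n1 n2 j1 j2] _] := Wt; have lt := W01_poincare Wt.
  (* The power term enters with the factor -l <= 0, so its exact convexity bound has the right
     direction; only the gradient term needs the uniform expansion and produces an error. *)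
  have h1 : powInt u + p * t * powerInt u v <= powInt (fun x => u x + t * v x).
    have k2 := itgZ mO (p * t) iP; rewrite /powerInt -(IntZ mO _ iP) -(IntD mO i1 k2).
    apply: Int_le => [|||x _]; [exact: mO|exact: (itgD mO i1 k2)|exact: j1|].
    exact: norm_conv.
  have h2 : gradInt (fun x => gu x + t *: gv x) <= gradInt gu + p * t * plapInt gu gv + p * d * e * (gradInt gu + gradInt gv).
    have k1 := itgD mO i2 i4; have k2 := itgZ mO (p * t) iL.
    have k3 := itgZ mO (p * d * e) k1; have k4 := itgD mO i2 k2.
    rewrite /plapInt -(IntZ mO _ iL) -[gradInt gu + gradInt gv](IntD mO i2 i4) -(IntZ mO _ k1).
    rewrite -(IntD mO i2 k2) -(IntD mO k4 k3).
    apply: Int_le => [|||x _]; [exact: mO|exact: j2|exact: (itgD mO k4 k3)|].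
    by have := H t (gu x) (gv x); rewrite td lexx => /(_ isT).
  have h3 := le_trans (ler_wpM2l l0 h1) (le_trans lt h2).
  rewrite /dEnergy; move: (powInt u) (gradInt gu) (powerInt u v) (plapInt gu gv) (gradInt gv) h3 => a b c k m h3.
  have -> : d * ((b - l * a) / (p * d) + e * (b + m)) = p^-1 * (b - l * a + p * d * e * (b + m)).
    by field; rewrite !gt_eqF.
  rewrite ler_pdivlMl//; clear -h3; lra.
have td1 : `|d| = d by rewrite gtr0_norm.
have td2 : `|- d| = d by rewrite normrN.
have := K d td1; have := K (- d) td2; rewrite mulNr opprK -[- (d * _)]mulrN !ler_pM2l// => k1 k2.
by rewrite ler_norml k1 andbT lerNl.
Qed.
End variational.

(** * Weak gradients, and the passage between pairs and Sobolev records *)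

Section bridge.
Context {R : realType} {N : nat} {p : R} (p1 : 1 < p).
Variables (Omega : set 'rV[R]_N).
Hypothesis oO : open Omega.
Local Notation X := 'rV[R]_N.
Local Notation mu := (@lebesgue_rV R N).
Implicit Types (f h u v a : X -> R) (g gu gv : X -> X) (c : R).
Local Notation Int := (Int Omega).
Local Notation itg := (itg Omega).
Local Notation powInt := (@powInt R N p Omega).
Local Notation gradInt := (@gradInt R N p Omega).
Local Notation W1 := (@W1 R N p Omega).
Local Notation W01 := (@W01 R N p Omega).

Let p0 : 0 < p. Proof. exact: lt_trans p1. Qed.

Let mO : measurable Omega. Proof. exact: open_measurable_rV. Qed.

Lemma test_itg phi : test_function Omega phi -> itg phi.
Proof.
move=> T; have [M M0 bM] := test_bounded T; have [r r0 br] := test_box T.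
apply: (itg_cube oO (r := r) (measurable_smooth (test_smooth T)) bM).
by move=> x nx; have [/notin_supp|/nx] := br x.
Qed.

(** Continuity in L^p of the pairing with a fixed test function. [e] stays free: it is fixed first,
    and the mass of [a] is then made small in terms of it. *)
Lemma Int_mul_test phi : test_function Omega phi -> exists2 M, 0 < M &
  forall a, measurable_fun Omega a -> itg (fun x => `|a x| `^ p) ->
  itg (fun x => a x * phi x) /\ forall e, 0 < e ->
  `|Int (fun x => a x * phi x)| <= e * Int (fun x => `|phi x|) + M * (e `^ (1 - p) * powInt a).
Proof.
move=> T; have [M M0 bM] := test_bounded T; exists M => // a ma ia.
have it : itg (fun x => `|phi x|) by exact: (integrable_norm (test_itg T)).
have bd e : 0 < e -> forall x, `|a x * phi x| <= e * `|phi x| + M * (e `^ (1 - p) * `|a x| `^ p).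
  move=> e0 x; have := powR_young p1 ler01 (normr_ge0 (a x)) e0.
  rewrite !powR1 mul1r mulr1 => H; rewrite normrM mulrC.
  apply: le_trans (ler_wpM2l (normr_ge0 _) H) _; rewrite mulrDr mulrC lerD2l.
  by rewrite ler_wpM2r// mulr_ge0// powR_ge0.
have i2 e : 0 < e -> itg (fun x => e * `|phi x| + M * (e `^ (1 - p) * `|a x| `^ p)).
  move=> e0; exact: (itgD mO (itgZ mO e it) (itgZ mO M (itgZ mO (e `^ (1 - p)) ia))).
have ip : itg (fun x => a x * phi x).
  apply: (itg_le mO _ _ (i2 1 ltr01)) => [|x _]; last exact: bd.
  apply: measurable_funM => //; exact: measurable_funS (measurable_smooth (test_smooth T)).
split=> // e e0; rewrite /powInt -(IntZ mO _ it) -(IntZ mO _ ia) -(IntZ mO _ (itgZ mO _ ia)).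
rewrite -(IntD mO (itgZ mO e it) (itgZ mO M (itgZ mO (e `^ (1 - p)) ia))).
apply: (normr_Int mO ip (i2 e e0)) => x _; exact: bd.
Qed.

(** The partial derivative of the product, extended by zero to the whole space, has integral
    zero. *)
Lemma Int_parts phi psi i : test_function Omega phi -> test_function Omega psi ->
  Int (fun x => psi x * partial i phi x) + Int (fun x => partial i psi x * phi x) = 0.
Proof.
move=> T S; have sT := test_smooth T; have sS := test_smooth S.
have TM := testS (@subsetT _ Omega) (testM sS T).
have := integral_partial i TM.
have [M M0 HM] := Int_mul_test (test_partial i T); have [K K0 HK] := Int_mul_test T.
have [m1 m2 i1 _] := test_W1 p1 oO S.
have [mp1 mp2 ip1 _] := test_W1 p1 oO (test_partial i S).
have [j1 _] := HM _ m1 i1; have [j2 _] := HK _ mp1 ip1.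
rewrite -(IntD mO j1 j2) => H.
have : (\int[mu]_(x in Omega) (psi x * partial i phi x + partial i psi x * phi x)%:E = 0)%E.
  rewrite -[RHS]H [LHS]integral_mkcond; apply: eq_integral => x _.
  rewrite patchE partialM//; case: ifPn => [_|]; first by rewrite [_ * phi x]mulrC.
  by rewrite notin_setE => nx /=; rewrite (test_out T nx) (test_out S nx) !mul0r addr0.
by rewrite (EFin_Int mO (itgD mO j1 j2)) => -[].
Qed.

(** The identity holds for the approximating test functions by [Int_parts], and both sides are
    continuous in L^p. *)
Lemma W01_weak_grad f g phi i : W01 f g -> test_function Omega phi ->
  Int (fun x => f x * partial i phi x) = - Int (fun x => g x ord0 i * phi x).
Proof.
move=> [Wf Hf] T; have [mf mg itf itg'] := Wf.
have ci (h : X -> X) : measurable_fun Omega h -> itg (fun x => enorm (h x) `^ p) ->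
   measurable_fun Omega (fun x => h x ord0 i) /\ itg (fun x => `|h x ord0 i| `^ p).
  move=> mh ih; have mhi := (iffLR (measurable_coords oO h) mh) i; split => //.
  apply: (itg_le mO _ _ ih) => [|x _]; first exact: measurable_powR_norm.
  rewrite ger0_norm ?powR_ge0// ge0_ler_powR ?nnegrE ?(ltW p0) ?enorm_ge0//.
  exact: coord_le_enorm.
have [M M0 HM] := Int_mul_test (test_partial i T); have [K K0 HK] := Int_mul_test T.
apply/eqP; rewrite -subr_eq0 opprK -normr_le0.
have A0 : 0 <= Int (fun x => `|partial i phi x|) by exact: Int_ge0.
have B0 : 0 <= Int (fun x => `|phi x|) by exact: Int_ge0.
apply: (@ler_epsM _ _ _ (Int (fun x => `|partial i phi x|) + Int (fun x => `|phi x|) + 1)) => [|e e0].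
  by rewrite !addr_ge0.
have q0 : 0 < e `^ (1 - p) by rewrite powR_gt0.
have Q0 : 0 < Num.max M K * e `^ (1 - p) by rewrite mulr_gt0// lt_max M0.
(* This tolerance cancels the large factor e^(1-p) of the two pairings, leaving a total error
   proportional to [e]. *)
have [psi S lt] := Hf _ (divr_gt0 e0 Q0).
have [m1 m2 i1 i2] := W1B p1 oO Wf (test_W1 p1 oO S).
have [n1 n2] := ci _ m2 i2; have [k1 k2] := ci _ mg itg'.
have [a1 /(_ _ e0) a2] := HM _ m1 i1; have [b1 /(_ _ e0) b2] := HK _ n1 n2.
have [c1 _] := HM _ mf itf; have [d1 _] := HK _ k1 k2.
have [mS1 mS2 iS1 iS2] := test_W1 p1 oO S.
have [s1 s2] := ci _ mS2 iS2.
have [c2 _] := HM _ mS1 iS1; have [d2 _] := HK _ s1 s2.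
have -> : Int (fun x => f x * partial i phi x) + Int (fun x => g x ord0 i * phi x) =
    Int (fun x => (f x - psi x) * partial i phi x) +
    Int (fun x => (g x - gradient psi x) ord0 i * phi x).
  have P := Int_parts i T S.
  rewrite -[LHS]subr0 -P opprD addrACA; congr (_ + _).
    by rewrite -(IntB mO c1 c2); apply: Int_eq => x _; rewrite mulrBl.
  have d3 : itg (fun x => partial i psi x * phi x).
    by move: d2; congr itg; apply/funext => x; rewrite mxE.
  by rewrite -(IntB mO d1 d3); apply: Int_eq => x _; rewrite !mxE mulrBl.
apply: le_trans (ler_normD _ _) _; apply: le_trans (lerD a2 b2) _.
have G1 : powInt (fun x => (g x - gradient psi x) ord0 i) <= gradInt (fun x => g x - gradient psi x).
  apply: Int_le => [|||x _]; [exact: mO|exact: n2|exact: i2|].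
  by rewrite ge0_ler_powR ?nnegrE ?(ltW p0) ?enorm_ge0//; exact: coord_le_enorm.
rewrite add0r addrACA -mulrDr [X in _ <= X]mulrDr lerD2l mulr1.
rewrite ltr_pdivlMr// mulrC in lt; apply: le_trans (ltW lt).
rewrite mulrDr; apply: lerD.
  by rewrite mulrA ler_wpM2r ?powInt_ge0// ler_wpM2r ?(ltW q0)// le_max lexx.
rewrite mulrA; apply: ler_pM; [|exact: powInt_ge0| |exact: G1].
  by rewrite mulr_ge0 ?(ltW q0) ?(ltW K0).
by rewrite ler_wpM2r ?(ltW q0)// le_max lexx orbT.
Qed.

Lemma pint_Pow f : itg (fun x => `|f x| `^ p) -> pint p Omega f = (powInt f)%:E.
Proof. by move=> itf; exact: EFin_Int. Qed.

Lemma pint_grad_gradInt g : itg (fun x => enorm (g x) `^ p) -> pint_grad p Omega g = (gradInt g)%:E.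
Proof. by move=> itf; exact: EFin_Int. Qed.

Lemma sobolev_W1 (u : sobolev p Omega) : W1 u (weak_grad u).
Proof.
have m1 := sobolev_measurable u; have m2 := weak_grad_measurable u; split => //.
- apply: itg_lty (sobolev_Lp u) => [|x _]; last exact: powR_ge0.
  exact: measurable_powR_norm.
- apply: itg_lty (weak_grad_Lp u) => [|x _]; last exact: powR_ge0.
  exact: measurable_powR_enorm.
Qed.

Lemma sobolev_normE f g : W1 f g ->
  sobolev_norm p Omega f g = ((powInt f + gradInt g) `^ p^-1)%:E.
Proof.
by move=> [m1 m2 i1 i2]; rewrite /sobolev_norm pint_Pow// pint_grad_gradInt// -poweR_EFin.
Qed.

Lemma sobolev0P (u : sobolev p Omega) : sobolev0 u <-> W01 u (weak_grad u).
Proof.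
have W := sobolev_W1 u.
have key phi e : 0 < e -> test_function Omega phi ->
    (sobolev_norm p Omega (fun x => u x - phi x)%R (fun x => weak_grad u x - gradient phi x)%R
       < e%:E)%E = (powInt (fun x => u x - phi x) + gradInt (fun x => weak_grad u x - gradient phi x) < e `^ p).
  move=> e0 T; rewrite sobolev_normE ?lte_fin; last exact/(W1B p1 oO W)/test_W1.
  set s := _ + _; have s0 : 0 <= s by rewrite addr_ge0 ?powInt_ge0 ?gradInt_ge0.
  apply/idP/idP => [h|h].
    rewrite -[s]powRr1// -[1](mulVf (lt0r_neq0 p0)) powRrM.
    by rewrite gt0_ltr_powR ?nnegrE ?powR_ge0 ?(ltW e0).
  rewrite -[e]powRr1 ?(ltW e0)// -[1](mulfV (lt0r_neq0 p0)) powRrM.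
  by rewrite gt0_ltr_powR ?nnegrE ?powR_ge0 ?invr_gt0.
split=> [H|[_ H]]; first split=> // e e0.
  have e1 : 0 < e `^ p^-1 by rewrite powR_gt0.
  have [phi T lt] := H _ e1; exists phi => //.
  by rewrite key// -powRrM mulVf ?gt_eqF// powRr1 ?(ltW e0) in lt.
move=> e e0; have e1 : 0 < e `^ p by rewrite powR_gt0.
by have [phi T lt] := H _ e1; exists phi => //; rewrite key.
Qed.

Lemma W01_sobolev f g : W01 f g -> exists u : sobolev p Omega,
  [/\ sobolev_fun u = f, weak_grad u = g & sobolev0 u].
Proof.
move=> W; have [[m1 m2 i1 i2] _] := W.
have l1 : (pint p Omega f < +oo)%E by rewrite pint_Pow// ltry.
have l2 : (pint_grad p Omega g < +oo)%E by rewrite pint_grad_gradInt// ltry.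
pose u := Sobolev m1 m2 l1 l2 (fun phi i T => W01_weak_grad i W T).
by exists u; split=> //; apply/sobolev0P.
Qed.

Lemma Lp_normE D f : Lp_norm p D f = (pint p D f `^ p^-1)%E.
Proof.
rewrite /Lp_norm unlock /Lnorm; congr (_ `^ _)%E.
rewrite /pint [RHS]integral_mkcond; apply: eq_integral => x _.
by rewrite !patchE; case: ifP => //= _; rewrite ?normr0 -?poweR_EFin// poweR_EFin powR0 ?gt_eqF.
Qed.

End bridge.

(** * Local limits of minimizing sequences *)

Lemma cvg_geometric_steps (R : realType) (y : nat -> R) (C q : R) (k0 : nat) :
  0 <= q < 1 -> (forall k, (k0 <= k)%N -> `|y k.+1 - y k| <= C * q ^+ k) -> cvgn y.
Proof.
move=> /andP[q0 q1] H.
have C0 : 0 <= C * q ^+ k0 by apply: le_trans (H k0 (leqnn _)).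
suff : cvgn (fun n => y (n + k0)%N).
  by move=> /cvg_ex[a ya]; apply/cvg_ex; exists a; rewrite -(cvg_shiftn k0).
set z := fun n => _; rewrite (_ : z = fun n => z 0%N + series (telescope z) n); last first.
  by apply/funext => n; exact: eq_sum_telescope.
apply: is_cvgD; first exact: is_cvg_cst.
apply: normed_cvg; apply: (@series_le_cvg _ _ (geometric (C * q ^+ k0) q)) => //.
- by move=> n; exact: normr_ge0.
- by move=> n; rewrite /geometric /= mulr_ge0// exprn_ge0.
- move=> n; rewrite /geometric /telescope /z /= addSn -mulrA -exprD addnC.
  by apply: H; rewrite leq_addr.
- by apply: is_cvg_geometric_series; rewrite ger0_norm.
Qed.

(** * Completeness of L^p on bounded sets *)

Section Lp_limits.
Context {R : realType} {N : nat}.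
Local Notation X := 'rV[R]_N.
Local Notation mu := (@lebesgue_rV R N).

Lemma fatou_bound (D : set X) (f : nat -> X -> R) (h : X -> R) (M : R) : measurable D ->
  (forall k, measurable_fun D (f k)) -> (forall k x, D x -> 0 <= f k x) ->
  (forall x, D x -> f k x @[k --> \oo] --> h x) ->
  (forall k, (\int[mu]_(x in D) (f k x)%:E <= M%:E)%E) ->
  (\int[mu]_(x in D) (h x)%:E <= M%:E)%E.
Proof.
move=> mD mf f0 fh fM.
have := @fatou _ _ _ mu D mD (fun k x => (f k x)%:E).
have mf' k : measurable_fun D (fun x => (f k x)%:E) by apply/measurable_EFinP.
move=> /(_ mf' f0) F.
rewrite (_ : \int[mu]_(x in D) (h x)%:E = \int[mu]_(x in D) limn_einf (fun k => (f k x)%:E))%E; last first.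
  apply: eq_integral => x /set_mem Dx.
  have : (f k x)%:E @[k --> \oo] --> (h x)%:E by apply: cvg_EFin; [exact: nearW|exact: fh].
  by move=> /cvg_limn_einf_sup[-> _].
apply: le_trans F _; rewrite limn_einf_lim; apply: lime_le; first exact: is_cvg_einfs.
apply: nearW => k; apply: le_trans (fM k).
by apply: ereal_inf_lbound; exists k => //=.
Qed.

Variables (p : R) (p1 : 1 < p).
Let p0 : 0 < p. Proof. exact: lt_trans p1. Qed.

Lemma cvg_norm_powR (a : nat -> R) (b : R) : a k @[k --> \oo] --> b ->
  `|a k| `^ p @[k --> \oo] --> `|b| `^ p.
Proof.
move=> ab; apply/cvgrPdist_le => e e0.
have B0 : 0 < `|b| `^ p + 1 by rewrite ltr_wpDl ?powR_ge0.
have e2 : 0 < e / 2 by rewrite divr_gt0.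
have [C C0 H] := norm_powB p1 (divr_gt0 e2 B0).
have d0 : 0 < (e / 2 / C) `^ p^-1 by rewrite powR_gt0// divr_gt0.
move/cvgrPdist_lt : ab => /(_ _ d0); apply: filterS => k abk.
rewrite distrC; apply: le_trans (H _ _) _; rewrite [leRHS](splitr e); apply: lerD.
  by rewrite -mulrA ler_piMr ?(ltW e2)// mulrC ler_pdivrMr// mul1r lerDl.
rewrite mulrC -ler_pdivlMr//.
have -> : e / 2 / C = ((e / 2 / C) `^ p^-1) `^ p.
  by rewrite -powRrM mulVf ?gt_eqF// powRr1// ltW// divr_gt0.
by rewrite distrC ge0_ler_powR ?nnegrE ?powR_ge0 ?(ltW p0) ?(ltW abk).
Qed.

(* Along a fast subsequence [f (m k)], the function [S] is integrable, and where
   it is finite the increments on any cube decay geometrically. *)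
Lemma Lp_local_complete (f : nat -> X -> R) : (forall k, measurable_fun setT (f k)) ->
  (forall r e, 0 < e -> exists n0, forall i j, (n0 <= i)%N -> (n0 <= j)%N ->
    (pint p (cube r) (fun x => f i x - f j x)%R <= e%:E)%E) ->
  exists2 h : X -> R, measurable_fun setT h & forall r e, 0 < e -> exists n0, forall i, (n0 <= i)%N ->
    (pint p (cube r) (fun x => f i x - h x)%R <= e%:E)%E.
Proof.
move=> mf fC.
have c0 k : 0 < (4^-1 : R) ^+ k by rewrite exprn_gt0// invr_gt0.
have /choice[n Hn] : forall k, exists n0, forall i j, (n0 <= i)%N -> (n0 <= j)%N ->
    (pint p (cube k%:R) (fun x => f i x - f j x)%R <= (4^-1 ^+ k)%:E)%E by move=> k; exact: fC.
(* Beyond [n k] the terms are 4^-k-close on the cube of radius k; the extra [k] makes the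
   subsequence go past every given index. *)
pose m := fix m k := if k is j.+1 then maxn (m j) (maxn (n k) k) else n 0%N.
have mS k : (m k <= m k.+1)%N by rewrite /= leq_maxl.
have mn k : (n k <= m k)%N by case: k => [|k] //=; rewrite !leq_max leqnn orbT.
have mk k : (k <= m k)%N by case: k => [|k] //=; rewrite !leq_max leqnn !orbT.
pose d k x := f (m k.+1) x - f (m k) x.
have md k : measurable_fun setT (d k) by apply: measurable_funB.
(* The weight 2^k leaves integrals of size 2^-k, still summable, and turns finiteness of the sum
   into geometric decay of the increments. *)
pose s k x := ((2 ^+ k * `|d k x| `^ p) * \1_(cube k%:R) x)%:E.
have s0 k x : (0 <= s k x)%E by rewrite lee_fin !mulr_ge0 ?powR_ge0// exprn_ge0.
have ms k : measurable_fun setT (s k).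
  apply/measurable_EFinP; apply: measurable_funM; last first.
    by apply: measurable_indic; exact: measurable_cube.
  by apply: measurable_funM => //; exact: measurable_powR_norm.
have Is k : (\int[mu]_x s k x <= ((2^-1) ^+ k)%:E)%E.
  have -> : (\int[mu]_x s k x = (2 ^+ k)%:E * pint p (cube k%:R) (d k))%E.
    rewrite -ge0_integralZl ?lee_fin ?exprn_ge0//; last 2 first.
    - exact: measurable_cube.
    - by apply/measurable_EFinP; apply: measurable_powR_norm; exact: measurable_funTS.
    rewrite [RHS]integral_mkcond; apply: eq_integral => x _; rewrite patchE /s indicE.
    by case: ifP => _; rewrite ?mulr1 ?mulr0 ?EFinM.
  have -> : (2^-1 : R) ^+ k = 2 ^+ k * 4^-1 ^+ k.
    by rewrite -exprMn; congr (_ ^+ _); field.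
  rewrite EFinM lee_pmul2l ?lte_fin ?exprn_gt0//.
  by apply: Hn => //; apply: leq_trans (mn k) _.
pose S x := (\sum_(0 <= k <oo) s k x)%E.
have mS' : measurable_fun setT S by apply: ge0_emeasurable_sum => // k x _ _; exact: s0.
have iS : (\int[mu]_x S x < +oo)%E.
  rewrite integral_nneseries// (@le_lt_trans _ _ (\sum_(0 <= k <oo) ((2^-1) ^+ k)%:E)%E)//.
    by apply: lee_nneseries => [k _ _|k _]; [exact: integral_ge0|exact: Is].
  have := @cvg_geometric_eseries_half R 2 0; move=> /cvg_lim.
  rewrite (_ : eseries _ = eseries (fun k => (2^-1 ^+ k)%:E)).
    by move=> -> //; rewrite ltry.
  congr eseries; apply/funext => k; congr EFin; rewrite addn1 natrX exprS invfM exprVn.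
  by rewrite mulrA divff ?mul1r.
pose E := [set x | (S x < +oo)%E].
have mE : measurable E by rewrite -[E]setTI; exact: emeasurable_fun_infty_o.
have muE : mu (~` E) = 0%E.
  have iS' : mu.-integrable setT S.
    apply/integrableP; split=> //; rewrite (eq_integral S)// => x _.
    by rewrite gee0_abs// nneseries_ge0.
  have [A [mA A0 HA]] := integrable_ae measurableT iS'.
  apply/eqP; rewrite eq_le measure_ge0 andbT -A0; apply: le_measure; rewrite ?inE//.
    exact: measurableC.
  move=> x Ex; apply: HA => /(_ I) fx; apply: Ex; rewrite /E /= ltey_eq fx//.
(* Cutting off outside [E] makes the subsequence converge everywhere, so that its limit is
   measurable. *)
pose g k x := f (m k) x * \1_E x.
have mg k : measurable_fun setT (g k).
  by apply: measurable_funM => //; exact: measurable_indic.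
have cg x : cvgn (fun k => g k x).
  rewrite /g indicE; case: (boolP (x \in E)) => [/set_mem Ex|_]; last first.
    under eq_fun do rewrite mulr0; exact: is_cvg_cst.
  under eq_fun do rewrite mulr1.
  have [M HM] : exists M : R, S x = M%:E.
    exists (fine (S x)); rewrite fineK// ge0_fin_numE//; exact: nneseries_ge0.
  have M0 : 0 <= M by rewrite -lee_fin -HM nneseries_ge0.
  (* A bound M for 2^k |d|^p gives |d| <= M^(1/p) (2^(-1/p))^k, available once the cube of radius k
     contains [x]. *)
  apply: (@cvg_geometric_steps _ _ (M `^ p^-1) ((2^-1) `^ p^-1) (Num.truncn `|x|).+1).
    have e1 : (1 : R) `^ p^-1 = 1 by rewrite powR1.
    rewrite powR_ge0/= -[ltRHS]e1; apply: gt0_ltr_powR; rewrite ?nnegrE ?invr_gt0//.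
    by rewrite invf_lt1// ltr1n.
  move=> k kx; have : (s k x <= M%:E)%E.
    rewrite -HM; apply: le_trans (nneseries_lim_ge k.+1 _) => //.
    by rewrite big_nat_recr//= leeDr// sume_ge0.
  have -> : s k x = (2 ^+ k * `|d k x| `^ p)%:E.
    rewrite /s indicE mem_set ?mulr1// /cube /=.
    by apply/ltW/(lt_le_trans (truncnS_gt _)); rewrite ler_nat.
  rewrite lee_fin mulrC -ler_pdivlMr ?exprn_gt0// -exprVn => dM.
  rewrite -[X in X <= _]/(`|d k x|).
  have -> : `|d k x| = (`|d k x| `^ p) `^ p^-1 by rewrite -powRrM divff ?gt_eqF// powRr1.
  have -> : M `^ p^-1 * (2^-1 `^ p^-1) ^+ k = (M * 2^-1 ^+ k) `^ p^-1.
    rewrite powRM// ?exprn_ge0// ?invr_ge0//; congr (_ * _).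
    have h2 : 0 <= 2^-1 :> R by rewrite invr_ge0.
    by rewrite -(powR_mulrn k (powR_ge0 _ _)) -(powR_mulrn k h2) -!powRrM mulrC.
  by apply: ge0_ler_powR; rewrite ?nnegrE ?powR_ge0 ?mulr_ge0 ?exprn_ge0 ?invr_ge0 ?(ltW p0).
pose h x := limn (fun k => g k x).
have gh x : g k x @[k --> \oo] --> h x by exact: cg.
have mh : measurable_fun setT h by apply: (measurable_fun_cvg mg) => x _; exact: gh.
exists h => // r e e0; have [n0 Hn0] := fC r e e0; exists n0 => i ni.
have mp (u : X -> R) : measurable_fun setT u -> measurable_fun (cube r) (fun x => `|f i x - u x| `^ p).
  move=> mu'; apply: measurable_powR_norm; apply: measurable_funTS.
  exact: measurable_funB.
have mI (u : X -> R) : measurable_fun setT u -> measurable_fun (cube r) (fun x => `|f i x - u x| `^ p * \1_E x).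
  by move=> mu'; apply: measurable_funM; [exact: mp|exact: measurable_indic].
have -> : pint p (cube r) (fun x => f i x - h x) =
    (\int[mu]_(x in cube r) (`|f i x - h x| `^ p * \1_E x)%:E)%E.
  apply: ge0_ae_eq_integral => //.
  - exact: measurable_cube.
  - by apply/measurable_EFinP; exact: mp.
  - by apply/measurable_EFinP; exact: mI.
  - exists (~` E); split=> //; first exact: measurableC.
    move=> x /= nx Ex; apply: nx => _; rewrite indicE mem_set// mulr1//.
(* Fatou in the second index: [f i] is close to all late terms of the subsequence, hence to their
   limit. This yields convergence of the whole sequence. *)
apply: (@fatou_bound (cube r) (fun k x => `|f i x - f (m (k + n0)%N) x| `^ p * \1_E x)).
- exact: measurable_cube.
- by move=> k; exact: mI.
- by move=> k x _; rewrite mulr_ge0 ?powR_ge0.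
- move=> x _; have := gh x; rewrite /g indicE; case: (boolP (x \in E)) => [_|_ _]; last first.
    by rewrite mulr0; under eq_fun do rewrite mulr0; exact: cvg_cst.
  under eq_fun do rewrite mulr1; rewrite mulr1 => gx; under eq_fun do rewrite mulr1.
  apply: cvg_norm_powR; apply: cvgB; first exact: cvg_cst.
  by move: gx; rewrite -(cvg_shiftn n0).
- move=> k; apply: le_trans (Hn0 i (m (k + n0)%N) ni _); last first.
    by apply: leq_trans (mk _); rewrite leq_addl.
  apply: ge0_le_integral => //.
  - exact: measurable_cube.
  - by apply/measurable_EFinP; exact: mI.
  - by apply/measurable_EFinP; exact: mp.
  - move=> x _; rewrite lee_fin ler_piMr ?powR_ge0//.
Qed.
End Lp_limits.

Section vector_limits.
Context {R : realType} {N : nat}.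
Local Notation X := 'rV[R]_N.
Local Notation mu := (@lebesgue_rV R N).
Variables (p : R) (p1 : 1 < p).
Let p0 : 0 < p. Proof. exact: lt_trans p1. Qed.

Lemma sum_powR (I : Type) (s : seq I) (x : I -> R) : (forall i, 0 <= x i) ->
  (\sum_(i <- s) x i) `^ p <= (2 `^ p) ^+ size s * \sum_(i <- s) x i `^ p.
Proof.
move=> x0; elim: s => [|i s IH]; first by rewrite !big_nil powR0 ?mulr0 ?gt_eqF.
have q1 : 1 <= 2 `^ p :> R by rewrite -[leLHS](powRr0 2) ler_powR ?ler1n ?(ltW p0).
rewrite !big_cons /=; apply: le_trans (powR_add p1 (x0 i) (sumr_ge0 _ (fun j _ => x0 j))) _.
rewrite exprS -mulrA ler_wpM2l ?powR_ge0// mulrDr; apply: lerD => //.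
by rewrite ler_peMl ?powR_ge0// exprn_ege1.
Qed.

Lemma enorm_powR_sum (a : X) :
  enorm a `^ p <= (2 `^ p) ^+ N * \sum_i `|a ord0 i| `^ p.
Proof.
apply: le_trans (_ : (\sum_i `|a ord0 i|) `^ p <= _).
  by rewrite ge0_ler_powR ?nnegrE ?enorm_ge0 ?sumr_ge0 ?(ltW p0)//; exact: enorm_le_sum.
apply: le_trans (sum_powR _ _) _ => //.
by rewrite /index_enum -enumT size_enum_ord.
Qed.

Lemma pint_coord D (g : X -> X) i : measurable D -> measurable_fun D g ->
  (pint p D (fun x => g x ord0 i) <= pint_grad p D g)%E.
Proof.
move=> mD mg; apply: ge0_le_integral => //.
- apply/measurable_EFinP; apply: measurable_powR_norm.
  exact: measurableT_comp (@measurable_coord _ _ _ i) mg.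
- by apply/measurable_EFinP; exact: measurable_powR_enorm.
- move=> x _; rewrite lee_fin ge0_ler_powR ?nnegrE ?enorm_ge0 ?(ltW p0)//.
  exact: coord_le_enorm.
Qed.

Lemma pint_grad_le_sum D (g : X -> X) : measurable D -> measurable_fun D g ->
  (pint_grad p D g <= ((2 `^ p) ^+ N)%:E * \sum_i pint p D (fun x => g x ord0 i)%R)%E.
Proof.
move=> mD mg.
have mi i : measurable_fun D (fun x => (`|g x ord0 i| `^ p)%:E).
  apply/measurable_EFinP; apply: measurable_powR_norm.
  exact: measurableT_comp (@measurable_coord _ _ _ i) mg.
have c0 : 0 <= (2 `^ p) ^+ N :> R by rewrite exprn_ge0 ?powR_ge0.
rewrite /pint -ge0_integral_sum//.
have ms : measurable_fun D (fun x => \sum_(i < N) (`|g x ord0 i| `^ p)%:E)%E.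
  exact: emeasurable_sum.
rewrite -ge0_integralZl ?lee_fin//; last by move=> x _; rewrite sume_ge0.
apply: ge0_le_integral => //.
- by move=> x _; rewrite lee_fin powR_ge0.
- by apply/measurable_EFinP; exact: measurable_powR_enorm.
- exact: measurable_funeM.
- by move=> x _; rewrite sumEFin -EFinM lee_fin enorm_powR_sum.
Qed.

(** Completeness coordinate by coordinate; the norm of a vector and its coordinates control each
    other up to constants. *)
Lemma Lp_local_complete_rV (g : nat -> X -> X) : (forall k, measurable_fun setT (g k)) ->
  (forall r e, 0 < e -> exists n0, forall i j, (n0 <= i)%N -> (n0 <= j)%N ->
    (pint_grad p (cube r) (fun x => g i x - g j x)%R <= e%:E)%E) ->
  exists2 h : X -> X, measurable_fun setT h & forall r e, 0 < e -> exists n0, forall i, (n0 <= i)%N ->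
    (pint_grad p (cube r) (fun x => g i x - h x)%R <= e%:E)%E.
Proof.
move=> mg gC.
have mgB k (h : X -> X) r : measurable_fun setT h -> measurable_fun (cube r) (fun x => g k x - h x).
  move=> mh; apply: measurable_funTS; apply: measurable_vecB => //.
  exact: openT.
have /choice[h Hh] (i : 'I_N) : exists h : X -> R, measurable_fun setT h /\
    forall r e, 0 < e -> exists n0, forall k, (n0 <= k)%N ->
    (pint p (cube r) (fun x => g k x ord0 i - h x)%R <= e%:E)%E.
  have [||h mh Hh] := @Lp_local_complete R N p p1 (fun k x => g k x ord0 i).
  - by move=> k; exact: measurableT_comp (@measurable_coord _ _ _ i) (mg k).
  - move=> r e e0; have [n0 H] := gC r e e0; exists n0 => j k nj nk.
    apply: le_trans (H j k nj nk).
    have := @pint_coord (cube r) (fun x => g j x - g k x) i (measurable_cube _) (mgB j _ r (mg k)).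
    by under [X in (pint _ _ X <= _)%E -> _]eq_fun do rewrite !mxE.
  - by exists h.
pose hv x : X := \row_i h i x.
have mhv : measurable_fun setT hv.
  by apply/measurable_fun_rVP => i; under eq_fun do rewrite mxE; exact: (Hh i).1.
exists hv => // r e e0.
have c0 : 0 < (2 `^ p) ^+ N * (N.+1)%:R :> R by rewrite mulr_gt0// exprn_gt0// powR_gt0.
have d0 := divr_gt0 e0 c0.
have /choice[n0 Hn0] (i : 'I_N) : exists n0, forall k, (n0 <= k)%N ->
    (pint p (cube r) (fun x => g k x ord0 i - h i x)%R <= (e / ((2 `^ p) ^+ N * (N.+1)%:R))%:E)%E.
  exact: (Hh i).2.
exists (\max_i n0 i)%N => k nk.
apply: le_trans (pint_grad_le_sum (measurable_cube _) (mgB k _ r mhv)) _.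
apply: (@le_trans _ _ (((2 `^ p) ^+ N)%:E * (\sum_(i < N) (e / ((2 `^ p) ^+ N * (N.+1)%:R))%:E))%E).
  rewrite lee_wpmul2l ?lee_fin ?exprn_ge0 ?powR_ge0//; apply: lee_sum => i _.
  rewrite (_ : (fun x => _) = (fun x => g k x ord0 i - h i x)); last first.
    by apply/funext => x; rewrite !mxE.
  by apply: Hn0; apply: leq_trans nk; exact: leq_bigmax.
rewrite sumEFin sumr_const card_ord -EFinM lee_fin -[(e / _) *+ N]mulr_natr.
have q0 : 0 < (2 `^ p) ^+ N :> R by rewrite exprn_gt0// powR_gt0.
have -> : (2 `^ p) ^+ N * (e / ((2 `^ p) ^+ N * N.+1%:R) * N%:R) = e * (N%:R / N.+1%:R).
  by field; rewrite gt_eqF//= -natr1 gt_eqF// ltr_wpDl.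
by rewrite ler_piMr ?(ltW e0)// ler_pdivrMr// mul1r ler_nat.
Qed.
End vector_limits.

(** * Dilated cutoffs and localised integrals *)

Section cutoffs.
Context {R : realType} {N : nat}.
Local Notation X := 'rV[R]_N.
Local Notation mu := (@lebesgue_rV R N).

(** Dilates x/(k+1) of a single cutoff: the gradients decay like 1/(k+1), the supports stay in cubes
    of size proportional to k+1, and continuity at the origin gives the pointwise limit 1. *)
Lemma cutoff_sequence : exists (chi : nat -> X -> R) (M K r rho : R),
  [/\ 0 < M, 0 < K, 0 < rho,
  (forall k, [/\ smooth (chi k), (forall x, 0 <= chi k x <= M),
      (forall x, enorm (gradient (chi k) x) <= K / k.+1%:R),
      (forall x, ~ cube (r * k.+1%:R) x -> chi k x = 0 /\ gradient (chi k) x = 0) &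
      (forall x, cube (rho * k.+1%:R) x -> 2^-1 <= chi k x)]) &
  forall x, chi k x @[k --> \oo] --> (1 : R)].
Proof.
have [psi [rho [M [T psi0 rho0 psiM psi2]]]] := @cutoff_exists R N.
have [K K0 HK] := gradient_bounded T; have [r r0 Hr] := test_box T.
have sp := test_smooth T.
pose chi k x := psi (k.+1%:R^-1 *: x).
have gchi k x : gradient (chi k) x = k.+1%:R^-1 *: gradient psi (k.+1%:R^-1 *: x).
  by apply/rowP => i; rewrite !mxE partial_scale.
have nk k x c : (`|k.+1%:R^-1 *: x| <= c) = (`|x| <= c * k.+1%:R :> R).
  by rewrite normrZ gtr0_norm ?invr_gt0// ler_pdivrMl// mulrC.
exists chi, (Num.max 1 M), K, r, rho; split=> //; [by rewrite lt_max ltr01|move=> k; split|].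
- exact: smooth_scale.
- by move=> x; have /andP[-> h] := psiM (k.+1%:R^-1 *: x); rewrite le_max h orbT.
- move=> x; rewrite gchi enormZ gtr0_norm ?invr_gt0// mulrC ler_wpM2r ?invr_ge0//.
- move=> x nx; have [nS|] := Hr (k.+1%:R^-1 *: x); last by rewrite nk.
  split; first exact: (notin_supp nS).
  rewrite gchi (_ : gradient psi _ = 0) ?scaler0//.
  by apply/rowP => i; rewrite !mxE partial_notin_supp.
- by move=> x xr; apply: psi2; rewrite nk.
- move=> x; rewrite -psi0; have c0 := smooth_continuous sp (x := 0).
  have h0 : (k.+1%:R^-1 *: x) @[k --> \oo] --> (0 : X).
    rewrite -[X in _ --> X](scale0r x); apply: cvgZ; last exact: cvg_cst.
    exact: (cvg_harmonic (R := R)).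
  exact: (cvg_comp _ _ h0 c0).
Qed.

Variables (Omega : set X) (oO : open Omega).
Let mO : measurable Omega. Proof. exact: open_measurable_rV. Qed.
Local Notation Int := (Int Omega).
Local Notation itg := (itg Omega).
Implicit Types (h : X -> R).

Lemma local_itg h (r e : R) : measurable_fun setT h -> (forall x, 0 <= h x) ->
  (\int[mu]_(x in cube r) (h x)%:E <= e%:E)%E ->
  itg (fun x => \1_(cube r) x * h x) /\ Int (fun x => \1_(cube r) x * h x) <= e.
Proof.
move=> mh h0 he; have mI : measurable_fun setT (fun x => \1_(cube r) x * h x).
  by apply: measurable_funM => //; apply: measurable_indic; exact: measurable_cube.
have I0 x : 0 <= \1_(cube r) x * h x by rewrite mulr_ge0.
have le : (\int[mu]_(x in Omega) (\1_(cube r) x * h x)%:E <= e%:E)%E.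
  apply: le_trans he; rewrite [leRHS](_ : _ = \int[mu]_x (\1_(cube r) x * h x)%:E)%E; last first.
    rewrite [LHS]integral_mkcond; apply: eq_integral => x _; rewrite patchE indicE.
    by case: ifP => _; rewrite ?mul1r ?mul0r.
  apply: ge0_subset_integral => //; first exact/measurable_EFinP.
  by move=> x _; rewrite lee_fin.
have it : itg (fun x => \1_(cube r) x * h x).
  apply: itg_lty; [exact: measurable_funTS|by move=> x _|].
  by apply: le_lt_trans le _; rewrite ltry.
by split=> //; rewrite -lee_fin -(EFin_Int mO it).
Qed.

(** Monitoring cubes is enough: at each point the localised functions are eventually equal to [h],
    and Fatou keeps the common bound. *)
Lemma itg_exhaust h (Q : R) : measurable_fun setT h -> (forall x, 0 <= h x) ->
  (forall k, itg (fun x => \1_(cube k%:R) x * h x) /\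
     Int (fun x => \1_(cube k%:R) x * h x) <= Q) -> itg h.
Proof.
move=> mh h0 H; apply: itg_lty; [exact: measurable_funTS|by move=> x _|].
apply: le_lt_trans (ltry Q).
apply: (@fatou_bound _ _ Omega (fun k x => \1_(cube k%:R) x * h x)) => //.
- by move=> k; exact: itg_measurable (H k).1.
- by move=> k x _; rewrite mulr_ge0.
- move=> x _; apply: (@cvg_near_cst _ _ _ (fun k => \1_(cube k%:R) x * h x)).
  exists (Num.truncn `|x|).+1 => // k /= kx; rewrite indicE mem_set ?mul1r//.
  by rewrite /cube /=; apply/ltW/(lt_le_trans (truncnS_gt _)); rewrite ler_nat.
- by move=> k; rewrite (EFin_Int mO (H k).1) lee_fin; exact: (H k).2.
Qed.

Lemma Int_cvg0 (a : nat -> X -> R) h (Q : R) : itg h -> (forall x, 0 <= h x) ->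
  (forall k, measurable_fun Omega (a k)) -> (forall k x, 0 <= a k x <= Q) ->
  (forall x, a k x @[k --> \oo] --> 0) ->
  (forall k, itg (fun x => a k x * h x)) /\
  forall e, 0 < e -> exists n0, forall k, (n0 <= k)%N -> Int (fun x => a k x * h x) <= e.
Proof.
move=> ih h0 ma aQ a0.
have mh k : measurable_fun Omega (fun x => a k x * h x).
  by apply: measurable_funM => //; exact: itg_measurable ih.
have bd k x : `|a k x * h x| <= Q * h x.
  have /andP[ak0 akQ] := aQ k x.
  by rewrite ger0_norm ?mulr_ge0// ler_wpM2r.
have it k : itg (fun x => a k x * h x) by apply: (itg_le mO (mh k) _ (itgZ mO Q ih)) => x _.
split=> // e e0.
have := @dominated_cvg _ _ _ mu Omega mO (fun k x => (a k x * h x)%:E) (fun=> 0%E) (fun x => (Q * h x)%:E).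
have m k : measurable_fun Omega (fun x => (a k x * h x)%:E) by apply/measurable_EFinP.
move=> /(_ m); rewrite integral0 => H.
have {}H : ((\int[mu]_(x in Omega) (a k x * h x)%:E)%E @[k --> \oo] --> 0%E).
  apply: H; [|by []|exact: (itgZ mO Q ih)|by move=> k x _; rewrite lee_fin].
  move=> x _; apply: cvg_EFin; first exact: nearW.
  by rewrite -[X in _ --> X](mul0r (h x)); apply: cvgM => //; exact: cvg_cst.
have [n0 _ Hn0] := cvge_lt_near H e0; exists n0 => k nk; have := Hn0 k nk.
by rewrite (EFin_Int mO (it k)) lte_fin => /ltW.
Qed.
End cutoffs.

(** * Strong local convergence of the gradients *)

Section local_compactness.
Context {R : realType} {N : nat} {p : R} (p1 : 1 < p).
Variables (Omega : set 'rV[R]_N) (l : R).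
Hypothesis oO : open Omega.
Local Notation X := 'rV[R]_N.
Local Notation mu := (@lebesgue_rV R N).
Implicit Types (f h v w : X -> R) (g gv gw : X -> X) (c : R).
Local Notation Int := (Int Omega).
Local Notation itg := (itg Omega).
Local Notation powInt := (@powInt R N p Omega).
Local Notation gradInt := (@gradInt R N p Omega).
Local Notation W1 := (@W1 R N p Omega).
Local Notation W01 := (@W01 R N p Omega).
Local Notation dEnergy := (@dEnergy R N p Omega l).

Let p0 : 0 < p. Proof. exact: lt_trans p1. Qed.

Let mO : measurable Omega. Proof. exact: open_measurable_rV. Qed.

Lemma itg_mul_bounded (a h : X -> R) (Q : R) : measurable_fun Omega a ->
  (forall x, `|a x| <= Q) -> itg h -> itg (fun x => a x * h x).
Proof.
move=> ma aQ ih; have ih' : itg (fun x => `|h x|) by exact: (integrable_norm ih).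
apply: (itg_le mO _ _ (itgZ mO Q ih')) => [|x _].
  by apply: measurable_funM => //; exact: itg_measurable ih.
by rewrite normrM ler_wpM2r.
Qed.

Lemma local_pint h (r : R) : measurable_fun setT h -> (forall x, 0 <= h x) ->
  (forall x, ~ Omega x -> h x = 0) -> itg h ->
  (\int[mu]_(x in cube r) (h x)%:E = (Int (fun x => \1_(cube r) x * h x))%:E)%E.
Proof.
move=> mh h0 hO ih.
have mI : measurable_fun setT (\1_(cube r) : X -> R) by apply: measurable_indic; exact: measurable_cube.
have i1 : itg (fun x => \1_(cube r) x * h x).
  apply: (@itg_mul_bounded _ _ 1) => // [|x]; first exact: measurable_funTS.
  by rewrite indicE; case: (_ \in _); rewrite ?normr1 ?normr0.
rewrite -(EFin_Int mO i1) [LHS]integral_mkcond [RHS]integral_mkcond.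
apply: eq_integral => x _; rewrite !patchE indicE.
case: (boolP (x \in Omega)) => [_|]; first by case: ifP => _; rewrite ?mul1r ?mul0r.
by rewrite notin_setE => /hO ->; case: ifP.
Qed.

(* Testing with [c *: (a - b) + z *: k], where [a, b] stand for two gradients, [s, t]
   for the values, [c, k] for a cutoff and its gradient. *)
Lemma cutoff_monotone (e c z s t Kp Mp D : R) (a b k : X) : 0 < e -> 0 <= l ->
  enorm (z *: k) `^ p <= Kp * D -> `|c * z| `^ p <= Mp * D ->
  c * dotp (plap p a - plap p b) (a - b) <=
  (dotp (plap p a) (c *: (a - b) + z *: k) - l * (`|s| `^ (p - 2) * s * (c * z))) -
  (dotp (plap p b) (c *: (a - b) + z *: k) - l * (`|t| `^ (p - 2) * t * (c * z))) +
  (e * (enorm a `^ p + enorm b `^ p + l * (`|s| `^ p + `|t| `^ p)) +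
   e `^ (1 - p) * (2 * (Kp + l * Mp)) * D).
Proof.
move=> e0 l0 HK HM.
have q0 : 0 <= e `^ (1 - p) by exact: powR_ge0.
have Ha : - dotp (plap p a) (z *: k) <= e * enorm a `^ p + e `^ (1 - p) * (Kp * D).
  apply: le_trans (_ : _ <= e * enorm a `^ p + e `^ (1 - p) * enorm (z *: k) `^ p) _.
    by rewrite -dotpNr -[enorm (z *: k)]enormN (le_trans (ler_norm _))// plap_young_dotp.
  by rewrite lerD2l ler_wpM2l.
have Hb : dotp (plap p b) (z *: k) <= e * enorm b `^ p + e `^ (1 - p) * (Kp * D).
  apply: le_trans (_ : _ <= e * enorm b `^ p + e `^ (1 - p) * enorm (z *: k) `^ p) _.
    by rewrite (le_trans (ler_norm _))// plap_young_dotp.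
  by rewrite lerD2l ler_wpM2l.
have Hs : `|s| `^ (p - 2) * s * (c * z) <= e * `|s| `^ p + e `^ (1 - p) * (Mp * D).
  apply: le_trans (_ : _ <= e * `|s| `^ p + e `^ (1 - p) * `|c * z| `^ p) _.
    by rewrite (le_trans (ler_norm _))// young_power.
  by rewrite lerD2l ler_wpM2l.
have Ht : - (`|t| `^ (p - 2) * t * (c * z)) <= e * `|t| `^ p + e `^ (1 - p) * (Mp * D).
  apply: le_trans (_ : _ <= e * `|t| `^ p + e `^ (1 - p) * `|c * z| `^ p) _.
    by rewrite (le_trans (ler_norm _))// normrN young_power.
  by rewrite lerD2l ler_wpM2l.
have {}Hs := ler_wpM2l l0 Hs; have {}Ht := ler_wpM2l l0 Ht.
rewrite dotpBl ![dotp _ (c *: _ + _)]dotpDr ![dotp _ (c *: _)]dotpZr.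
move: (dotp (plap p a) (z *: k)) (dotp (plap p b) (z *: k)) Ha Hb.
move: (dotp (plap p a) (a - b)) (dotp (plap p b) (a - b)).
move: (enorm a `^ p) (enorm b `^ p) (e `^ (1 - p)) q0 Hs Ht.
move: (`|s| `^ (p - 2) * s * (c * z)) (`|t| `^ (p - 2) * t * (c * z)) (`|s| `^ p) (`|t| `^ p).
clear; move=> s1 t1 s2 t2 A B q _ Hs Ht m1 m2 m3 m4 Ha Hb; lra.
Qed.

Hypotheses (l0 : 0 <= l) (lP : forall phi, test_function Omega phi ->
  l * powInt phi <= gradInt (gradient phi)).
Variables (u : nat -> X -> R) (B : R).
Local Notation G n := (gradient (u n)).
Hypotheses (T : forall n, test_function Omega (u n)) (P1 : forall n, powInt (u n) = 1)
  (GB : forall n, gradInt (G n) <= B)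
  (Gl : forall e, 0 < e -> exists n0, forall n, (n0 <= n)%N -> gradInt (G n) <= l + e).

Let sm n := test_smooth (T n).
Let W n := test_W1 p1 oO (T n).
Let iP n : itg (fun x => `|u n x| `^ p). Proof. by have [] := W n. Qed.
Let iG n : itg (fun x => enorm (G n x) `^ p). Proof. by have [] := W n. Qed.
Let mu_ n : measurable_fun setT (u n). Proof. exact: measurable_smooth. Qed.
Let mG n : measurable_fun setT (G n). Proof. exact: measurable_gradient. Qed.
Let P1' n : Int (fun x => `|u n x| `^ p) = 1. Proof. exact: P1. Qed.
Let GB' n : Int (fun x => enorm (G n x) `^ p) <= B. Proof. exact: GB. Qed.
Let B0 : 0 <= B. Proof. exact: le_trans (gradInt_ge0 _ _) (GB 0). Qed.

(** [dEnergy_bound] with a small coefficient fixes [d]; afterwards the energy defect of [u n] tends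
    to 0 and beats the factor 1/(p d). Uniformity over all [w] of bounded energy is what allows [w]
    to depend on [n]. *)
Lemma dEnergy_small (Q e : R) : 0 <= Q -> 0 < e -> exists n0, forall n, (n0 <= n)%N ->
  forall w gw, W01 w gw -> gradInt gw <= Q -> `|dEnergy (u n) (G n) w gw| <= e.
Proof.
move=> Q0 e0; have BQ : 0 < B + Q + 1 by rewrite ltr_wpDl ?addr_ge0.
have e1 : 0 < e / 2 by rewrite divr_gt0.
have [d d0 H] := dEnergy_bound p1 oO l0 lP (divr_gt0 e1 BQ).
have pd0 : 0 < p * d by rewrite mulr_gt0.
have [n0 Hn0] := Gl (mulr_gt0 e1 pd0); exists n0 => n nn w gw Ww Gw.
apply: le_trans (H _ _ _ _ (test_W01 p1 oO (T n)) Ww) _.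
rewrite [leRHS]splitr; apply: lerD.
  by rewrite P1 mulr1 ler_pdivrMr// lerBlDl Hn0.
rewrite mulrAC ler_pdivrMr// ler_pM2l//.
by apply: le_trans (lerD (GB n) Gw) _; rewrite lerDl.
Qed.

Hypothesis uC : forall r e, 0 < e -> exists n0, forall i j, (n0 <= i)%N -> (n0 <= j)%N ->
  (pint p (cube r) (fun x => u i x - u j x)%R <= e%:E)%E.

(** Everything in the tested equations besides the monotone term contains u_i - u_j on the support
    of the cutoff, where the L^p Cauchy property is known. [enormB_le_plap] then converts the
    monotone term into the distance of the gradients. *)
Lemma gradient_Cauchy r e : 0 < e -> exists n0, forall i j, (n0 <= i)%N -> (n0 <= j)%N ->
  (pint_grad p (cube r) (fun x => G i x - G j x)%R <= e%:E)%E.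
Proof.
move=> e0; have [chi [M [K [r' [rho [M0 K0 rho0 Hchi _]]]]]] := @cutoff_sequence R N.
(* The dilation is large enough for the cutoff to be at least 1/2 on [cube r]; this is the origin of
   the factor 2 below. *)
pose k := (Num.truncn (r / rho)).
have rk : r <= rho * k.+1%:R by rewrite mulrC -ler_pdivrMr// ltW// truncnS_gt.
have [sc cM gc cz c2] := Hchi k; set c := chi k in sc cM gc cz c2.
set rr := r' * k.+1%:R in cz; set Kk := K / k.+1%:R in gc.
have Kk0 : 0 <= Kk by rewrite divr_ge0// ltW.
have c0 x : 0 <= c x by have /andP[] := cM x.
have cM' x : `|c x| <= M by rewrite ger0_norm//; have /andP[] := cM x.
have mc : measurable_fun setT c := measurable_smooth sc.
pose w i j := c \* (fun x => u i x - u j x).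
have Tij i j : test_function Omega (fun x => u i x - u j x) by exact: testB.
have Tw i j : test_function Omega (w i j) by exact: testM.
have gw i j x : gradient (w i j) x = c x *: (G i x - G j x) + (u i x - u j x) *: gradient c x.
  by rewrite (gradientM _ sc (test_smooth (Tij i j))) (gradientB _ (sm i) (sm j)).
(* A bound for the energies of all [w i j], so that [dEnergy_small] gives one threshold for all
   pairs. *)
pose Q := 2 `^ p * (M `^ p * (2 `^ p * (B + B)) + Kk `^ p * (2 `^ p * 2)).
have pw x : (0:R) <= x `^ p := powR_ge0 _ _.
have Q0 : 0 <= Q by rewrite !(mulr_ge0, addr_ge0, powR_ge0, B0).
have cutG i j x : enorm ((u i x - u j x) *: gradient c x) `^ p <= Kk `^ p * `|u i x - u j x| `^ p.
  rewrite enormZ_powR mulrC ler_wpM2r// ge0_ler_powR ?nnegrE ?enorm_ge0 ?(ltW p0)//.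
have cutP x z : `|c x * z| `^ p <= M `^ p * `|z| `^ p.
  by rewrite normrM powRM// ler_wpM2r// ge0_ler_powR ?nnegrE ?(ltW p0) ?(ltW M0).
have GQ i j : gradInt (gradient (w i j)) <= Q.
  have j1 := itgD mO (iG i) (iG j); have j2 := itgD mO (iP i) (iP j).
  have j3 := itgZ mO (M `^ p) (itgZ mO (2 `^ p) j1).
  have j4 := itgZ mO (Kk `^ p) (itgZ mO (2 `^ p) j2).
  have j5 := itgZ mO (2 `^ p) (itgD mO j3 j4).
  have [_ _ _ iw] := test_W1 p1 oO (Tw i j).
  apply: le_trans (Int_le mO iw j5 _) _ => [x _|].
    rewrite gw; apply: le_trans (enormD_powR p1 _ _) _; rewrite ler_wpM2l//.
    apply: lerD; last first.
      by apply: le_trans (cutG _ _ _) _; rewrite ler_wpM2l// -[`|u j x|]normrN normrD_powR.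
    rewrite enormZ_powR; apply: ler_pM => //; last exact: enormB_powR.
    by rewrite ge0_ler_powR ?nnegrE ?(ltW p0) ?(ltW M0).
  rewrite (IntZ mO _ (itgD mO j3 j4)) (IntD mO j3 j4) (IntZ mO _ (itgZ mO _ j1)) (IntZ mO _ (itgZ mO _ j2)).
  rewrite (IntZ mO _ j1) (IntZ mO _ j2) (IntD mO (iG i) (iG j)) (IntD mO (iP i) (iP j)).
  rewrite !P1' /Q; apply: (ler_wpM2l (pw _)); rewrite lerD2r; apply: (ler_wpM2l (pw _)).
  by apply: (ler_wpM2l (pw _)); exact: lerD (GB' i) (GB' j).
(* One half of [e] pays for the error term of the quantitative monotonicity, the other half is 2 * C
   * h. *)
have e20 : 0 < e / (8 * M * (B + 1)) by rewrite divr_gt0// !mulr_gt0// ltr_wpDl.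
have [C C0 HC] := @enormB_le_plap R N p p1 _ e20.
pose h := e / (4 * C); have h0 : 0 < h by rewrite divr_gt0// mulr_gt0.
(* [h] is spent in quarters: two for the equations of [u i] and [u j], one for the Young terms with
   coefficient [e1], one for the L^p distance multiplied by e1^(1-p) * Q2. *)
pose e1 := h / (8 * (B + l + 1)).
have e10 : 0 < e1 by rewrite divr_gt0// mulr_gt0// ltr_wpDl// addr_ge0.
pose Q2 := 2 * (Kk `^ p + l * M `^ p).
have Q20 : 0 <= e1 `^ (1 - p) * Q2 by rewrite /Q2 mulr_ge0 ?powR_ge0// mulr_ge0// addr_ge0// mulr_ge0.
have h4 : 0 < h / 4 by rewrite divr_gt0.
have Q21 : 0 < e1 `^ (1 - p) * Q2 + 1 by rewrite ltr_wpDl.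
have e30 := divr_gt0 h4 Q21.
have [n1 Hn1] := dEnergy_small Q0 h4.
have [n2 Hn2] := uC rr e30.
exists (maxn n1 n2) => i j; rewrite !geq_max => /andP[i1 i2] /andP[j1 j2].
pose D x := \1_(cube rr) x * `|u i x - u j x| `^ p.
have mij : measurable_fun setT (fun x => `|u i x - u j x| `^ p).
  by apply: measurable_powR_norm; exact: measurable_funB.
have [iD ID] : itg D /\ Int D <= h / 4 / (e1 `^ (1 - p) * Q2 + 1).
  by apply: local_itg => //; exact: Hn2.
pose A x := c x * dotp (plap p (G i x) - plap p (G j x)) (G i x - G j x).
have mGo n : measurable_fun Omega (G n) by exact: measurable_funTS.
have muo n : measurable_fun Omega (u n) by exact: measurable_funTS.
have [mb1 mb2 ib1 ib2] := test_W1 p1 oO (Tij i j).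
have [mw1 mw2 iw1 iw2] := test_W1 p1 oO (Tw i j).
have iGij : itg (fun x => enorm (G i x - G j x) `^ p).
  move: ib2; congr itg; apply/funext => x.
  by rewrite (gradientB _ (sm i) (sm j)).
have iA : itg A.
  apply: (itg_mul_bounded (Q := M)) => //; first exact: measurable_funTS.
  have a1 := itg_young p1 oO (mGo i) (measurable_vecB oO (mGo i) (mGo j)) (iG i) iGij.
  have a2 := itg_young p1 oO (mGo j) (measurable_vecB oO (mGo i) (mGo j)) (iG j) iGij.
  by move: (itgB mO a1 a2); congr itg; apply/funext => x; rewrite dotpBl.
have IA : Int A <= h.
  have L n := itg_young p1 oO (mGo n) mw2 (iG n) iw2.
  have K' n := itgZ mO l (itg_power p1 oO (muo n) mw1 (iP n) iw1).
  have k1 := itgB mO (itgB mO (L i) (K' i)) (itgB mO (L j) (K' j)).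
  have k2 := itgD mO (itgD mO (iG i) (iG j)) (itgZ mO l (itgD mO (iP i) (iP j))).
  have k3 := itgD mO (itgZ mO e1 k2) (itgZ mO (e1 `^ (1 - p) * Q2) iD).
  apply: le_trans (Int_le mO iA (itgD mO k1 k3) _) _ => [x _|].
    rewrite /A gw; apply: cutoff_monotone => //; rewrite /D indicE.
      case: (boolP (x \in cube rr)) => [_|]; first by rewrite mul1r.
      rewrite notin_setE => /cz[_ ->]; rewrite scaler0 enorm0 mul0r mulr0.
      by rewrite powR0 ?gt_eqF.
    case: (boolP (x \in cube rr)) => [_|]; first by rewrite mul1r.
    rewrite notin_setE => /cz[-> _]; rewrite mul0r normr0 mul0r mulr0.
    by rewrite powR0 ?gt_eqF.
  rewrite (IntD mO k1 k3) (IntB mO (itgB mO (L i) (K' i)) (itgB mO (L j) (K' j))).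
  rewrite (IntB mO (L i) (K' i)) (IntB mO (L j) (K' j)).
  rewrite (IntZ mO _ (itg_power p1 oO (muo i) mw1 (iP i) iw1)).
  rewrite (IntZ mO _ (itg_power p1 oO (muo j) mw1 (iP j) iw1)).
  rewrite (IntD mO (itgZ mO e1 k2) (itgZ mO (e1 `^ (1 - p) * Q2) iD)) (IntZ mO _ k2) (IntZ mO _ iD).
  rewrite (IntD mO (itgD mO (iG i) (iG j)) (itgZ mO l (itgD mO (iP i) (iP j)))).
  rewrite (IntD mO (iG i) (iG j)) (IntZ mO _ (itgD mO (iP i) (iP j))) (IntD mO (iP i) (iP j)).
  rewrite !P1'.
  have Wij := test_W01 p1 oO (Tw i j).
  have Di := le_trans (ler_norm _) (Hn1 i i1 _ _ Wij (GQ i j)).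
  have Dj := Hn1 j j1 _ _ Wij (GQ i j); rewrite -normrN in Dj.
  have {}Dj := le_trans (ler_norm _) Dj.
  have d1 : e1 * (Int (fun x => enorm (G i x) `^ p) + Int (fun x => enorm (G j x) `^ p) + l * (1 + 1)) <= h / 4.
    rewrite /e1 mulrAC ler_pdivrMr ?mulr_gt0 ?ltr_wpDl ?addr_ge0//.
    have -> : h / 4 * (8 * (B + l + 1)) = h * (B + B + l * (1 + 1) + 2) by field.
    apply: (ler_wpM2l (ltW h0)); apply: le_trans (lerD (lerD (GB' i) (GB' j)) (lexx _)) _.
    by rewrite lerDl.
  have d2 : e1 `^ (1 - p) * Q2 * Int D <= h / 4.
    apply: le_trans (ler_wpM2l Q20 ID) _; rewrite mulrCA ler_piMr ?(ltW h4)//.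
    by rewrite ler_pdivrMr ?mul1r ?lerDl// ltr_wpDl.
  apply: le_trans (lerD (lerD Di Dj) (lerD d1 d2)) _.
  by rewrite le_eqVlt; apply/orP; left; apply/eqP; field.
have iAB := itgD mO (iG i) (iG j).
have k1 := itgD mO (itgZ mO (2 * (e / (8 * M * (B + 1)) * M)) iAB) (itgZ mO (2 * C) iA).
have GO x : ~ Omega x -> enorm (G i x - G j x) `^ p = 0.
  by move=> nx; rewrite (gradient_out (T i) nx) (gradient_out (T j) nx) subrr enorm0 powR0 ?gt_eqF.
have mgij : measurable_fun setT (fun x => enorm (G i x - G j x) `^ p).
  by apply: measurable_powR_enorm; apply: measurable_vecB => //; exact: openT.
rewrite /pint_grad (local_pint r mgij _ GO iGij)// lee_fin.
have iI : itg (fun x => \1_(cube r) x * enorm (G i x - G j x) `^ p).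
  apply: (itg_mul_bounded (Q := 1)) => // [|x].
    by apply: measurable_funTS; apply: measurable_indic; exact: measurable_cube.
  by rewrite indicE; case: (_ \in _); rewrite ?normr1 ?normr0.
apply: le_trans (Int_le mO iI k1 _) _ => [x _|].
  have H : c x * enorm (G i x - G j x) `^ p <=
      e / (8 * M * (B + 1)) * M * (enorm (G i x) `^ p + enorm (G j x) `^ p) + C * A x.
    apply: le_trans (ler_wpM2l (c0 x) (HC _ _)) _; rewrite mulrDr [C * A x]mulrCA lerD2r.
    rewrite mulrA ler_wpM2r ?addr_ge0// mulrC ler_wpM2l ?(ltW e20)//.
    by have /andP[] := cM x.
  rewrite -![2 * _ * _]mulrA -mulrDr; apply: le_trans (ler_wpM2l _ H) => //.
  rewrite indicE mulrA; case: (boolP (x \in cube r)) => [/set_mem xr|_]; last first.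
    by rewrite mul0r !mulr_ge0.
  rewrite mul1r ler_peMl// mulrC -ler_pdivrMr// mul1r; apply: c2.
  exact: le_trans xr rk.
rewrite (IntD mO (itgZ mO (2 * (e / (8 * M * (B + 1)) * M)) iAB) (itgZ mO (2 * C) iA)).
rewrite (IntZ mO _ iAB) (IntZ mO _ iA) (IntD mO (iG i) (iG j)) [leRHS]splitr.
apply: lerD.
  have -> : e / 2 = 2 * (e / (8 * M * (B + 1)) * M) * ((B + 1) + (B + 1)).
    by field; rewrite !gt_eqF// ltr_wpDl.
  apply: ler_wpM2l; first by rewrite mulr_ge0// mulr_ge0 ?(ltW e20) ?(ltW M0).
  by apply: le_trans (lerD (GB' i) (GB' j)) _; apply: lerD; rewrite lerDl.
apply: le_trans (ler_wpM2l _ IA) _; first by rewrite mulr_ge0// ltW.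
by rewrite /h le_eqVlt; apply/orP; left; apply/eqP; field; rewrite gt_eqF.
Qed.
End local_compactness.

(** * The local limit as an eigenfunction *)

Section limit_function.
Context {R : realType} {N : nat} {p : R} (p1 : 1 < p).
Variables (Omega : set 'rV[R]_N) (l : R).
Hypothesis oO : open Omega.
Local Notation X := 'rV[R]_N.
Local Notation mu := (@lebesgue_rV R N).
Local Notation Int := (Int Omega).
Local Notation itg := (itg Omega).
Local Notation powInt := (@powInt R N p Omega).
Local Notation gradInt := (@gradInt R N p Omega).
Local Notation W01 := (@W01 R N p Omega).
Local Notation dEnergy := (@dEnergy R N p Omega l).

Let p0 : 0 < p. Proof. exact: lt_trans p1. Qed.

Let mO : measurable Omega. Proof. exact: open_measurable_rV. Qed.

Hypotheses (l0 : 0 <= l) (lP : forall phi, test_function Omega phi ->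
  l * powInt phi <= gradInt (gradient phi)).
Variables (u : nat -> X -> R) (B : R).
Local Notation G n := (gradient (u n)).
Hypotheses (T : forall n, test_function Omega (u n)) (P1 : forall n, powInt (u n) = 1)
  (GB : forall n, gradInt (G n) <= B)
  (Gl : forall e, 0 < e -> exists n0, forall n, (n0 <= n)%N -> gradInt (G n) <= l + e).
Variables (v : X -> R) (g : X -> X).
Hypotheses (mv : measurable_fun setT v) (mg : measurable_fun setT g)
  (vL : forall r e, 0 < e -> exists n0, forall n, (n0 <= n)%N ->
    (pint p (cube r) (fun x => u n x - v x)%R <= e%:E)%E)
  (gL : forall r e, 0 < e -> exists n0, forall n, (n0 <= n)%N ->
    (pint_grad p (cube r) (fun x => G n x - g x)%R <= e%:E)%E).

Let sm n := test_smooth (T n).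
Let W n := test_W1 p1 oO (T n).
Let iP n : itg (fun x => `|u n x| `^ p). Proof. by have [] := W n. Qed.
Let iG n : itg (fun x => enorm (G n x) `^ p). Proof. by have [] := W n. Qed.
Let mu_ n : measurable_fun setT (u n). Proof. exact: measurable_smooth. Qed.
Let mG n : measurable_fun setT (G n). Proof. exact: measurable_gradient. Qed.
Let P1' n : Int (fun x => `|u n x| `^ p) = 1. Proof. exact: P1. Qed.
Let GB' n : Int (fun x => enorm (G n x) `^ p) <= B. Proof. exact: GB. Qed.
Let B0 : 0 <= B. Proof. exact: le_trans (gradInt_ge0 _ _) (GB 0). Qed.
Let pw (x : R) : 0 <= x `^ p. Proof. exact: powR_ge0. Qed.

Let mvp : measurable_fun setT (fun x => `|v x| `^ p).
Proof. exact: measurable_powR_norm. Qed.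
Let mgp : measurable_fun setT (fun x => enorm (g x) `^ p).
Proof. exact: measurable_powR_enorm. Qed.

Local Notation D r n x := (\1_(cube r) x * `|u n x - v x| `^ p).
Local Notation E r n x := (\1_(cube r) x * enorm (G n x - g x) `^ p).

Let vloc r e : 0 < e -> exists n0, forall n, (n0 <= n)%N ->
  itg (fun x => D r n x) /\ Int (fun x => D r n x) <= e.
Proof.
move=> e0; have [n0 H] := vL r e0; exists n0 => n nn.
apply: (local_itg oO) => //; last exact: H.
by apply: measurable_powR_norm; exact: measurable_funB.
Qed.

Let gloc r e : 0 < e -> exists n0, forall n, (n0 <= n)%N ->
  itg (fun x => E r n x) /\ Int (fun x => E r n x) <= e.
Proof.
move=> e0; have [n0 H] := gL r e0; exists n0 => n nn.
apply: (local_itg oO) => //; last exact: H.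
by apply: measurable_powR_enorm; apply: measurable_vecB => //; exact: openT.
Qed.

Let itg_cubeM h r : itg h -> itg (fun x => \1_(cube r) x * h x).
Proof.
move=> ih; apply: (itg_mul_bounded oO (Q := 1)) => // [|x].
  by apply: measurable_funTS; apply: measurable_indic; exact: measurable_cube.
by rewrite indicE; case: (_ \in _); rewrite ?normr1 ?normr0.
Qed.

Let mI r : measurable_fun Omega (\1_(cube r) : X -> R).
Proof. by apply: measurable_funTS; apply: measurable_indic; exact: measurable_cube. Qed.

(** On each cube the limit is within distance 1 of some [u n], whose total mass is 1; the resulting
    bound does not depend on the cube. *)
Lemma limit_itg : itg (fun x => `|v x| `^ p).
Proof.
apply: (@itg_exhaust _ _ _ oO _ (2 `^ p * (1 + 1))) => // k.
have [n /(_ n (leqnn _))[iD ID]] := @vloc k%:R 1 ltr01.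
have j := itgZ mO (2 `^ p) (itgD mO iD (iP n)).
have le x : \1_(cube k%:R) x * `|v x| `^ p <= 2 `^ p * (D k%:R n x + `|u n x| `^ p).
  apply: le_trans (_ : _ <= 2 `^ p * (\1_(cube k%:R) x * (`|v x - u n x| `^ p + `|u n x| `^ p))) _.
    rewrite mulrCA; apply: ler_wpM2l => //.
    by rewrite -{1}(subrK (u n x) (v x)) normrD_powR.
  apply: ler_wpM2l => //; rewrite mulrDr distrC lerD2l.
  by rewrite -[leRHS]mul1r ler_wpM2r.
have i : itg (fun x => \1_(cube k%:R) x * `|v x| `^ p).
  apply: (itg_le mO _ _ j) => [|x _]; last by rewrite ger0_norm ?mulr_ge0.
  by apply: measurable_funM => //; exact: measurable_funTS.
split=> //; apply: le_trans (Int_le mO i j (fun x _ => le x)) _.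
rewrite (IntZ mO _ (itgD mO iD (iP n))) (IntD mO iD (iP n)) P1'.
by apply: ler_wpM2l => //; rewrite lerD2r.
Qed.

Lemma limit_grad_itg : itg (fun x => enorm (g x) `^ p).
Proof.
apply: (@itg_exhaust _ _ _ oO _ (2 `^ p * (1 + B))) => // k.
have [n /(_ n (leqnn _))[iD ID]] := @gloc k%:R 1 ltr01.
have j := itgZ mO (2 `^ p) (itgD mO iD (iG n)).
have le x : \1_(cube k%:R) x * enorm (g x) `^ p <= 2 `^ p * (E k%:R n x + enorm (G n x) `^ p).
  apply: le_trans (_ : _ <= 2 `^ p * (\1_(cube k%:R) x * (enorm (g x - G n x) `^ p + enorm (G n x) `^ p))) _.
    rewrite mulrCA; apply: ler_wpM2l => //.
    by rewrite -{1}(subrK (G n x) (g x)) enormD_powR.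
  apply: ler_wpM2l => //; rewrite mulrDr -opprB enormN lerD2l.
  by rewrite -[leRHS]mul1r ler_wpM2r.
have i : itg (fun x => \1_(cube k%:R) x * enorm (g x) `^ p).
  apply: (itg_le mO _ _ j) => [|x _]; last by rewrite ger0_norm ?mulr_ge0.
  by apply: measurable_funM => //; exact: measurable_funTS.
split=> //; apply: le_trans (Int_le mO i j (fun x _ => le x)) _.
rewrite (IntZ mO _ (itgD mO iD (iG n))) (IntD mO iD (iG n)).
by apply: ler_wpM2l => //; apply: lerD.
Qed.

Lemma limit_W1 : W1 Omega v g (p := p).
Proof.
split; [exact: measurable_funTS|exact: measurable_funTS|exact: limit_itg|exact: limit_grad_itg].
Qed.

(** Were [v] zero almost everywhere, the mass of [u n] in the cube would be at most 2^p times its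
    distance to [v] there, which can be made at most e/2. *)
Lemma limit_nonzero (r e : R) : 0 < e ->
  (forall n, e <= Int (fun x => \1_(cube r) x * `|u n x| `^ p)) ->
  ~ {ae mu, forall x, Omega x -> v x = 0}.
Proof.
move=> e0 He v0; have q0 : 0 < 2 `^ p :> R by rewrite powR_gt0.
have d0 : 0 < e / 2 / 2 `^ p by rewrite !divr_gt0.
have [n /(_ n (leqnn _))[iD ID]] := vloc r d0.
have iv := itg_cubeM r limit_itg.
have Iv : Int (fun x => \1_(cube r) x * `|v x| `^ p) = 0.
  apply/EFin_inj; rewrite -(EFin_Int mO iv).
  rewrite (ae_eq_integral (cst 0%E)) ?integral0//.
  - by apply/measurable_EFinP; exact: itg_measurable iv.
  - apply: filterS v0 => x vx Ox /=.
    by rewrite vx// normr0 powR0 ?gt_eqF// mulr0.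
have j := itgD mO iD iv.
have := Int_le mO (itg_cubeM r (iP n)) (itgZ mO (2 `^ p) j).
rewrite (IntZ mO _ j) (IntD mO iD iv) Iv addr0 => H.
have : e <= 2 `^ p * Int (fun x => D r n x).
  apply: le_trans (He n) _; apply: H => x _.
  rewrite -mulrDr mulrCA ler_wpM2l//.
  by rewrite -{1}(subrK (v x) (u n x)) normrD_powR.
rewrite leNgt => /negP; apply.
apply: le_lt_trans (ler_wpM2l (ltW q0) ID) _; rewrite mulrC divfK ?gt_eqF//.
by rewrite ltr_pdivrMr// ltr_pMr// ltr1n.
Qed.

(** The difference v - chi u_n consists of the tail (1 - chi) v and the local error chi (u_n - v);
    the gradients split alike, with u_n times the gradient of chi in addition. *)
Let cutoff_pt (M Kk c : R) (k : X) (z w : R) (a b : X) : 0 <= c <= M -> enorm k <= Kk -> 0 <= M ->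
  `|z - c * w| `^ p + enorm (a - (c *: b + w *: k)) `^ p <= 2 `^ p * (2 `^ p *
   (`|1 - c| `^ p * (`|z| `^ p + enorm a `^ p) + c `^ p * (`|w - z| `^ p + enorm (b - a) `^ p) +
    Kk `^ p * `|w| `^ p)).
Proof.
move=> /andP[c0 cM] kK M0; have q1 : 1 <= 2 `^ p :> R by rewrite -[leLHS](powRr0 2) ler_powR ?ler1n ?(ltW p0).
have q0 : 0 <= 2 `^ p :> R by [].
have H1 : `|z - c * w| `^ p <= 2 `^ p * (`|1 - c| `^ p * `|z| `^ p + c `^ p * `|w - z| `^ p).
  have -> : z - c * w = (1 - c) * z + (- c) * (w - z) by ring.
  apply: le_trans (normrD_powR p1 _ _) _; rewrite !normrM normrN (ger0_norm c0).
  by rewrite !powRM.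
have H2 : enorm (a - (c *: b + w *: k)) `^ p <= 2 `^ p * (2 `^ p * (`|1 - c| `^ p * enorm a `^ p +
    c `^ p * enorm (b - a) `^ p) + Kk `^ p * `|w| `^ p).
  have -> : a - (c *: b + w *: k) = ((1 - c) *: a + (- c) *: (b - a)) + (- w) *: k.
    by apply/rowP => i; rewrite !mxE; ring.
  apply: le_trans (enormD_powR p1 _ _) _; rewrite ler_wpM2l//; apply: lerD.
    apply: le_trans (enormD_powR p1 _ _) _; rewrite !enormZ_powR normrN (ger0_norm c0) ler_wpM2l//.
  rewrite enormZ_powR normrN mulrC ler_wpM2r// ge0_ler_powR ?nnegrE ?enorm_ge0 ?(ltW p0)//.
  exact: le_trans (enorm_ge0 _) kK.
have c1 : 0 <= `|1 - c| `^ p * `|z| `^ p + c `^ p * `|w - z| `^ p by rewrite addr_ge0 ?mulr_ge0.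
have c2 : 0 <= Kk `^ p * `|w| `^ p by rewrite mulr_ge0.
apply: le_trans (lerD H1 H2) _; rewrite -mulrDr; apply: ler_wpM2l => //.
apply: le_trans (_ : _ <= 2 `^ p * (`|1 - c| `^ p * `|z| `^ p + c `^ p * `|w - z| `^ p) +
   (2 `^ p * (`|1 - c| `^ p * enorm a `^ p + c `^ p * enorm (b - a) `^ p) +
    2 `^ p * (Kk `^ p * `|w| `^ p))) _.
  by rewrite lerD ?ler_peMl// lerD2l ler_peMl.
by rewrite -!mulrDr; apply: ler_wpM2l => //; rewrite !mulrDr addrA lerD2r addrACA.
Qed.

Let harmonic_small (K d : R) : 0 < d -> exists k0, forall k, (k0 <= k)%N -> K / k.+1%:R <= d.
Proof.
move=> d0; exists (Num.truncn (K / d)).+1 => k kk.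
rewrite ler_pdivrMr// mulrC -ler_pdivrMr//; apply/ltW/(lt_le_trans (truncnS_gt _)).
by rewrite ler_nat (leq_trans kk).
Qed.

(** The products of cutoffs with [u n] are test functions approximating [v]. The cutoff is fixed
    first, making the tail and its own gradient small, the latter thanks to the unit mass of [u n];
    only then is [n] chosen, on the support of that cutoff. *)
Lemma limit_W01 : W01 v g.
Proof.
split=> [|e e0]; first exact: limit_W1.
have [chi [M [K [r' [rho [M0 K0 rho0 Hchi chi1]]]]]] := @cutoff_sequence R N.
have q0 : 0 < 2 `^ p :> R by rewrite powR_gt0.
(* Three errors of size [d] are multiplied by 2^p twice, which gives 3/4 of [e]. *)
pose d := e / (4 * (2 `^ p * 2 `^ p)).
have d0 : 0 < d by rewrite divr_gt0// !mulr_gt0.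
have ih := itgD mO limit_itg limit_grad_itg.
have mc k : measurable_fun setT (chi k) by have [sc _ _ _ _] := Hchi k; exact: measurable_smooth.
have ma k : measurable_fun Omega (fun x => `|1 - chi k x| `^ p).
  by apply: measurable_funTS; apply: measurable_powR_norm; exact: measurable_funB.
have c01 k x : 0 <= chi k x <= M by have [_ + _ _ _] := Hchi k.
have aQ k x : 0 <= `|1 - chi k x| `^ p <= (1 + M) `^ p.
  rewrite pw ge0_ler_powR ?nnegrE ?addr_ge0 ?(ltW p0) ?(ltW M0)//.
  apply: le_trans (ler_normB _ _) _; rewrite normr1 lerD2l.
  by have /andP[a b] := c01 k x; rewrite ger0_norm.
have a0 x : `|1 - chi k x| `^ p @[k --> \oo] --> 0.
  rewrite (_ : 0 = `|1 - 1 : R| `^ p); last by rewrite subrr normr0 powR0 ?gt_eqF.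
  apply: (cvg_norm_powR p1).
  by apply: cvgB; [exact: cvg_cst|exact: chi1].
have h0 x : 0 <= `|v x| `^ p + enorm (g x) `^ p by rewrite addr_ge0.
have [ia /(_ _ d0)[k1 Hk1]] := Int_cvg0 oO ih h0 ma aQ a0.
have d1 : 0 < d `^ p^-1 by rewrite powR_gt0.
have [k2 Hk2] := harmonic_small K d1; pose k := maxn k1 k2.
have {Hk1} Ia := Hk1 k (leq_maxl _ _).
have {Hk2} kap : (K / k.+1%:R) `^ p <= d.
  have := Hk2 k (leq_maxr _ _) => H.
  have -> : d = (d `^ p^-1) `^ p by rewrite -powRrM mulVf ?gt_eqF// powRr1 ?(ltW d0).
  by rewrite ge0_ler_powR ?nnegrE ?powR_ge0 ?(ltW p0) ?divr_ge0 ?(ltW K0).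
have [sc _ gc cz _] := Hchi k; set rr := r' * k.+1%:R in cz.
have Mp0 : 0 < M `^ p by rewrite powR_gt0.
have d2 : 0 < d / 2 / M `^ p by rewrite !divr_gt0.
have [n1 Hn1] := vloc rr d2; have [n2 Hn2] := gloc rr d2.
have [iD ID] := Hn1 _ (leq_maxl n1 n2); have [iE IE] := Hn2 _ (leq_maxr n1 n2).
set n := maxn n1 n2 in iD ID iE IE.
exists (chi k \* u n); first exact: testM.
have [m1 m2 i1 i2] := W1B p1 oO limit_W1 (test_W1 p1 oO (testM sc (T n))).
rewrite /powInt /gradInt -(IntD mO i1 i2).
have iDE := itgD mO iD iE.
have j1 := itgD mO (itgD mO (ia k) (itgZ mO (M `^ p) iDE)) (itgZ mO ((K / k.+1%:R) `^ p) (iP n)).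
have j2 := itgZ mO (2 `^ p) (itgZ mO (2 `^ p) j1).
apply: le_lt_trans (Int_le mO (itgD mO i1 i2) j2 _) _ => [x _|].
  rewrite (gradientM _ sc (sm n)).
  apply: le_trans (cutoff_pt (v x) (u n x) (g x) (G n x) (c01 k x) (gc x) (ltW M0)) _.
  rewrite ler_wpM2l// ler_wpM2l// lerD2r lerD2l -mulrDr indicE.
  case: (boolP (x \in cube rr)) => [_|].
    rewrite mul1r ler_wpM2r ?addr_ge0// ge0_ler_powR ?nnegrE ?(ltW p0) ?(ltW M0)//;
    by have /andP[] := c01 k x.
  by rewrite notin_setE => /cz[-> _]; rewrite mul0r mulr0 powR0 ?gt_eqF// mul0r.
rewrite (IntZ mO _ (itgZ mO (2 `^ p) j1)) (IntZ mO _ j1).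
rewrite (IntD mO (itgD mO (ia k) (itgZ mO (M `^ p) iDE)) (itgZ mO ((K / k.+1%:R) `^ p) (iP n))).
rewrite (IntD mO (ia k) (itgZ mO (M `^ p) iDE)) (IntZ mO _ iDE) (IntZ mO _ (iP n)) (IntD mO iD iE) P1' mulr1.
have IDE : M `^ p * (Int (fun x => D rr n x) + Int (fun x => E rr n x)) <= d.
  apply: le_trans (ler_wpM2l (pw _) (lerD ID IE)) _.
  by rewrite -mulrDl -splitr mulrC divfK ?gt_eqF.
have S := lerD (lerD Ia IDE) kap.
apply: le_lt_trans (ler_wpM2l (pw _) (ler_wpM2l (pw _) S)) _.
have -> : 2 `^ p * (2 `^ p * (d + d + d)) = e * (3 / 4).
  by rewrite /d; field; rewrite gt_eqF.
by rewrite gtr_pMr// ltr_pdivrMr// mul1r ltr_nat.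
Qed.

(* Testing with [c * s], where [a], [b] stand for the gradients of the limit and of an
   approximant, [z], [s] for their values, and [c], [q] for a cutoff and its gradient. *)
Let cutoff_energy (c e C C' M ka s z d d' : R) (a b q : X) : 0 <= c <= M ->
  0 <= e -> 0 <= C * d -> 0 <= C' * d' ->
  enorm q <= ka ->
  c * enorm a `^ p <= c * (enorm b `^ p + (e * enorm a `^ p + C' * d')) ->
  c * `|s| `^ p <= c * (`|z| `^ p + (e * `|z| `^ p + C * d)) ->
  enorm a `^ p - l * `|z| `^ p <=
    (dotp (plap p b) (c *: b + s *: q) - l * (`|s| `^ (p - 2) * s * (c * s))) +
    (`|1 - c| * (enorm a `^ p + l * `|z| `^ p) + ka * (enorm b `^ p + `|s| `^ p) +
     (e * M * (enorm a `^ p + l * `|z| `^ p) + M * (C' * d' + l * (C * d)))).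
Proof.
move=> /andP[c0 cM] e0 Cd Cd' qk Ha Hs.
have H1 : - (ka * (enorm b `^ p + `|s| `^ p)) <= dotp (plap p b) (s *: q).
  rewrite lerNl -dotpNr; apply: le_trans (ler_norm _) _; rewrite -scaleNr.
  apply: le_trans (normr_dotp_plap p1 _ _) _; rewrite enormZ normrN mulrA mulrC.
  apply: ler_pM => //; rewrite ?enorm_ge0 ?mulr_ge0 ?powR_ge0//.
  by apply: powR_young1; rewrite ?enorm_ge0.
have ss : `|s| `^ (p - 2) * s * (c * s) = c * `|s| `^ p.
  by rewrite mulrCA -dotp_plap_vec1 (dotp_plap p1) enorm_vec1.
rewrite dotpDr dotpZr (dotp_plap p1) ss.
have b1 : 1 - c <= `|1 - c| by exact: ler_norm.
have b2 : c - 1 <= `|1 - c| by rewrite -normrN opprB ler_norm.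
have A0 : 0 <= enorm a `^ p by []. have Z0 : 0 <= l * `|z| `^ p by rewrite mulr_ge0.
have e1 := ler_wpM2r A0 b1; have e2 := ler_wpM2r Z0 b2.
have e3 := Ha; have e4 := ler_wpM2l l0 Hs.
have f1 : c * (e * enorm a `^ p + C' * d') <= M * (e * enorm a `^ p + C' * d').
  by rewrite ler_wpM2r// addr_ge0// mulr_ge0.
have f2 : l * (c * (e * `|z| `^ p + C * d)) <= l * (M * (e * `|z| `^ p + C * d)).
  by rewrite ler_wpM2l// ler_wpM2r// addr_ge0// mulr_ge0.
move: (C * d) (C' * d') (enorm a `^ p) (enorm b `^ p) (`|z| `^ p) (`|s| `^ p) (`|1 - c|)
  (dotp (plap p b) (s *: q)) H1 e1 e2 e3 e4 f1 f2.
move=> x y A B' Z S t w H1 e1 e2 e3 e4 f1 f2; lra.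
Qed.

(** Testing the equation of [u n] with the cutoff times [u n] localises the identity between energy
    and mass. Both sides then converge on the support, and the tails concern only the limit, whose
    integrability is already known. *)
Lemma limit_le : gradInt g <= l * powInt v.
Proof.
have [chi [M [K [r' [rho [M0 K0 rho0 Hchi chi1]]]]]] := @cutoff_sequence R N.
have GP0 : 0 <= gradInt g + l * powInt v by rewrite addr_ge0 ?mulr_ge0 ?gradInt_ge0 ?powInt_ge0.
(* The coefficient collects the errors met below: the equation, the tail, the gradient of the
   cutoff, and the replacement of [v] and [g] by the approximants. *)
apply: (@ler_epsM _ _ _ (1 + 1 + (B + 1) + (M * (gradInt g + l * powInt v) + M * (1 + 1)))) => [|e e0].
  have M1 := mulr_ge0 (ltW M0) GP0; have M2 : 0 <= M * (1 + 1) by rewrite mulr_ge0// ltW.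
  by rewrite addr_ge0 ?addr_ge0.
have iv := limit_itg; have ig := limit_grad_itg.
have ih := itgD mO ig (itgZ mO l iv).
have mc k : measurable_fun setT (chi k) by have [sc _ _ _ _] := Hchi k; exact: measurable_smooth.
have ma k : measurable_fun Omega (fun x => `|1 - chi k x|).
  by apply: measurable_funTS; apply: measurableT_comp => //; exact: measurable_funB.
have c01 k x : 0 <= chi k x <= M by have [_ + _ _ _] := Hchi k.
have aQ k x : 0 <= `|1 - chi k x| <= 1 + M.
  rewrite normr_ge0/=; apply: le_trans (ler_normB _ _) _; rewrite normr1 lerD2l.
  by have /andP[a b] := c01 k x; rewrite ger0_norm.
have a0 x : `|1 - chi k x| @[k --> \oo] --> 0.
  rewrite (_ : 0 = `|1 - 1 : R|); last by rewrite subrr normr0.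
  by apply: cvg_norm; apply: cvgB; [exact: cvg_cst|exact: chi1].
have h0 x : 0 <= enorm (g x) `^ p + l * `|v x| `^ p by rewrite addr_ge0 ?mulr_ge0.
have [ia /(_ _ e0)[k1 Hk1]] := Int_cvg0 oO ih h0 ma aQ a0.
have [k2 Hk2] := harmonic_small K e0; pose k := maxn k1 k2.
have {Hk1} Ia := Hk1 k (leq_maxl _ _).
have {Hk2} kap := Hk2 k (leq_maxr _ _).
have [sc _ gc cz _] := Hchi k; set rr := r' * k.+1%:R in cz; set ka := K / k.+1%:R in gc kap.
have ka0 : 0 <= ka by rewrite divr_ge0 ?(ltW K0).
have [C C0 HC] := norm_powB p1 e0; have [C' C'0 HC'] := enorm_powB p1 N e0.
have lC0 : 0 < l * C + 1 by rewrite ltr_wpDl// mulr_ge0// ltW.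
have dv := divr_gt0 e0 lC0; have dg := divr_gt0 e0 C'0.
have [n1 Hn1] := vloc rr dv; have [n2 Hn2] := gloc rr dg.
have Tw n : test_function Omega (chi k \* u n) by exact: testM.
have gw n x : gradient (chi k \* u n) x = chi k x *: G n x + u n x *: gradient (chi k) x.
  exact: (gradientM _ sc (sm n)).
pose Q := 2 `^ p * (M `^ p * B + ka `^ p * 1).
have Q0 : 0 <= Q by rewrite mulr_ge0 ?addr_ge0 ?mulr_ge0.
have GQ n : gradInt (gradient (chi k \* u n)) <= Q.
  have j := itgD mO (itgZ mO (M `^ p) (iG n)) (itgZ mO (ka `^ p) (iP n)).
  have [_ _ _ iw] := test_W1 p1 oO (Tw n).
  apply: le_trans (Int_le mO iw (itgZ mO (2 `^ p) j) _) _ => [x _|].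
    rewrite gw; apply: le_trans (enormD_powR p1 _ _) _; rewrite !enormZ_powR ler_wpM2l//.
    apply: lerD; first rewrite ler_wpM2r//.
      have /andP[a b] := c01 k x.
      by rewrite (ger0_norm a) ge0_ler_powR ?nnegrE ?(ltW p0) ?(ltW M0).
    by rewrite mulrC ler_wpM2r// ge0_ler_powR ?nnegrE ?enorm_ge0 ?(ltW p0).
  rewrite (IntZ mO _ j) (IntD mO (itgZ mO (M `^ p) (iG n)) (itgZ mO (ka `^ p) (iP n))).
  rewrite (IntZ mO _ (iG n)) (IntZ mO _ (iP n)) P1'.
  by apply: ler_wpM2l => //; rewrite lerD2r; apply: ler_wpM2l.
have [n3 Hn3] := dEnergy_small p1 oO l0 lP T P1 GB Gl Q0 e0.
pose n := maxn n3 (maxn n1 n2).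
have [|iD ID] := Hn1 n; first by rewrite /n !leq_max leqnn orbT.
have [|iE IE] := Hn2 n; first by rewrite /n !leq_max leqnn !orbT.
have Dn := le_trans (ler_norm _) (Hn3 n (leq_maxl _ _) _ _ (test_W01 p1 oO (Tw n)) (GQ n)).
have [mw1 mw2 iw1 iw2] := test_W1 p1 oO (Tw n).
have L := itg_young p1 oO (measurable_funTS (mG n)) mw2 (iG n) iw2.
have K' := itg_power p1 oO (measurable_funTS (mu_ n)) mw1 (iP n) iw1.
have j1 := itgB mO L (itgZ mO l K').
have j2 := itgD mO (iG n) (iP n).
have j3 := itgD mO (ia k) (itgZ mO ka j2).
have j4 := itgD mO (itgZ mO C' iE) (itgZ mO l (itgZ mO C iD)).
have j5 := itgD mO (itgZ mO (e * M) ih) (itgZ mO M j4).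
have j6 := itgD mO j3 j5; have j7 := itgD mO j1 j6.
have j8 := itgB mO ig (itgZ mO l iv).
have := Int_le mO j8 j7 _.
rewrite (IntB mO ig (itgZ mO l iv)) (IntZ mO _ iv) (IntD mO j1 j6) (IntD mO j3 j5) (IntB mO L (itgZ mO l K')).
rewrite (IntZ mO _ K') (IntD mO (ia k) (itgZ mO ka j2)) (IntZ mO _ j2) (IntD mO (iG n) (iP n)) P1'.
rewrite (IntD mO (itgZ mO (e * M) ih) (itgZ mO M j4)) (IntZ mO _ ih) (IntZ mO _ j4).
rewrite (IntD mO ig (itgZ mO l iv)) (IntZ mO _ iv).
rewrite (IntD mO (itgZ mO C' iE) (itgZ mO l (itgZ mO C iD))) (IntZ mO _ iE) (IntZ mO _ (itgZ mO C iD)) (IntZ mO _ iD).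
move=> H; have {}H : gradInt g - l * powInt v <= dEnergy (u n) (G n) (chi k \* u n) (gradient (chi k \* u n)) +
  (Int (fun x => `|1 - chi k x| * (enorm (g x) `^ p + l * `|v x| `^ p)) +
   ka * (Int (fun x => enorm (G n x) `^ p) + 1) +
   (e * M * (gradInt g + l * powInt v) + M * (C' * Int (fun x => E rr n x) + l * (C * Int (fun x => D rr n x))))).
  apply: H => x _; rewrite gw; apply: cutoff_energy => //; first exact: ltW.
  - by rewrite mulr_ge0 ?mulr_ge0// ltW.
  - by rewrite mulr_ge0 ?mulr_ge0// ltW.
  - have [a b] := andP (c01 k x); rewrite indicE; case: (boolP (x \in cube rr)) => [_|]; last first.
      by rewrite notin_setE => /cz[-> _]; rewrite !mul0r.
    apply: ler_wpM2l => //; rewrite mul1r -lerBlDl.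
    by apply: le_trans (HC' _ _); rewrite distrC ler_norm.
  - have [a b] := andP (c01 k x); rewrite indicE; case: (boolP (x \in cube rr)) => [_|]; last first.
      by rewrite notin_setE => /cz[-> _]; rewrite !mul0r.
    apply: ler_wpM2l => //; rewrite mul1r -lerBlDl.
    by apply: le_trans (HC _ _); rewrite ler_norm.
rewrite -lerBlDl; apply: le_trans H _.
have g1 : ka * (Int (fun x => enorm (G n x) `^ p) + 1) <= e * (B + 1).
  by apply: ler_pM => //; [rewrite addr_ge0// gradInt_ge0|rewrite lerD2r].
have g2 : C' * Int (fun x => E rr n x) <= e.
  by rewrite mulrC -ler_pdivlMr.
have g3 : l * (C * Int (fun x => D rr n x)) <= e.
  rewrite mulrA mulrC; apply: le_trans (ler_wpM2r _ ID) _; first by rewrite mulr_ge0// ltW.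
  by rewrite mulrAC ler_pdivrMr// ler_pM2l// lerDl.
have g4 := ler_wpM2l (ltW M0) (lerD g2 g3).
apply: le_trans (lerD Dn (lerD (lerD Ia g1) (lerD (lexx _) g4))) _.
by rewrite le_eqVlt; apply/orP; left; apply/eqP; ring.
Qed.

Lemma limit_eigen w gw : W01 w gw -> dEnergy v g w gw = 0.
Proof.
move=> Ww; apply/eqP; rewrite -normr_le0.
apply: (@ler_epsM _ _ _ (gradInt g + gradInt gw)) => [|e e0]; first by rewrite addr_ge0 ?gradInt_ge0.
have [d d0 H] := dEnergy_bound p1 oO l0 lP e0.
apply: le_trans (H _ _ _ _ limit_W01 Ww) _; rewrite lerD2r.
by rewrite ler_pdivrMr ?mulr_gt0// mul0r subr_le0 limit_le.
Qed.

End limit_function.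

(** * The spectrum *)

Section eigenvalue.
Context {R : realType} {N : nat} {p : R} (p1 : 1 < p).
Variables (Omega : set 'rV[R]_N).
Hypothesis oO : open Omega.
Local Notation X := 'rV[R]_N.
Local Notation mu := (@lebesgue_rV R N).
Local Notation Int := (Int Omega).
Local Notation itg := (itg Omega).
Local Notation powInt := (@powInt R N p Omega).
Local Notation gradInt := (@gradInt R N p Omega).
Local Notation W01 := (@W01 R N p Omega).

Let p0 : 0 < p. Proof. exact: lt_trans p1. Qed.

Let mO : measurable Omega. Proof. exact: open_measurable_rV. Qed.

Let rootK (s : R) : 0 <= s -> (s `^ p^-1) `^ p = s.
Proof. by move=> s0; rewrite -powRrM mulVf ?gt_eqF// powRr1. Qed.

Lemma powInt_eq0 (f : X -> R) : measurable_fun Omega f -> itg (fun x => `|f x| `^ p) -> powInt f = 0 ->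
  {ae mu, forall x, Omega x -> f x = 0}.
Proof.
move=> mf itf Pf.
have mp : measurable_fun Omega (fun x => (`|f x| `^ p)%:E).
  by apply/measurable_EFinP; exact: measurable_powR_norm.
have : (\int[mu]_(x in Omega) `|(`|f x| `^ p)%:E| = 0)%E.
  rewrite -[RHS]/((0:R)%:E) -Pf -(EFin_Int mO itf); apply: eq_integral => x _.
  by rewrite gee0_abs// lee_fin powR_ge0.
move=> /(ae_eq_integral_abs mu mO mp); apply: filterS => x H Ox.
by have [/eqP] := H Ox; rewrite powR_eq0 normr_eq0 => /andP[/eqP].
Qed.

(** A continuous function positive at [c] is positive on a box around [c], and boxes with nonempty
    interior have positive measure. *)
Lemma bump_mass (c : X) : Omega c -> exists2 phi, test_function Omega phi & 0 < powInt phi.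
Proof.
move=> Oc; have := open_nbhs_nbhs (conj oO Oc).
rewrite -nbhs_ballE => -[d /= d0 Hd].
have r0 : 0 < d / 2 by rewrite divr_gt0.
have T : test_function Omega (bump c (d / 2)).
  apply: bump_test => // x xc; apply: Hd.
  rewrite -ball_normE /= distrC; apply: le_lt_trans xc _.
  by rewrite ltr_pdivrMr// ltr_pMr// ltr1n.
exists (bump c (d / 2)) => //.
have [m1 _ i1 _] := test_W1 p1 oO T.
rewrite lt0r powInt_ge0 andbT; apply/eqP => P0.
have [A [mA A0 HA]] := powInt_eq0 m1 i1 P0.
have : nbhs c [set x | 0 < bump c (d / 2) x].
  have := smooth_continuous (test_smooth T) (x := c).
  by move=> /cvgr_gt; apply; exact: bump_center.
rewrite -nbhs_ballE => -[e /= e0 He].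
pose m := Num.min e d / 2.
have m0 : 0 < m by rewrite divr_gt0// lt_min e0.
have mm : m < Num.min e d by rewrite ltr_pdivrMr// ltr_pMr ?ltr1n// lt_min e0.
pose U := [set x : X | forall i, `[c ord0 i - m, c ord0 i + m]%classic (x ord0 i)].
have UA : U `<=` A.
  move=> x Ux; apply: HA => /=.
  have xc : `|x - c| <= m.
    have := cubeE (N := N) (ltW m0); rewrite /cube => /seteqP[_]; apply => i /=.
    by have := Ux i; rewrite /= !in_itv/= !mxE => /andP[h1 h2]; rewrite lerBrDl h1 lerBlDl.
  have bx h : m < h -> ball c h x by move=> mh; rewrite -ball_normE /= distrC (le_lt_trans xc).
  have := He x (bx _ (lt_le_trans mm _)); rewrite ge_min lexx => /(_ isT) b0.
  have Ox : Omega x by apply/Hd/bx/(lt_le_trans mm); rewrite ge_min lexx orbT.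
  by move=> bx0; move: b0; rewrite /= (bx0 Ox) ltxx.
have mU : measurable U.
  rewrite (_ : U = \bigcap_(i : 'I_N) [set x : X | `[c ord0 i - m, c ord0 i + m]%classic (x ord0 i)]).
    apply: fin_bigcap_measurable => // i _.
    by rewrite -[X in measurable X]setTI; exact: (measurable_coord i).
  by apply/seteqP; split=> x /= Ax i; [move=> _; exact: Ax|exact: Ax].
have : (mu U <= 0)%E by rewrite -A0; apply: le_measure; rewrite ?inE.
rewrite (@lebesgue_rV_box R N (fun i => `[c ord0 i - m, c ord0 i + m]%classic))//.
rewrite leNgt => /negP; apply.
elim/big_ind : _ => // [a b|i _]; first exact: mule_gt0.
rewrite lebesgue_measure_itv/= lte_fin ler_ltD ?gtrN//.
rewrite -EFinD lte_fin (_ : _ - _ = m + m) ?addr_gt0//; ring.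
Qed.

Hypothesis Ononempty : Omega !=set0.

(** Normalising a test function turns the infimum into a homogeneous inequality; a bump in Omega
    keeps the infimum finite. *)
Lemma lambda_p_real : exists2 l : R, lambda_p p Omega = l%:E &
  0 <= l /\ forall phi, test_function Omega phi -> l * powInt phi <= gradInt (gradient phi).
Proof.
have norm1 phi : test_function Omega phi -> 0 < powInt phi ->
    (lambda_p p Omega <= (gradInt (gradient phi) / powInt phi)%:E)%E.
  move=> T P0; pose c := powInt phi `^ (- p^-1).
  have [m1 m2 i1 i2] := test_W1 p1 oO T; have Tc := testZ c T.
  have [_ _ j1 j2] := test_W1 p1 oO Tc.
  have cp : `|c| `^ p = (powInt phi)^-1.
    by rewrite ger0_norm ?powR_ge0// /c -powRrM mulNr mulVf ?gt_eqF// powR_inv1 ?(ltW P0).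
  rewrite mulrC -cp -(gradIntZ oO c i2).
  have -> : gradInt (fun x => c *: gradient phi x) = gradInt (gradient (fun x => c * phi x)).
    by apply: Int_eq => x _; rewrite (gradientZ _ _ (test_smooth T)).
  rewrite -(pint_grad_gradInt oO j2); apply: ereal_inf_lbound; exists (fun x => c * phi x) => //.
  by split=> //; rewrite (pint_Pow oO j1) (powIntZ oO c i1) cp mulVf ?gt_eqF.
have l0 : (0 <= lambda_p p Omega)%E.
  by apply/ereal_infP => _ [phi _ <-]; apply: integral_ge0 => x _; rewrite lee_fin powR_ge0.
have [c Oc] := Ononempty; have [phi T P0] := bump_mass Oc.
have lfin : lambda_p p Omega \is a fin_num.
  by rewrite ge0_fin_numE// (le_lt_trans (norm1 _ T P0))// ltry.
exists (fine (lambda_p p Omega)); rewrite ?fineK//; split; first exact: fine_ge0.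
move=> psi S; have [P00|P00] := eqVneq (powInt psi) 0; first by rewrite P00 mulr0 gradInt_ge0.
have Pp : 0 < powInt psi by rewrite lt0r P00 powInt_ge0.
by rewrite -ler_pdivlMr// -lee_fin fineK//; exact: norm1.
Qed.

Variable l : R.
Hypotheses (l0 : 0 <= l) (lE : lambda_p p Omega = l%:E)
  (lP : forall phi, test_function Omega phi -> l * powInt phi <= gradInt (gradient phi)).

Lemma p_laplacianE (u v : sobolev p Omega) :
  p_laplacian u v = @plapInt R N p Omega (weak_grad u) (weak_grad v).
Proof. by []. Qed.

Lemma p_powerE (u v : sobolev p Omega) : p_power u v = @powerInt R N p Omega u v.
Proof. by []. Qed.

Lemma eigen_ge t : eigen_spectrum p Omega t -> l <= t.
Proof.
move=> [u [u0 nu H]]; have := H u u0; rewrite p_laplacianE p_powerE.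
have [m1 m2 i1 i2] := sobolev_W1 u.
have -> : @plapInt R N p Omega (weak_grad u) (weak_grad u) = gradInt (weak_grad u).
  by apply: Int_eq => x _; rewrite (dotp_plap p1).
have -> : @powerInt R N p Omega u u = powInt u.
  by apply: Int_eq => x _; rewrite -dotp_plap_vec1 (dotp_plap p1) enorm_vec1.
have Pp : 0 < powInt u.
  rewrite lt0r powInt_ge0 andbT; apply/eqP => P0; apply: nu.
  exact: powInt_eq0 P0.
move=> E; have := W01_poincare p1 oO l0 lP (iffLR (sobolev0P p1 oO u) u0).
by rewrite E ler_pM2r.
Qed.

Lemma Lp_norm1 (u : sobolev p Omega) : Lp_norm p Omega u = 1%E <-> powInt u = 1.
Proof.
have [m1 m2 i1 i2] := sobolev_W1 u.
rewrite Lp_normE// pint_Pow// poweR_EFin; split=> [[H]|->]; last by rewrite powR1.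
by rewrite -[LHS](rootK (powInt_ge0 _ _)) H powR1.
Qed.

Lemma essential_ge t : essential_spectrum p Omega t -> l <= t.
Proof.
move=> [u [u0 u1 ut _] _]; rewrite -lee_fin; apply: (cvge_to_ge ut); apply: nearW => n.
have [m1 m2 i1 i2] := sobolev_W1 (u n).
rewrite (pint_grad_gradInt oO i2) lee_fin.
have := W01_poincare p1 oO l0 lP (iffLR (sobolev0P p1 oO (u n)) (u0 n)).
by rewrite (iffLR (Lp_norm1 (u n)) (u1 n)) mulr1.
Qed.

Variable u : nat -> X -> R.
Hypotheses (T : forall n, test_function Omega (u n)) (P1 : forall n, powInt (u n) = 1)
  (Gu : forall n, gradInt (gradient (u n)) <= l + n.+1%:R^-1).

Let Gl e : 0 < e -> exists n0, forall n, (n0 <= n)%N -> gradInt (gradient (u n)) <= l + e.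
Proof.
move=> e0; exists (Num.truncn e^-1) => n nn; apply: le_trans (Gu n) _; rewrite lerD2l.
rewrite invf_ple ?posrE//; apply/ltW/(lt_le_trans (truncnS_gt _)).
by rewrite ler_nat ltnS.
Qed.

Let GB n : gradInt (gradient (u n)) <= l + 1.
Proof. by apply: le_trans (Gu n) _; rewrite lerD2l invf_le1 ?ler1n. Qed.

(** The unit ball of the Sobolev norm consists of functions of energy at most 1, so the uniform
    estimate of the first variation applies directly. *)
Let dual_small (U : (sobolev p Omega)^nat) e : (forall n, sobolev_fun (U n) = u n) ->
  (forall n, weak_grad (U n) = gradient (u n)) -> 0 < e ->
  exists n0, forall n, (n0 <= n)%N ->
    (dual_norm (fun v => p_laplacian (U n) v - l * p_power (U n) v)%R <= e%:E)%E.
Proof.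
move=> Uu Ug e0; have [n0 H] := dEnergy_small p1 oO l0 lP T P1 GB Gl ler01 e0.
exists n0 => n nn; apply/ereal_supP => _ [v [v0 v1] <-]; rewrite lee_fin.
rewrite p_laplacianE p_powerE Uu Ug; apply: (H n nn); first exact/sobolev0P.
move: v1; rewrite (sobolev_normE oO (sobolev_W1 v)) lee_fin => v1.
have {}v1 : powInt v + gradInt (weak_grad v) <= 1.
  have s0 : 0 <= powInt v + gradInt (weak_grad v) by rewrite addr_ge0 ?powInt_ge0 ?gradInt_ge0.
  rewrite -(rootK s0).
  have <- : 1 `^ p = 1 :> R by rewrite powR1.
  by rewrite ge0_ler_powR ?nnegrE ?powR_ge0 ?(ltW p0).
by apply: le_trans v1; rewrite lerDr powInt_ge0.
Qed.

Lemma minimizing_palais_smale (U : (sobolev p Omega)^nat) :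
  (forall n, sobolev_fun (U n) = u n) -> (forall n, weak_grad (U n) = gradient (u n)) ->
  (forall n, sobolev0 (U n)) -> palais_smale l U.
Proof.
move=> Uu Ug U0; split=> //.
- by move=> n; apply/Lp_norm1; rewrite Uu.
- have Gn n : pint_grad p Omega (weak_grad (U n)) = (gradInt (gradient (u n)))%:E.
    by rewrite Ug pint_grad_gradInt//; have [] := test_W1 p1 oO (T n).
  under eq_fun do rewrite Gn; apply: cvg_EFin; first exact: nearW.
  apply/cvgrPdist_le => e e0; have [n0 H] := Gl e0.
  exists n0 => // n /= nn; rewrite distrC ger0_norm; first by rewrite lerBlDl H.
  by rewrite subr_ge0 -[l]mulr1 -(P1 n); exact: lP.
(* The zero function lies in the unit ball, so the supremum defining the dual norm is over a
   nonempty set and cannot be negative. *)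
- have ge0 n : (0 <= dual_norm (fun v => p_laplacian (U n) v - l * p_power (U n) v)%R)%E.
    have [m1 m2 i1 i2] := test_W1 p1 oO (T 0%N).
    have [z [zu zg z0]] := W01_sobolev p1 oO (W01Z p1 oO 0 (test_W01 p1 oO (T 0%N))).
    apply: (@le_trans _ _ `|p_laplacian (U n) z - l * p_power (U n) z|%:E).
      by rewrite lee_fin.
    apply: ereal_sup_ubound; exists z => //; split=> //.
    rewrite (sobolev_normE oO (sobolev_W1 z)) zu zg (powIntZ oO 0 i1) (gradIntZ oO 0 i2).
    by rewrite normr0 powR0 ?gt_eqF// !mul0r addr0 powR0 ?lee_fin// gt_eqF// invr_gt0.
  have fin : \forall n \near \oo,
      dual_norm (fun v => p_laplacian (U n) v - l * p_power (U n) v)%R \is a fin_num.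
    have [n0 H] := dual_small Uu Ug ltr01; exists n0 => // n /= nn.
    by rewrite ge0_fin_numE// (le_lt_trans (H n nn))// ltry.
  apply: cvg_EFin => //; apply/cvgrPdist_le => e e0.
  have [n0 H] := dual_small Uu Ug e0.
  near=> n; rewrite sub0r normrN /= ger0_norm ?fine_ge0//.
  rewrite -lee_fin fineK; last by near: n.
  by apply: H; near: n; exists n0.
Unshelve. all: by end_near. Qed.

(** The Euclidean ball lies in the cube of the same radius, so the retained mass is seen by the
    convergence on cubes and prevents the limit from vanishing. *)
Lemma minimizing_nonsingular (r e : R) : 0 < e ->
  (forall n, (e%:E <= pint p (Omega `&` eball r) (u n))%E) -> eigen_spectrum p Omega l.
Proof.
move=> e0 He; have mcu r' : measurable (cube r') := measurable_cube r'.
have Ts k := testS (@subsetT _ Omega) (T k).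
(* Extension by zero: the bounds on Omega become bounds on the whole space, where the compactness
   theorem is stated. *)
have offint (h : X -> R) : (forall x, ~ Omega x -> h x = 0) ->
    (\int[mu]_x (h x)%:E = \int[mu]_(x in Omega) (h x)%:E)%E.
  move=> hO; rewrite [RHS]integral_mkcond; apply: eq_integral => x _.
  by rewrite patchE; case: ifPn => //; rewrite notin_setE => /hO ->.
have uO k x : ~ Omega x -> `|u k x| `^ p = 0.
  by move=> nx; rewrite (test_out (T k) nx) normr0 powR0 ?gt_eqF.
have A1 k : (pint p setT (u k) <= 1%:E)%E.
  have [_ _ i1 _] := test_W1 p1 oO (T k).
  by rewrite /pint (offint _ (uO k)) -[X in (X <= _)%E]/(pint p Omega (u k)) (pint_Pow oO i1) P1.
have B1 k : (pint_grad p setT (gradient (u k)) <= (l + 1)%:E)%E.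
  have [_ _ _ i2] := test_W1 p1 oO (T k); rewrite /pint_grad offint.
    by rewrite -[X in (X <= _)%E]/(pint_grad p Omega (gradient (u k))) (pint_grad_gradInt oO i2) lee_fin.
  by move=> x nx; rewrite (gradient_out (T k) nx) enorm0 powR0 ?gt_eqF.
have [phi [phik C]] := rellich p1 Ts A1 B1.
pose w k := u (phi k).
have wT k : test_function Omega (w k) by exact: T.
have wP k : powInt (w k) = 1 by exact: P1.
have wG k : gradInt (gradient (w k)) <= l + 1 by exact: GB.
have wl d : 0 < d -> exists n0, forall n, (n0 <= n)%N -> gradInt (gradient (w n)) <= l + d.
  by move=> d0; have [n0 H] := Gl d0; exists n0 => n nn; apply/H/(leq_trans nn).
have [v mv vL] := Lp_local_complete p1 (fun k => measurable_smooth (test_smooth (wT k))) C.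
have gC := gradient_Cauchy p1 oO l0 lP wT wP wG wl C.
have [g mg gL] := Lp_local_complete_rV p1 (fun k => measurable_gradient (test_smooth (wT k))) gC.
have W := limit_W01 p1 oO wT wP wG mv mg vL gL.
have [z [zv zg z0]] := W01_sobolev p1 oO W.
exists z; split=> //.
  rewrite zv; apply: (limit_nonzero p1 oO wT wP mv vL (r := r) e0) => n.
  have [_ _ i1 _] := test_W1 p1 oO (wT n).
  have mun : measurable_fun setT (w n) := measurable_smooth (test_smooth (wT n)).
  rewrite -lee_fin -(local_pint oO r (measurable_powR_norm p mun) _ (uO _) i1)//.
  apply: le_trans (He (phi n)) _; apply: pint_subset => //.
  - apply: measurableI => //; rewrite -[eball r]setTI.
    exact: (measurable_fun_ltr measurable_enorm (measurable_cst r)).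
  - by move=> x [_ xr]; apply: le_trans (mx_norm_le_enorm x) (ltW xr).
  - exact: measurable_funTS.
move=> h h0; apply/eqP; rewrite -subr_eq0; apply/eqP.
rewrite p_laplacianE p_powerE zv zg.
by apply: (limit_eigen p1 oO l0 lP wT wP wG wl mv mg vL gL); exact/sobolev0P.
Qed.
End eigenvalue.

Theorem mainTheorem2 (R : realType) (N : nat) (p : R) (Omega : set 'rV[R]_N) :
  (0 < N)%N -> 1 < p -> open Omega -> Omega !=set0 ->
  exists l : R, [/\ lambda_p p Omega = l%:E,
    variational_spectrum p Omega l &
    lbound (variational_spectrum p Omega) l].
Proof.
move=> _ p1 oO On; have p0 : 0 < p := lt_trans ltr01 p1.
have [l lE [l0 lP]] := lambda_p_real p1 oO On; exists l; split=> //; last first.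
  move=> t [/(essential_ge p1 oO l0 lP)|/(eigen_ge p1 oO l0 lP)]; exact.
have /choice[u Hu] n : exists phi, [/\ test_function Omega phi, pint p Omega phi = 1%E &
    (pint_grad p Omega (gradient phi) < (l + n.+1%:R^-1)%:E)%E].
  have n0 : 0 < n.+1%:R^-1 :> R by rewrite invr_gt0.
  have [|_ [phi [T P1] <-] lt] := lb_ereal_inf_adherent n0 (S := [set pint_grad p Omega (gradient phi) | phi in
    [set phi | test_function Omega phi /\ pint p Omega phi = 1%E]]).
    by rewrite -/(lambda_p p Omega) lE.
  by exists phi; split=> //; move: lt; rewrite -/(lambda_p p Omega) lE.
have T n : test_function Omega (u n) by have [] := Hu n.
have P1 n : @powInt R N p Omega (u n) = 1.
  have [_ + _] := Hu n; have [_ _ i1 _] := test_W1 p1 oO (T n).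
  by rewrite (pint_Pow oO i1) => -[].
have Gu n : @gradInt R N p Omega (gradient (u n)) <= l + n.+1%:R^-1.
  have [_ _] := Hu n; have [_ _ _ i2] := test_W1 p1 oO (T n).
  by rewrite (pint_grad_gradInt oO i2) lte_fin => /ltW.
have /choice[U HU] n := W01_sobolev p1 oO (test_W01 p1 oO (T n)).
have Uu n : sobolev_fun (U n) = u n by have [] := HU n.
have Ug n : weak_grad (U n) = gradient (u n) by have [] := HU n.
have U0 n : sobolev0 (U n) by have [] := HU n.
have PS := minimizing_palais_smale p1 oO l0 lP T P1 Gu Uu Ug U0.
have [S|/existsNP[r /not_implyP[r0 nS]]] := pselect (singular U); first by left; exists U.
right.
(* Failure of convergence to 0 in the ball of radius [r]: infinitely many terms keep a fixed mass
   there. *)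
have [e e0 He] : exists2 e : R, 0 < e & forall m, exists2 n, (m <= n)%N &
    (e%:E <= pint p (Omega `&` eball r) (u n))%E.
  apply: contrapT => H; apply: nS.
  have L n : Lp_norm p (Omega `&` eball r) (U n) = (pint p (Omega `&` eball r) (u n) `^ p^-1)%E.
    by rewrite (Lp_normE p1) Uu.
  have small e : 0 < e -> exists m, forall n, (m <= n)%N ->
      (pint p (Omega `&` eball r) (u n) < e%:E)%E.
    move=> e0; apply: contrapT => H'; apply: H; exists e => // m.
    apply: contrapT => H''; apply: H'; exists m => n mn; rewrite ltNge; apply/negP => le.
    by apply: H''; exists n.
  have Lsmall e : 0 < e -> exists m, forall n, (m <= n)%N ->
      (0 <= Lp_norm p (Omega `&` eball r) (U n) <= e%:E)%E.
    move=> e0; have ep : 0 < e `^ p by rewrite powR_gt0.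
    have [m Hm] := small _ ep; exists m => n mn; rewrite L poweR_ge0/=.
    have -> : e%:E = ((e `^ p)%:E `^ p^-1)%E.
      by rewrite poweR_EFin -powRrM mulfV ?gt_eqF// powRr1 ?(ltW e0).
    apply: gt0_ler_poweR; rewrite ?invr_ge0 ?(ltW p0)//.
    - by rewrite in_itv/= pint_ge0// leey.
    - by rewrite in_itv/= lee_fin powR_ge0 leey.
    - exact/ltW/Hm.
  have [m1 Hm1] := Lsmall _ ltr01.
  apply: cvg_EFin.
    exists m1 => // n /= mn; have /andP[a b] := Hm1 n mn.
    by rewrite ge0_fin_numE// (le_lt_trans b)// ltry.
  apply/cvgrPdist_le => e e0; have [m Hm] := Lsmall _ e0.
  exists (maxn m m1) => // n /=; rewrite geq_max => /andP[mn m1n].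
  have /andP[a b] := Hm n mn; have /andP[_ b1] := Hm1 n m1n.
  have f : Lp_norm p (Omega `&` eball r) (U n) \is a fin_num.
    by rewrite ge0_fin_numE// (le_lt_trans b1)// ltry.
  by rewrite sub0r normrN ger0_norm ?fine_ge0// -lee_fin fineK.
(* [m <= s m] preserves the energy bound l + 1/(m+1) along the selected terms. *)
have /choice[s Hs] m : exists n, (m <= n)%N /\ (e%:E <= pint p (Omega `&` eball r) (u n))%E.
  by have [n mn h] := He m; exists n.
apply: (minimizing_nonsingular p1 oO l0 lP (u := fun m => u (s m)) _ _ _ e0 (r := r)) => n.
- exact: T.
- exact: P1.
- apply: le_trans (Gu _) _; rewrite lerD2l lef_pV2 ?posrE// ler_nat ltnS.
  exact: (Hs n).1.
- exact: (Hs n).2.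
Qed.
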